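(* Let $n\ge 1$ and $s\in(0,1)$. Let $\Omega\subseteq\mathbb{R}^n$ be a regular open, bounded set whose closure $\overline{\Omega}$ has positive reach $r_\Omega>0$, and let $t\in(0,r_\Omega)$. Let $u\in H^s(\mathbb{R}^n)$ be the unique weak solution of the fractional torsion problem $$(-\Delta)^s u=1 \ \text{ in }\Omega,\qquad u=0\ \text{ in }\mathbb{R}^n\setminus\Omega.$$ If there is a constant $c_\flat\in\mathbb{R}$ such that $$\mathcal{N}_s u=c_\flat\quad\text{on }\Gamma_t,$$ then $\Omega$ is a ball.
   Context: A set $\Omega\subseteq\mathbb{R}^n$ is regular open if it equals the interior of its closure. Reach: for a non-empty set $E\subseteq\mathbb{R}^n$, let $\mathrm{Unp}(E)$ be the set of $x\in\mathbb{R}^n$ for which $\{y\in E : \mathrm{dist}(x,E)=|x-y|\}$ is a singleton. For $x\in E$, $\mathrm{reach}(E,x)=\sup\{r>0 : B_r(x)\subseteq\mathrm{Unp}(E)\}$, and $\mathrm{reach}(E)=\inf_{x\in E}\mathrm{reach}(E,x)\in[0,+\infty]$. Here $r_\Omega=\mathrm{reach}(\overline\Omega)$ (possibly $+\infty$), and $\Omega$ is non-empty. Outer parallel set: $\Gamma_t=\{x\in\mathbb{R}^n : \mathrm{dist}(x,\Omega)=t\}$. Constant: $c_{n,s}=s(1-s)4^s\pi^{-n/2}\,\Gamma(n/2+s)/\Gamma(2-s)$. Function spaces and weak solutions: $H^s(\mathbb{R}^n)$ is the space of $u\in L^2(\mathbb{R}^n)$ with $\iint |u(x)-u(y)|^2|x-y|^{-n-2s}\,dx\,dy<\infty$;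 $\mathcal{H}^s_0(\Omega)=\{u\in H^s(\mathbb{R}^n): u=0\text{ on }\mathbb{R}^n\setminus\Omega\}$; and $$\mathcal{E}(u,v)=\frac{c_{n,s}}{2}\int_{\mathbb{R}^n}\int_{\mathbb{R}^n}\frac{(u(x)-u(y))(v(x)-v(y))}{|x-y|^{n+2s}}\,dx\,dy .$$ A weak solution of $(-\Delta)^su=1$ in $\Omega$, $u=0$ in $\mathbb{R}^n\setminus\Omega$, is a function $u\in\mathcal{H}^s_0(\Omega)$ with $\mathcal{E}(u,\phi)=\int_\Omega\phi\,dx$ for all $\phi\in\mathcal{H}^s_0(\Omega)$; it exists and is unique. Nonlocal normal derivative: for $x\in\mathbb{R}^n\setminus\overline\Omega$, $$\mathcal{N}_su(x)=c_{n,s}\int_\Omega\frac{u(x)-u(y)}{|x-y|^{n+2s}}\,dy ,$$ where $u(x)=0$ for such $x$. *)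

(* Defs.v *)
From HB Require Import structures.
From mathcomp Require Import all_boot all_order all_algebra.
From mathcomp Require Import all_classical all_reals all_analysis.

Set Implicit Arguments.
Unset Strict Implicit.
Unset Printing Implicit Defensive.

Import Order.TTheory GRing.Theory Num.Theory.
Import numFieldNormedType.Exports.

Local Open Scope classical_set_scope.
Local Open Scope ring_scope.

(* The sigma-algebra of 'rV[R]_n generated by the coordinates, that is, the
   Borel sigma-algebra of R^n (R being second countable). *)

Definition rV_display : measure_display -> measure_display.
Proof. exact. Qed.

Section measurable_rV.
Context {R : realType} {n : nat}.

Definition rV_coord (i : 'I_n) (x : 'rV[R]_n) : R := x ord0 i.

Let rV_set0 : g_sigma_preimage rV_coord set0.
Proof. exact: sigma_algebra0. Qed.

Let rV_setC A : g_sigma_preimage rV_coord A -> g_sigma_preimage rV_coord (~` A).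
Proof. exact: sigma_algebraC. Qed.

Let rV_bigcup (F : (set 'rV[R]_n)^nat) :
  (forall i, g_sigma_preimage rV_coord (F i)) ->
  g_sigma_preimage rV_coord (\bigcup_i F i).
Proof. exact: sigma_algebra_bigcup. Qed.

HB.instance Definition _ := @isMeasurable.Build
  (rV_display default_measure_display)
  'rV[R]_n (g_sigma_preimage rV_coord) rV_set0 rV_setC rV_bigcup.

End measurable_rV.

Lemma measurable_rV_coord (R : realType) n (i : 'I_n) :
  measurable_fun [set: 'rV[R]_n] (rV_coord i).
Proof.
move=> _ Y mY; rewrite setTI; apply: sub_sigma_algebra => /=.
rewrite -bigcup_seq/=; exists i => /=; first by rewrite mem_index_enum.
by exists Y => //; rewrite setTI.
Qed.

Lemma measurable_fun_rVP (R : realType) d (T : measurableType d) n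
    (f : T -> 'rV[R]_n) :
  (forall i, measurable_fun [set: T] (fun t => f t ord0 i)) ->
  measurable_fun [set: T] f.
Proof.
move=> mf; have prefS :
    g_sigma_preimage (fun i => rV_coord i \o f) `<=` measurable.
  apply: smallest_sub; first exact: sigma_algebra_measurable.
  case: n => [|n] in f mf *; first by rewrite big_ord0.
  rewrite -bigcup_mkord_ord; apply: bigcup_sub => i Ii.
  by move=> A [B mB <-]; exact: mf.
by move=> _ A mA; apply: prefS; rewrite g_sigma_preimage_comp; exists A.
Qed.

(* Lebesgue measure on 'rV[R]_n, by recursion on n: the Dirac mass on the point
   'rV[R]_0, then the image of the product measure under R x R^n -> R^n.+1. *)

Section rV_cons.
Context {R : realType} {n : nat}.

Definition rV_cons (p : measurableTypeR R * 'rV[R]_n) : 'rV[R]_n.+1 :=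
  \row_i oapp (fun j => p.2 ord0 j) p.1 (unlift ord0 i).

Definition rV_uncons (x : 'rV[R]_n.+1) : measurableTypeR R * 'rV[R]_n :=
  (x ord0 ord0, \row_j x ord0 (lift ord0 j)).

Lemma rV_consK : cancel rV_cons rV_uncons.
Proof.
move=> [a x]; rewrite /rV_uncons !mxE unlift_none; congr pair.
by apply/rowP => j; rewrite !mxE liftK.
Qed.

Lemma measurable_rV_cons : measurable_fun setT rV_cons.
Proof.
apply: measurable_fun_rVP => i; under eq_fun do rewrite mxE.
case: unliftP => [j _|_] /=; last exact: measurable_fst.
by apply: (measurableT_comp (measurable_rV_coord j)); exact: measurable_snd.
Qed.

Lemma measurable_rV_uncons : measurable_fun setT rV_uncons.
Proof.
apply/measurable_fun_pairP; split; first exact: (measurable_rV_coord ord0).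
apply: measurable_fun_rVP => j; rewrite /comp; under eq_fun do rewrite mxE.
exact: measurable_rV_coord.
Qed.

Variable mu : {sigma_finite_measure set 'rV[R]_n -> \bar R}.

Definition rV_cons_measure : set 'rV[R]_n.+1 -> \bar R :=
  pushforward ((@lebesgue_measure R) \x mu)%E rV_cons.

HB.instance Definition _ := Measure.copy rV_cons_measure
  (measure_function_pushforward__canonical__measure_function_Measure _
     measurable_rV_cons).

Lemma rV_cons_measure_sigma_finite : sigma_finite setT rV_cons_measure.
Proof.
have /sigma_finiteP[F [TF ndF Ffin]] := sigma_finiteT (@lebesgue_measure R).
have /sigma_finiteP[G [TG ndG Gfin]] := sigma_finiteT mu.
exists (fun k => rV_uncons @^-1` (F k `*` G k)).
  rewrite -preimage_bigcup; apply/esym/seteqP; split => // x _.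
  have [i _ Fi] : (\bigcup_i F i) (rV_uncons x).1 by rewrite -TF.
  have [j _ Gj] : (\bigcup_i G i) (rV_uncons x).2 by rewrite -TG.
  exists (maxn i j) => //; split.
    by apply: (subsetPset _ _ (ndF _ _ (leq_maxl i j))).
  by apply: (subsetPset _ _ (ndG _ _ (leq_maxr i j))).
move=> k; have [mF Fk] := Ffin k; have [mG Gk] := Gfin k; split.
  rewrite -[X in measurable X]setTI; apply: measurable_rV_uncons => //.
  exact: measurableX.
rewrite /rV_cons_measure /pushforward -comp_preimage.
rewrite (_ : rV_uncons \o rV_cons = id); last by apply/funext; exact: rV_consK.
rewrite preimage_id product_measure1E//.
by rewrite lte_mul_pinfty// ge0_fin_numE.
Qed.

HB.instance Definition _ := Measure_isSigmaFinite.Build _ _ _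
  rV_cons_measure rV_cons_measure_sigma_finite.

End rV_cons.

Fixpoint lebesgue_rV (R : realType) (n : nat) :
    {sigma_finite_measure set 'rV[R]_n -> \bar R} :=
  match n with
  | 0 => @dirac _ 'rV[R]_0 0 R
  | n'.+1 => rV_cons_measure (lebesgue_rV R n')
  end.

Lemma lebesgue_rV_box (R : realType) n (A : 'I_n -> set (measurableTypeR R)) :
  (forall i, measurable (A i)) ->
  lebesgue_rV R n [set x | forall i, A i (x ord0 i)] =
  (\prod_(i < n) lebesgue_measure (A i))%E.
Proof.
elim: n A => [|n IH] A mA.
  by rewrite big_ord0 /= diracE mem_set// => -[].
have mB : measurable [set x : 'rV[R]_n | forall i, A (lift ord0 i) (x ord0 i)].
  rewrite [X in measurable X](_ : _ = \bigcap_(i in [set: 'I_n])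
      (rV_coord i @^-1` (A (lift ord0 i)))).
    apply: fin_bigcap_measurable => // i _.
    rewrite -[X in measurable X]setTI.
    exact: (@measurable_rV_coord R n i measurableT _ (mA (lift ord0 i))).
  by apply/seteqP; split=> x /= Ax i => [_|]; exact: Ax.
rewrite big_ord_recl -IH// /= /rV_cons_measure /pushforward.
rewrite -product_measure1E//; congr product_measure1.
apply/seteqP; split=> -[a x] /= => [Ax|[Aa Ax] i].
  split=> [|i]; first by have := Ax ord0; rewrite mxE unlift_none.
  by have := Ax (lift ord0 i); rewrite mxE liftK.
by rewrite mxE; case: unliftP => [j ->|->] //=; exact: Ax.
Qed.

Definition GammaR (R : realType) (z : R) : R :=
  \int[lebesgue_measure]_(x in `]0, +oo[) (x `^ (z - 1) * expR (- x)).

Section euclidean.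
Context {R : realType} {n : nat}.
Implicit Types (x y : 'rV[R]_n) (E A : set 'rV[R]_n) (r : R).

(* The library norm `|x| on 'rV[R]_n is the sup norm; it induces the usual
   topology and the usual bounded sets, but not the Euclidean distance. *)
Definition enorm x : R := Num.sqrt (\sum_(i < n) x ord0 i ^+ 2).

Definition eball x r : set 'rV[R]_n := [set y | enorm (x - y) < r].

(* Meaningful for E !=set0 only: the real infimum of set0 is 0. *)
Definition dist_set x E : R := inf [set enorm (x - y) | y in E].

Definition Unp E : set 'rV[R]_n :=
  [set x | exists y,
     [set z | E z /\ dist_set x E = enorm (x - z)] = [set y]].

(* The maximum with 0 makes the supremum of set0 equal to 0 instead of -oo. *)
Definition reach_at E x : \bar R :=
  maxe 0%E
    (ereal_sup [set r%:E | r in [set r | 0 < r /\ eball x r `<=` Unp E]]).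

Definition reach E : \bar R := ereal_inf [set reach_at E x | x in E].

Definition parallel_set A (t : R) : set 'rV[R]_n := [set x | dist_set x A = t].

Definition is_eball A : Prop := exists x r, 0 < r /\ A = eball x r.

End euclidean.

Definition frac_const (R : realType) (n : nat) (s : R) : R :=
  s * (1 - s) * 4 `^ s * pi `^ (- (n%:R / 2)) *
  GammaR (n%:R / 2 + s) / GammaR (2 - s).

Section fractional.
Context {R : realType} {n : nat}.
Variable s : R.
Implicit Types (u v phi : 'rV[R]_n -> R) (A : set 'rV[R]_n).

Local Notation mu := (lebesgue_rV R n).

Definition Hs : set ('rV[R]_n -> R) := [set u |
  u \in Lfun mu 2%:E /\
  (\int[mu]_x \int[mu]_y
     (`|u x - u y| ^+ 2 * enorm (x - y) `^ (- n%:R - 2 * s))%:E < +oo)%E].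

(* Elements are functions, not classes modulo a.e. equality: u vanishes at every
   point outside A. Each class vanishing a.e. outside A has such a
   representative when A is measurable. *)
Definition Hs0 A : set ('rV[R]_n -> R) :=
  [set u | Hs u /\ forall x, ~ A x -> u x = 0].

(* Values are in \bar R, so that equations with a real right-hand side do not
   rely on a default value for divergent integrals. *)
Definition frac_form u v : \bar R :=
  ((frac_const n s / 2)%:E * \int[mu]_x \int[mu]_y
     ((u x - u y) * (v x - v y) / enorm (x - y) `^ (n%:R + 2 * s))%:E)%E.

Definition torsion_weak_solution A u : Prop :=
  Hs0 A u /\
  forall phi, Hs0 A phi -> frac_form u phi = (\int[mu]_(x in A) (phi x)%:E)%E.

Definition nonlocal_normal A u (x : 'rV[R]_n) : \bar R :=
  ((frac_const n s)%:E * \int[mu]_(y in A)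
     ((u x - u y) / enorm (x - y) `^ (n%:R + 2 * s))%:E)%E.

End fractional.

(* Main.v *)
Require Import Defs.
From mathcomp Require Import all_boot all_order all_algebra.
From mathcomp Require Import all_classical all_reals all_analysis.
From mathcomp Require Import measurable_realfun ring lra.

Set Implicit Arguments.
Unset Strict Implicit.
Unset Printing Implicit Defensive.

Import Order.TTheory GRing.Theory Num.Theory.
Import numFieldNormedType.Exports.

Local Open Scope classical_set_scope.
Local Open Scope ring_scope.

(** Let d be the distance to Omega and Gamma_t its level set d = t. The proof
  moves a plane x . e = l in from infinity, for a fixed unit vector e, and
  watches the parallel neighbourhood {d < t} instead of Omega itself.

  A position l is admissible ([plane_ok]) when the reflection in the plane
  carries the part of {d < t} on its right into {d < t}. At the critical
  position ([critical_plane]) the surface Gamma_t contains either two distinct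
  points that are symmetric about the plane, or pairs of points that differ by
  a multiple of e and merge at a point of the plane. These are the two
  classical contact cases, but the second one is expressed by a sequence, so
  that no tangent space to Gamma_t is needed. Positive reach of the closure of
  Omega allows one to move away from this closure until the distance t is attained
  ([reach_far]), and this transfers admissibility from {d < t} to Omega
  ([plane_ok_domain]).

  Let R be the reflection in an admissible plane. A weak maximum principle
  gives u <= u o R almost everywhere on the right of the plane
  ([reflected_le]): the weak equation is tested with the odd function that
  equals the positive part of u - u o R on the right, and the kernel is larger
  between points of the same side than between a point and the mirror image of
  the other.

  For x on Gamma_t the nonlocal normal derivative is, up to a negative factor,
  the potential of u at x, that is the integral of u(y) |x - y|^(-n-2s), so this
  potential is constant on Gamma_t ([potential_const]). Subtracting it at the
  two symmetric points, or passing to the limit in its difference quotients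
  along the merging pairs, shows that u is orthogonal to a weight D that is odd
  under R and positive on the right. Folding the integral along the plane, the
  integral of (u o R - u) D over the right side is zero while its integrand is
  nonnegative; hence u = u o R almost everywhere ([symmetric_of_pair],
  [symmetric_of_tangency]). As u vanishes on no open part of Omega
  ([weak_solution_nonvanishing]), the regular open set Omega is symmetric about
  the critical plane ([symmetric_domain]).

  So in every direction Omega is symmetric about some plane and monotone beyond
  it, and a bounded open set with these properties is a ball
  ([symmetric_is_eball]). Neither regularity of u nor a boundary lemma of Hopf
  type enters: all inequalities for u hold almost everywhere and come from the
  weak formulation. *)

(** * Euclidean geometry and reflections *)
Section euclid.
Context {R : realType} {n : nat}.
Implicit Types (x y z e : 'rV[R]_n) (a r l : R).

Definition dot x y : R := \sum_(i < n) x ord0 i * y ord0 i.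

Lemma dotC x y : dot x y = dot y x.
Proof. by apply: eq_bigr => i _; rewrite mulrC. Qed.

Lemma dotDl x y z : dot (x + y) z = dot x z + dot y z.
Proof. by rewrite -big_split; apply: eq_bigr => i _; rewrite mxE mulrDl. Qed.

Lemma dotZl a x z : dot (a *: x) z = a * dot x z.
Proof. by rewrite mulr_sumr; apply: eq_bigr => i _; rewrite mxE mulrA. Qed.

Lemma dotDr x y z : dot z (x + y) = dot z x + dot z y.
Proof. by rewrite dotC dotDl !(dotC z). Qed.

Lemma dotZr a x z : dot z (a *: x) = a * dot z x.
Proof. by rewrite dotC dotZl (dotC z). Qed.

Lemma dotNl x z : dot (- x) z = - dot x z.
Proof. by rewrite -scaleN1r dotZl mulN1r. Qed.

Lemma dotNr x z : dot z (- x) = - dot z x.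
Proof. by rewrite dotC dotNl (dotC z). Qed.

Lemma dot0l x : dot 0 x = 0.
Proof. by rewrite -(subrr 0) dotDl dotNl subrr. Qed.

Lemma dot0r x : dot x 0 = 0.
Proof. by rewrite dotC dot0l. Qed.

Definition dotE := (dotDl, dotDr, dotNl, dotNr, dotZl, dotZr).

Lemma dot_ge0 x : 0 <= dot x x.
Proof. by apply: sumr_ge0 => i _; rewrite -expr2 sqr_ge0. Qed.

Lemma enormE x : enorm x = Num.sqrt (dot x x).
Proof. by congr Num.sqrt; apply: eq_bigr => i _; rewrite expr2. Qed.

Lemma enorm_sq x : enorm x ^+ 2 = dot x x.
Proof. by rewrite enormE sqr_sqrtr// dot_ge0. Qed.

Lemma enorm_ge0 x : 0 <= enorm x.
Proof. exact: sqrtr_ge0. Qed.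

Lemma le_enorm x r : 0 <= r -> (enorm x <= r) = (dot x x <= r ^+ 2).
Proof. by move=> r0; rewrite -enorm_sq ler_sqr ?nnegrE// enorm_ge0. Qed.

Lemma lt_enorm x r : 0 <= r -> (enorm x < r) = (dot x x < r ^+ 2).
Proof. by move=> r0; rewrite -enorm_sq ltr_sqr ?nnegrE// enorm_ge0. Qed.

Lemma enormZ a x : enorm (a *: x) = `|a| * enorm x.
Proof.
by rewrite !enormE !dotE mulrA -expr2 sqrtrM ?sqr_ge0// sqrtr_sqr.
Qed.

Lemma enormN x : enorm (- x) = enorm x.
Proof. by rewrite -scaleN1r enormZ normrN1 mul1r. Qed.

Lemma enormBC x y : enorm (x - y) = enorm (y - x).
Proof. by rewrite -enormN opprB. Qed.

Lemma enorm0 : enorm (0 : 'rV[R]_n) = 0.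
Proof. by rewrite enormE dot0l sqrtr0. Qed.

Lemma coord_le_enorm x i : `|x ord0 i| <= enorm x.
Proof.
rewrite -ler_sqr ?nnegrE ?enorm_ge0// enorm_sq -normrX ger0_norm ?sqr_ge0//.
rewrite /dot (bigD1 i)//= -expr2 lerDl sumr_ge0// => j _.
by rewrite -expr2 sqr_ge0.
Qed.

Lemma normr_le_enorm x : `|x| <= enorm x.
Proof.
rewrite /Num.norm/= mx_normrE bigmax_le ?enorm_ge0// => -[i j] _ /=.
by rewrite ord1 coord_le_enorm.
Qed.

Lemma coord_le_normr x i : `|x ord0 i| <= `|x|.
Proof.
rewrite [leRHS]/Num.norm/= mx_normrE.
by rewrite (le_bigmax _ (fun k => `|x k.1 k.2|) (ord0, i)).
Qed.

Lemma enorm_le_normr x : enorm x <= n%:R * `|x|.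
Proof.
rewrite le_enorm ?mulr_ge0// exprMn.
apply: (@le_trans _ _ (n%:R * `|x| ^+ 2)); last first.
  rewrite ler_wpM2r ?sqr_ge0// -natrX ler_nat.
  by case: (n) => // m; rewrite leq_pmulr.
rewrite mulr_natl -[X in _ *+ X]card_ord -sumr_const; apply: ler_sum => i _.
by rewrite -expr2 -real_normK ?num_real// ler_sqr ?nnegrE// coord_le_normr.
Qed.

Lemma dot_eq0 x : dot x x = 0 -> x = 0.
Proof.
rewrite -enorm_sq => /eqP; rewrite sqrf_eq0 => /eqP x0; apply/eqP.
by rewrite -normr_eq0 eq_le normr_ge0 andbT -x0 normr_le_enorm.
Qed.

Lemma enorm_eq0 x : enorm x = 0 -> x = 0.
Proof. by move=> x0; apply: dot_eq0; rewrite -enorm_sq x0 expr0n. Qed.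

Lemma enorm_gt0 x : x != 0 -> 0 < enorm x.
Proof.
by move=> x0; rewrite lt_def enorm_ge0 andbT; apply: contra x0 => /eqP/enorm_eq0 ->.
Qed.

Lemma dot_le_enorm x y : dot x y <= enorm x * enorm y.
Proof.
have [->|y0] := eqVneq y 0.
  by rewrite enorm0 mulr0 dot0r.
have [->|x0] := eqVneq x 0.
  by rewrite dot0l enorm0 mul0r.
have := dot_ge0 (enorm y *: x - enorm x *: y).
rewrite !dotE (dotC y x) -!enorm_sq.
have px := enorm_gt0 x0; have py := enorm_gt0 y0 => h.
have {}h : 0 <= (enorm x * enorm y) * (enorm x * enorm y - dot x y).
  by nra.
by move: h; rewrite pmulr_rge0 ?mulr_gt0// subr_ge0.
Qed.

Lemma ler_enormD x y : enorm (x + y) <= enorm x + enorm y.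
Proof.
rewrite le_enorm ?addr_ge0 ?enorm_ge0// !dotE (dotC y x) -!enorm_sq.
by have := dot_le_enorm x y; nra.
Qed.

Lemma ler_enormB x y z : enorm (x - z) <= enorm (x - y) + enorm (y - z).
Proof. by have := ler_enormD (x - y) (y - z); rewrite addrA subrK. Qed.

Lemma enorm_lip x y : `|enorm x - enorm y| <= enorm (x - y).
Proof.
have h := ler_enormD (x - y) y; have h' := ler_enormD (y - x) x.
rewrite !subrK in h h'; rewrite (enormBC y x) in h'; rewrite ler_norml; lra.
Qed.

Lemma enorm_ball x r : 0 < r ->
  exists2 r', 0 < r' & forall y, `|x - y| < r' -> enorm (x - y) < r.
Proof.
move=> r0; exists (r / n.+1%:R); first by rewrite divr_gt0.
move=> y; rewrite ltr_pdivlMr// => h; apply: le_lt_trans (enorm_le_normr _) _.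
by apply: le_lt_trans h; rewrite mulrC ler_wpM2l// ler_nat.
Qed.

Lemma lip_continuous (f : 'rV[R]_n -> R) c :
  (forall x y, `|f x - f y| <= c * enorm (x - y)) -> continuous f.
Proof.
move=> lf x; apply/(cvgrPdist_lt (FF := nbhs_filter x)) => r r0.
have c0 : 0 < `|c| + 1 by rewrite ltr_wpDl.
have [r' r'0 h] := enorm_ball x (divr_gt0 r0 c0).
apply/nbhs_ballP; exists r' => // y; rewrite -ball_normE/= => /h.
rewrite ltr_pdivlMr// => hr; apply: le_lt_trans (lf _ _) _.
apply: le_lt_trans hr; rewrite mulrC ler_wpM2l ?enorm_ge0//.
by rewrite (le_trans (ler_norm _))// lerDl.
Qed.

Lemma enorm_continuous : continuous (@enorm R n).
Proof.
by apply: (@lip_continuous _ 1) => x y; rewrite mul1r enorm_lip.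
Qed.

(** For a unit vector [e], the reflection in the hyperplane [dot x e = l]. *)
Definition refl e l x := x - (2 * (dot x e - l)) *: e.

Section refl.
Variables (e : 'rV[R]_n) (l : R).
Hypothesis e1 : dot e e = 1.

Lemma dot_refl x : dot (refl e l x) e = 2 * l - dot x e.
Proof. by rewrite !dotE e1; ring. Qed.

Lemma reflK : involutive (refl e l).
Proof.
move=> x; rewrite {1}/refl dot_refl /refl -addrA -opprD -scalerDl.
rewrite [X in X *: e](_ : _ = 0) ?scale0r ?subr0//; ring.
Qed.

(** The excess has the sign that tells whether [x] and [y] lie on the same side
  of the hyperplane; every comparison of distances or kernels under a reflection
  reduces to this identity. *)
Lemma dot_sub_refl x y :
  dot (x - refl e l y) (x - refl e l y) =
  dot (x - y) (x - y) + 4 * (dot x e - l) * (dot y e - l).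
Proof. by rewrite /refl !dotE e1 (dotC e) (dotC e) (dotC y x); ring. Qed.

Lemma enorm_reflr x y : enorm (refl e l x - refl e l y) = enorm (x - y).
Proof.
rewrite !enormE; congr Num.sqrt; rewrite /refl !dotE e1.
by rewrite (dotC e x) (dotC e y) (dotC y x); ring.
Qed.

Lemma enorm_reflC x y : enorm (refl e l x - y) = enorm (x - refl e l y).
Proof. by rewrite -{2}(reflK x) enorm_reflr. Qed.

Lemma refl_center : refl e l (l *: e) = l *: e.
Proof. by rewrite /refl dotZl e1 mulr1 subrr mulr0 scale0r subr0. Qed.

End refl.

Lemma enorm_sub_continuous x : continuous (fun y => enorm (x - y)).
Proof.
apply: (@lip_continuous _ 1) => y z; rewrite mul1r.
rewrite (le_trans (enorm_lip _ _))//.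
by rewrite (_ : x - y - (x - z) = z - y) ?(enormBC z)//; rewrite opprB addrC subrKA.
Qed.

Lemma eball_open x r : open (eball x r).
Proof.
rewrite (_ : eball x r = (fun y => enorm (x - y)) @^-1` `]-oo, r[%classic); last first.
  by apply/seteqP; split => y; rewrite /eball/= in_itv.
by move/continuousP: (@enorm_sub_continuous x) => /(_ _ (interval_open _ _)); apply.
Qed.

Lemma nbhs_eball x r : 0 < r -> nbhs x (eball x r).
Proof.
move=> r0; apply: open_nbhs_nbhs; split; first exact: eball_open.
by rewrite /eball/= subrr enorm0.
Qed.

Lemma eball_bounded x r : bounded_set (eball x r).
Proof.
exists (`|x| + `|r|); split; first by rewrite num_real.
move=> M hM y; rewrite /eball/= => yr; apply: le_trans (ltW hM).
have -> : y = x - (x - y) by rewrite opprB addrC subrK.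
rewrite (le_trans (ler_normB _ _))// lerD2l (le_trans (normr_le_enorm _))//.
by rewrite (le_trans (ltW yr))// ler_norm.
Qed.

End euclid.

(** * Measure-preserving maps and reflection invariance of Lebesgue measure *)
Section mpres.
Context d (T : measurableType d) (R : realType).
Implicit Types (mu : {measure set T -> \bar R}) (f : T -> T).

Definition mpres (mu : set T -> \bar R) f :=
  measurable_fun setT f /\ forall A, measurable A -> mu (f @^-1` A) = mu A.

Lemma mpres_comp mu f g : mpres mu f -> mpres mu g -> mpres mu (f \o g).
Proof.
move=> [mf pf] [mg pg]; split; first exact: measurableT_comp.
move=> A mA; rewrite comp_preimage pg ?pf//.
by rewrite -[X in measurable X]setTI; exact: mf.
Qed.

Section int.
Variables (mu : {measure set T -> \bar R}) (f : T -> T).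
Hypothesis pf : mpres mu f.

Lemma mpres_ge0_integral (g : T -> \bar R) : measurable_fun setT g ->
  (forall x, 0 <= g x)%E -> (\int[mu]_x g (f x) = \int[mu]_x g x)%E.
Proof.
move=> mg g0; rewrite -(ge0_integral_pushforward pf.1 mu measurableT)//.
apply: eq_measure_integral => [|mf A mA _]; first exact: pf.1.
exact: pf.2.
Qed.

Lemma mpres_integrable (g : T -> \bar R) :
  mu.-integrable setT g -> mu.-integrable setT (fun x => g (f x)).
Proof.
move=> /integrableP[mg ig]; apply/integrableP; split.
  exact: measurableT_comp mg pf.1.
by rewrite (mpres_ge0_integral (g := fun x => `|g x|%E))//; exact: measurableT_comp.
Qed.

Lemma mpres_integral (g : T -> \bar R) :
  mu.-integrable setT g -> (\int[mu]_x g (f x) = \int[mu]_x g x)%E.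
Proof.
move=> ig; have [mg _] := integrableP _ _ _ ig.
rewrite -(integral_pushforward pf.1 mg (mpres_integrable ig) measurableT).
apply: eq_measure_integral => [|mf A mA _]; first exact: pf.1.
exact: pf.2.
Qed.

Lemma mpres_ae (P : T -> Prop) :
  {ae mu, forall x, P x} -> {ae mu, forall x, P (f x)}.
Proof.
move=> [N [mN N0 PN]]; exists (f @^-1` N); split => //.
- by rewrite -[X in measurable X]setTI; exact: pf.1.
- by rewrite pf.2.
- by move=> x; exact: PN.
Qed.

End int.
End mpres.

(** Both the product measure and its image agree on rectangles, which determine
  a product of sigma-finite measures. *)
Lemma mpres_prod d1 d2 (T1 : measurableType d1) (T2 : measurableType d2)
    (R : realType) (m1 : {sigma_finite_measure set T1 -> \bar R})
    (m2 : {sigma_finite_measure set T2 -> \bar R}) f g :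
  mpres m1 f -> mpres m2 g ->
  mpres (m1 \x m2)%E (fun p => (f p.1, g p.2)).
Proof.
move=> [mf pf] [mg pg]; have mfg : measurable_fun setT (fun p : T1 * T2 => (f p.1, g p.2)).
  apply/measurable_fun_pairP; split.
    exact: measurableT_comp mf measurable_fst.
  exact: measurableT_comp mg measurable_snd.
split => // A mA; apply/esym.
apply: (@product_measure_unique _ _ _ _ _ m1 m2 (measure_function_pushforward__canonical__measure_function_Measure _ mfg)) => //.
move=> A1 A2 mA1 mA2 /=; rewrite /pushforward.
have mfA : measurable (f @^-1` A1).
  by rewrite -[X in measurable X]setTI; exact: mf.
have mgA : measurable (g @^-1` A2).
  by rewrite -[X in measurable X]setTI; exact: mg.
rewrite [X in product_measure1 _ _ X](_ : _ = (f @^-1` A1) `*` (g @^-1` A2))//.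
by rewrite product_measure1E//; congr (_ * _)%E; [exact: pf|exact: pg].
Qed.

Section lebesgue_rV.
Context {R : realType}.
Local Notation leb n := (lebesgue_rV R n).

Lemma lebesgue_translate (a : R) :
  mpres (@lebesgue_measure R) (fun x : measurableTypeR R => (x + a : measurableTypeR R)).
Proof.
have mf : measurable_fun setT (fun x : measurableTypeR R => (x + a : measurableTypeR R)).
  exact: measurable_funD.
split => // A mA; apply/esym.
apply: (@lebesgue_measure_unique R (measure_function_pushforward__canonical__measure_function_Measure _ mf)) => // _ [[b c] _ <-] /=.
rewrite /pushforward (_ : _ @^-1` _ = `]b - a, c - a]%classic); last first.
  by apply/seteqP; split => x /=; rewrite !in_itv/= lerBrDr ltrBlDr.
rewrite !lebesgue_measure_itv/= !lte_fin ltrD2r; case: ifP => // _.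
by congr _%:E; ring.
Qed.

Lemma lebesgue_opp :
  mpres (@lebesgue_measure R) (fun x : measurableTypeR R => (- x : measurableTypeR R)).
Proof.
split; last exact: lebesgue_measureN.
exact: measurable_funN.
Qed.

(** The measure in dimension n + 1 is a product, so invariance under maps acting
  separately on the first coordinate and on the others follows by induction. *)
Lemma mpres_rV_cons n f (g : 'rV[R]_n -> 'rV[R]_n) (h : 'rV[R]_n.+1 -> 'rV[R]_n.+1) :
  mpres (@lebesgue_measure R) f -> mpres (leb n) g ->
  (forall p, h (rV_cons p) = rV_cons (f p.1, g p.2)) -> mpres (leb n.+1) h.
Proof.
move=> pf pg hE; have [mfg pfg] := mpres_prod pf pg.
have E : h = rV_cons \o (fun p => (f p.1, g p.2)) \o rV_uncons.
  apply/funext => x; rewrite -[RHS](hE (rV_uncons x)); congr h; apply/rowP => i.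
  by rewrite mxE; case: unliftP => [j ->|->]/=; rewrite ?mxE.
split.
  rewrite E; apply: measurableT_comp measurable_rV_uncons.
  exact: measurableT_comp measurable_rV_cons mfg.
move=> A mA; rewrite /= /rV_cons_measure /pushforward -comp_preimage.
rewrite (_ : h \o rV_cons = rV_cons \o (fun p => (f p.1, g p.2))); last first.
  by apply/funext => p /=; rewrite hE.
rewrite comp_preimage pfg// -[X in measurable X]setTI.
exact: measurable_rV_cons.
Qed.

Lemma lebesgue_rV_translate n (a : 'rV[R]_n) : mpres (leb n) (fun x => x + a).
Proof.
elim: n a => [|n IH] a.
  rewrite (_ : (fun x => _) = id); last by apply/funext => x; rewrite !thinmx0.
  by split => //; exact: measurable_id.
apply: (mpres_rV_cons (lebesgue_translate (a ord0 ord0))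
  (IH (\row_j a ord0 (lift ord0 j)))) => p.
by apply/rowP => i; rewrite !mxE; case: unliftP => [j ->|->]/=; rewrite ?mxE.
Qed.

Lemma lebesgue_rV_opp n : mpres (leb n) (fun x => - x).
Proof.
elim: n => [|n IH].
  rewrite (_ : (fun x => _) = id); last by apply/funext => x; rewrite !thinmx0.
  by split => //; exact: measurable_id.
apply: (mpres_rV_cons lebesgue_opp IH) => p.
by apply/rowP => i; rewrite !mxE; case: unliftP => [j _|_]/=; rewrite ?mxE.
Qed.

Lemma lebesgue_rV_subl n (a : 'rV[R]_n) : mpres (leb n) (fun x => a - x).
Proof.
rewrite (_ : (fun x => _) = (fun x => x + a) \o (fun x => - x)); last first.
  by apply/funext => x /=; rewrite addrC.
exact: mpres_comp (lebesgue_rV_translate _) (lebesgue_rV_opp _).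
Qed.

Lemma measurable_rV_ball n (q : 'rV[R]_n) r :
  measurable [set x : 'rV[R]_n | forall i, `|q ord0 i - x ord0 i| < r].
Proof.
rewrite [X in measurable X](_ : _ = \bigcap_(i in [set: 'I_n])
    (rV_coord i @^-1` (ball (q ord0 i) r))); last first.
  by apply/seteqP; split=> x /= xq i => [_|]; exact: xq.
apply: fin_bigcap_measurable => // i _; rewrite -[X in measurable X]setTI.
apply: measurable_rV_coord => //.
exact: (measurable_ball (q ord0 i)).
Qed.

(** The sigma-algebra is generated by the coordinates; an open set belongs to it
  as the union of the countably many cubes with rational centre and side that it
  contains. *)
Lemma open_measurable_rV n (A : set 'rV[R]_n) : open A -> measurable A.
Proof.
move=> oA.
pose B (p : 'rV[rat]_n * nat) := [set x : 'rV[R]_n |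
  forall i, `|ratr (p.1 ord0 i) - x ord0 i| < p.2.+1%:R^-1].
pose D := [set p | B p `<=` A].
have -> : A = \bigcup_(k in [set k | exists2 p, unpickle k = Some p & D p])
    (if unpickle k is Some p then B p else set0).
  apply/seteqP; split => [x Ax|x [k [p -> Dp]]]; last exact: Dp.
  move: oA; rewrite openE => /(_ _ Ax)/nbhs_ballP[r/= r0 xrA].
  have [m mr] : exists m : nat, 2 * m.+1%:R^-1 < r.
    have := near_infty_natSinv_lt (PosNum (divr_gt0 r0 (ltr0n R 2))).
    by case=> m _ /(_ m (leqnn _))/= h; exists m; rewrite mulrC -ltr_pdivlMr.
  have /choice[q qx] : forall i, exists q : rat,
      `|ratr q - x ord0 i| < m.+1%:R^-1.
    move=> i; have : 0 < m.+1%:R^-1 :> R by [].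
    move: (_^-1) => d d0.
    have xd : x ord0 i - d < x ord0 i + d by lra.
    have [q] := rat_in_itvoo xd.
    by rewrite in_itv/= => qi; exists q; rewrite ltr_norml; lra.
  exists (pickle (\row_i q i, m)); last first.
    by rewrite pickleK => i /=; rewrite mxE; exact: qx.
  exists (\row_i q i, m); first exact: pickleK.
  move=> y By; apply: xrA; rewrite -ball_normE/=.
  apply: le_lt_trans mr; rewrite /Num.norm/= mx_normrE bigmax_le ?mulr_ge0//.
  move=> [i j] _ /=; rewrite ord1 !mxE.
  have := By j; have := qx j; rewrite /= mxE.
  move: (_^-1) => d h1 h2.
  rewrite (le_trans (ler_distD (ratr (q j)) _ _))// distrC; lra.
apply: bigcup_measurable => k [p -> _].
have := measurable_rV_ball (\row_i ratr (p.1 ord0 i)) p.2.+1%:R^-1.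
by congr measurable; apply/seteqP; split => x /= xB i; have := xB i; rewrite mxE.
Qed.

Lemma continuous_measurable_rV n (f : 'rV[R]_n -> R) :
  continuous f -> measurable_fun setT f.
Proof.
move=> /continuousP cf; apply: (measurability (@RGenOpens.G R)).
  exact: RGenOpens.measurableE.
move=> _ [_ [a [b ->] <-]]; rewrite setTI; apply: open_measurable_rV.
exact/cf/interval_open.
Qed.

End lebesgue_rV.

Section lebesgue_balls.
Context {R : realType}.
Local Notation leb n := (lebesgue_rV R n).

Lemma lebesgue_rV_cube n (q : 'rV[R]_n) r : 0 <= r ->
  leb n [set x | forall i, `|q ord0 i - x ord0 i| < r] = ((r *+ 2) ^+ n)%:E.
Proof.
move=> r0; have := @lebesgue_rV_box R n (fun i => ball (q ord0 i) r).
rewrite /= => -> => [|i]; last exact: (measurable_ball (q ord0 i)).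
rewrite (eq_bigr (fun=> (r *+ 2)%:E)); last first.
  by move=> i _; exact: (lebesgue_measure_ball _ r0).
by rewrite prodEFin prodr_const card_ord.
Qed.

Lemma normr_lt_cube n (q x : 'rV[R]_n) r : 0 < r ->
  (`|q - x| < r) = [forall i, `|q ord0 i - x ord0 i| < r].
Proof.
move=> r0; apply/idP/forallP => [h i|h].
  by apply: le_lt_trans h; have := coord_le_normr (q - x) i; rewrite !mxE.
rewrite /Num.norm/= mx_normrE; apply: bigmax_lt => // -[i j] _ /=.
by rewrite ord1 !mxE h.
Qed.

Lemma lebesgue_rV_ball n (q : 'rV[R]_n) r : 0 < r ->
  leb n (ball q r) = ((r *+ 2) ^+ n)%:E.
Proof.
move=> r0; rewrite -(lebesgue_rV_cube q (ltW r0)); congr (leb n _).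
rewrite -ball_normE; apply/seteqP; split => x /=; rewrite normr_lt_cube//.
  by move=> /forallP.
by move=> h; apply/forallP.
Qed.

Lemma lebesgue_rV_bounded n (A : set 'rV[R]_n) : measurable A -> bounded_set A ->
  (leb n A < +oo)%E.
Proof.
move=> mA [M [Mreal hM]].
have M0 : 0 < `|M| + 1 :> R by rewrite ltr_wpDl.
apply: (@le_lt_trans _ _ (leb n (ball 0 (`|M| + 1 + 1)))); last first.
  by rewrite lebesgue_rV_ball ?ltry// addr_gt0.
apply: le_measure; rewrite ?inE//.
  by apply: open_measurable_rV; exact: ball_open.
move=> x Ax; rewrite -ball_normE/= sub0r normrN.
have /= := hM (`|M| + 1) _ x Ax; move=> h; apply: le_lt_trans (h _) _.
  by rewrite ltr_pwDr// ler_norm.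
by rewrite ltrDl.
Qed.

Lemma lebesgue_rV_open n (A : set 'rV[R]_n) : open A -> A !=set0 ->
  (0 < leb n A)%E.
Proof.
move=> oA [x Ax]; move: (oA); rewrite openE => /(_ _ Ax)/nbhs_ballP[r/= r0 xrA].
apply: (@lt_le_trans _ _ (leb n (ball x r))).
  by rewrite lebesgue_rV_ball// lte_fin exprn_gt0// pmulrn_lgt0.
by apply: le_measure; rewrite ?inE//; apply: open_measurable_rV => //; exact: ball_open.
Qed.

Lemma measurable_rV_set1 n (x : 'rV[R]_n) : measurable [set x].
Proof.
rewrite (_ : [set x] = \bigcap_i (rV_coord i @^-1` [set x ord0 i])).
  apply: fin_bigcap_measurable => // i _; rewrite -[X in measurable X]setTI.
  exact: measurable_rV_coord.
by apply/seteqP; split => [_ -> //|y xy]; apply/rowP => i; rewrite [LHS]xy.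
Qed.

Lemma lebesgue_rV_set1 n (x : 'rV[R]_n) : (1 <= n)%N -> leb n [set x] = 0%E.
Proof.
move=> n1; apply/eqP; rewrite eq_le measure_ge0 andbT; apply/lee_addgt0Pr => r r0.
rewrite add0e; pose d := Num.min (r / 2) 2^-1.
have d0 : 0 < d by rewrite lt_min; apply/andP; split; lra.
apply: (@le_trans _ _ (leb n (ball x d))).
  apply: le_measure; rewrite ?inE.
  - exact: measurable_rV_set1.
  - by apply: open_measurable_rV; exact: ball_open.
  - by move=> _ ->; exact: ballxx.
rewrite lebesgue_rV_ball// lee_fin; case: n n1 @d x d0 => // n _ d x d0.
rewrite exprS (@le_trans _ _ ((d *+ 2) * 1))//.
  rewrite ler_wpM2l ?mulrn_wge0 ?(ltW d0)// exprn_ile1 ?mulrn_wge0 ?(ltW d0)//.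
  have : d <= 2^-1 by rewrite /d ge_min lexx orbT.
  lra.
have : d <= r / 2 by rewrite /d ge_min lexx.
lra.
Qed.

(** An additive surjection, up to translation. Invariance of the measure under
  such a map is obtained without a change of variables formula: in the double
  integral of 1_A(x) 1_B(L y - x), the inner substitution x := L y - x exchanges
  [A] and [B], while integrating over y first gives the product of the measures
  of [A] and of the preimage of [B]. *)
Section affine.
Variables (n : nat) (L : 'rV[R]_n -> 'rV[R]_n).
Hypothesis mL : measurable_fun setT L.
Hypothesis tL : forall x, exists x', forall y, L y - x = L (y + x').
Local Notation mu := (leb n).

Let measurable_diff : measurable_fun setT
  (fun p : 'rV[R]_n * 'rV[R]_n => L p.2 - p.1).
Proof.
apply: measurable_fun_rVP => i; under eq_fun do rewrite !mxE.
apply: measurable_funB.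
  apply: (measurableT_comp (measurable_rV_coord i)).
  exact: measurableT_comp mL measurable_snd.
exact: (measurableT_comp (measurable_rV_coord i) measurable_fst).
Qed.

Let convol (A B : set 'rV[R]_n) : measurable A -> measurable B ->
  (\int[mu]_x \int[mu]_y (\1_A x * \1_B (L y - x))%:E = mu A * mu (L @^-1` B))%E.
Proof.
move=> mA mB.
have mLB : measurable (L @^-1` B) by rewrite -[X in measurable X]setTI; exact: mL.
rewrite (eq_integral (fun x => mu (L @^-1` B) * (\1_A x)%:E)%E); last first.
  move=> x _; have [x' xx'] := tL x.
  rewrite (eq_integral (fun y : 'rV[R]_n => (\1_A x * \1_(L @^-1` B) (y + x'))%:E)); last first.
    by move=> y _; rewrite xx' !indicE; congr (_ * _)%:E; rewrite !in_setE.
  rewrite (mpres_ge0_integral (lebesgue_rV_translate x')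
    (g := fun y : 'rV[R]_n => (\1_A x * \1_(L @^-1` B) y)%:E))//; last first.
  by apply/measurable_EFinP; exact: measurable_funM.
  under eq_integral do rewrite EFinM.
  rewrite ge0_integralZl//; last by apply/measurable_EFinP.
  by rewrite integral_indic// setIT muleC.
rewrite ge0_integralZl//; last by apply/measurable_EFinP.
by rewrite integral_indic// setIT muleC.
Qed.

Let convolC (A B : set 'rV[R]_n) : measurable A -> measurable B ->
  (mu A * mu (L @^-1` B) = mu B * mu (L @^-1` A))%E.
Proof.
move=> mA mB.
apply: etrans (esym (convol mA mB)) _; apply: etrans (convol mB mA).
pose F (X Y : set 'rV[R]_n) (p : 'rV[R]_n * 'rV[R]_n) : \bar R :=
  (\1_X p.1 * \1_Y (L p.2 - p.1))%:E.
have mF X Y : measurable X -> measurable Y -> measurable_fun setT (F X Y).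
  move=> mX mY; apply/measurable_EFinP; apply: measurable_funM.
    by apply: (measurableT_comp (f := \1_X : _ -> R)); [exact: measurable_indic|].
  by apply: (measurableT_comp (f := \1_Y : _ -> R)); [exact: measurable_indic|].
have F0 X Y p : (0 <= F X Y p)%E by rewrite lee_fin mulr_ge0.
transitivity (\int[mu]_y \int[mu]_x F A B (x, y))%E.
  exact: (fubini_tonelli (F A B) (mF _ _ mA mB) (F0 _ _)).
transitivity (\int[mu]_y \int[mu]_x F B A (x, y))%E; last first.
  exact/esym/(fubini_tonelli (F B A) (mF _ _ mB mA) (F0 _ _)).
apply: eq_integral => y _; rewrite /F/=.
rewrite -(mpres_ge0_integral (lebesgue_rV_subl (L y))
    (g := fun x : 'rV[R]_n => (\1_A x * \1_B (L y - x))%:E))//; last first.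
exact: (measurableT_comp (mF _ _ mA mB) (measurable_pair2 _)).
by apply: eq_integral => x _; rewrite mulrC subKr.
Qed.

(** The exchange formula compares the measure of any preimage with the measure of
  one invariant test set. *)
Lemma mpres_affine (B : set 'rV[R]_n) : measurable B -> L @^-1` B = B ->
  (0 < mu B < +oo)%E -> mpres mu L.
Proof.
move=> mB LB /andP[B0 Boo]; split => // A mA; have := convolC mA mB.
have bfin : mu B \is a fin_num by rewrite ge0_fin_numE ?measure_ge0.
rewrite LB muleC => h; apply/eqP; rewrite eq_le; apply/andP; split.
  by rewrite -(lee_pmul2l bfin B0) h.
by rewrite -(lee_pmul2l bfin B0) h.
Qed.
End affine.

(** The invariant test set is a Euclidean ball centred on the hyperplane. *)
Lemma mpres_refl n (e : 'rV[R]_n) l : dot e e = 1 -> mpres (leb n) (refl e l).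
Proof.
move=> e1; apply: (@mpres_affine _ _ _ _ (eball (l *: e) 1)).
- apply: measurable_fun_rVP => i; under eq_fun do rewrite !mxE.
  apply: measurable_funB; first exact: measurable_rV_coord.
  apply: measurable_funM => //; apply: measurable_funM => //.
  apply: measurable_funB => //; apply: measurable_sum => j.
  by apply: measurable_funM => //; exact: measurable_rV_coord.
- move=> x; exists (- refl e 0 x) => y; rewrite /refl.
  rewrite !dotE e1; apply/rowP => i; rewrite !mxE; ring.
- by apply: open_measurable_rV; exact: eball_open.
- have E x : enorm (l *: e - refl e l x) = enorm (l *: e - x).
    by rewrite -{1}(refl_center l e1) enorm_reflr.
  by apply/seteqP; split => x; rewrite /eball/= E.
- apply/andP; split.
    apply: lebesgue_rV_open; first exact: eball_open.
    by exists (l *: e); rewrite /eball/= subrr enorm0.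
  apply: lebesgue_rV_bounded; first by apply: open_measurable_rV; exact: eball_open.
  exact: eball_bounded.
Qed.

End lebesgue_balls.

(** * Distance functions and sets of positive reach *)
Section dist.
Context {R : realType} {n : nat}.
Implicit Types (A B : set 'rV[R]_n) (x y : 'rV[R]_n) (r : R).

Lemma dist_has_inf A x : A !=set0 -> has_inf [set enorm (x - y) | y in A].
Proof.
move=> [a Aa]; split; first by exists (enorm (x - a)), a.
by exists 0 => _ [y _ <-]; exact: enorm_ge0.
Qed.

Lemma dist_le A x y : A y -> dist_set x A <= enorm (x - y).
Proof.
by move=> Ay; apply: ge_inf; [case: (dist_has_inf x (ex_intro _ y Ay))|exists y].
Qed.

Lemma dist_lt A x r : A !=set0 -> dist_set x A < r ->
  exists2 y, A y & enorm (x - y) < r.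
Proof.
by move=> A0 /(inf_lt (dist_has_inf x A0).1) [_ [y Ay <-] yr]; exists y.
Qed.

Lemma dist_ge A x r : A !=set0 -> (forall y, A y -> r <= enorm (x - y)) ->
  r <= dist_set x A.
Proof.
move=> A0 h; apply: lb_le_inf; first by case: (dist_has_inf x A0).
by move=> _ [y Ay <-]; exact: h.
Qed.

Lemma dist_ge0 A x : A !=set0 -> 0 <= dist_set x A.
Proof. by move=> A0; apply: dist_ge => // y _; exact: enorm_ge0. Qed.

Lemma dist_lipD A x y : A !=set0 -> dist_set x A <= dist_set y A + enorm (x - y).
Proof.
move=> A0; rewrite -lerBlDr; apply: dist_ge => // z Az.
rewrite lerBlDr addrC; apply: le_trans (dist_le _ Az) _; exact: ler_enormB.
Qed.

Lemma dist_continuous A : A !=set0 -> continuous (fun x => dist_set x A).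
Proof.
move=> A0; apply: (@lip_continuous _ _ _ 1) => x y; rewrite mul1r.
have := dist_lipD x y A0; have := dist_lipD y x A0; rewrite (enormBC y) ler_norml; lra.
Qed.

Lemma dist_closure A x : A !=set0 -> dist_set x (closure A) = dist_set x A.
Proof.
move=> A0; have cA0 : closure A !=set0 by case: A0 => a /subset_closure; exists a.
apply/eqP; rewrite eq_le; apply/andP; split.
  by apply: dist_ge => // y /subset_closure; exact: dist_le.
apply: dist_ge => // y cAy; apply/ler_addgt0Pr => r r0.
have [z [Az yz]] := cAy _ (nbhs_eball y r0).
have := dist_le x Az; have := ler_enormB x y z; move: yz; rewrite /eball/=.
lra.
Qed.

Lemma dist_eq0 A x : A !=set0 -> closed A -> dist_set x A = 0 -> A x.
Proof.
move=> A0 cA d0; apply: cA => B /nbhs_ballP[r/= r0 xrB].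
have [|y Ay xy] := @dist_lt A x r A0; first by rewrite d0.
exists y; split => //; apply: xrB; rewrite -ball_normE/=.
exact: le_lt_trans (normr_le_enorm _) xy.
Qed.

Lemma closed_bounded_attain A x : A !=set0 -> closed A -> bounded_set A ->
  exists2 y, A y & forall z, A z -> enorm (x - y) <= enorm (x - z).
Proof.
move=> A0 cA bA.
have [|y /set_mem Ay yA] := @EVT_min_rV _ _ (fun y => enorm (x - y)) A A0
  (bounded_closed_compact bA cA).
  by apply: continuous_subspaceT; exact: enorm_sub_continuous.
by exists y => // z Az; apply: yA; exact: mem_set.
Qed.

Lemma dist_attain A x : A !=set0 -> closed A -> bounded_set A ->
  exists2 y, A y & dist_set x A = enorm (x - y).
Proof.
move=> A0 cA bA; have [y Ay yA] := closed_bounded_attain x A0 cA bA.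
exists y => //; apply/eqP; rewrite eq_le dist_le//=.
exact: dist_ge.
Qed.

Lemma closed_le_cont (f g : 'rV[R]_n -> R) : continuous f -> continuous g ->
  closed [set x | f x <= g x].
Proof.
move=> cf cg; rewrite (_ : [set x | _] = (fun x => g x - f x) @^-1` [set z | 0 <= z]).
  have /continuous_closedP : continuous (fun x => g x - f x).
    by move=> x; apply: continuousB; [exact: cg|exact: cf].
  by apply; exact: closed_ge.
by apply/seteqP; split => x /=; rewrite subr_ge0.
Qed.

Lemma bounded_setS A B : A `<=` B -> bounded_set B -> bounded_set A.
Proof.
by move=> AB [M [rM hM]]; exists M; split => // N MN x /AB; exact: hM.
Qed.

Lemma bounded_sub_eball A x r : (forall y, A y -> enorm (x - y) <= r) -> bounded_set A.
Proof.
move=> h; apply: (@bounded_setS _ (eball x (r + 1))); last exact: eball_bounded.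
by move=> y /h; rewrite /eball/=; lra.
Qed.

Lemma Unp_unique A x y z : A !=set0 -> Unp A x -> A y -> A z ->
  dist_set x A = enorm (x - y) -> dist_set x A = enorm (x - z) -> y = z.
Proof.
move=> A0 [w Ew] Ay Az dy dz.
have -> : y = w by have : [set w] y by rewrite -Ew.
by have : [set w] z by rewrite -Ew.
Qed.

(** The infimum of local reaches being larger than [t], one radius [r > t] serves
  all points of [A]. *)
Lemma reach_Unp A (t : R) : 0 < t -> (t%:E < reach A)%E -> exists2 r, t < r &
  forall x y, A y -> enorm (y - x) < r -> Unp A x.
Proof.
move=> t0 tr.
have [r tr' rr] : exists2 r, t < r & (r%:E <= reach A)%E.
  case: (reach A) tr => [r|_|//].
    by rewrite lte_fin => tr; exists r.
  by exists (t + 1); [rewrite ltrDl|rewrite leey].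
pose r' := (t + r) / 2; exists r'; first by rewrite /r'; lra.
move=> x y Ay xy.
have : (r'%:E < reach_at A y)%E.
  apply: (@lt_le_trans _ _ r%:E); first by rewrite lte_fin /r'; lra.
  by apply: le_trans rr _; apply: ereal_inf_lbound; exists y.
rewrite /reach_at lt_max lte_fin => /orP[r'0|].
  by exfalso; move: r'0; rewrite /r'; lra.
move/ereal_sup_gt => [_ [s [s0 sU] <-]]; rewrite lte_fin => rs.
by apply: sU; rewrite /eball/=; exact: lt_trans xy rs.
Qed.

End dist.

Section reach.
Context {R : realType} {n : nat}.
Variables (K : set 'rV[R]_n) (r0 : R).
Hypotheses (K0 : K !=set0) (cK : closed K) (bK : bounded_set K).
Hypothesis unpK : forall x y, K y -> enorm (y - x) < r0 -> Unp K x.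
Local Notation d := (fun x => dist_set x K).

Let dxy_unique x y z : dist_set x K < r0 -> K y -> K z ->
  dist_set x K = enorm (x - y) -> dist_set x K = enorm (x - z) -> y = z.
Proof.
move=> xr Ky Kz dy dz; apply: (Unp_unique K0 _ Ky Kz dy dz).
by apply: (unpK Ky); rewrite enormBC -dy.
Qed.

(** Near a set of positive reach the distance can be increased at unit speed. The
  best point [y] of the ball of radius [r] about [x] is found by compactness; it
  must lie straight ahead of its own nearest point [q], for otherwise uniqueness
  of [q] would allow a further step that increases the distance. Then [x] lies
  between [q] and [y]. This avoids differentiating the distance function. *)
Lemma reach_step x r : 0 < r -> r < dist_set x K -> dist_set x K + r < r0 ->
  exists2 y, enorm (x - y) <= r & dist_set x K + r <= dist_set y K.
Proof.
move=> rp rd dr.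
pose B := [set y | enorm (x - y) <= r].
have Bx : B x by rewrite /B/= subrr enorm0 ltW.
have cB : closed B.
  by apply: closed_le_cont; [exact: enorm_sub_continuous|exact: cst_continuous].
have bB : bounded_set B by apply: (@bounded_sub_eball _ _ _ x r).
have [|y /set_mem By ymax] := @EVT_max_rV _ _ d B (ex_intro _ _ Bx)
    (bounded_closed_compact bB cB).
  by apply: continuous_subspaceT; exact: dist_continuous.
exists y => //.
have [q Kq dyq] := dist_attain y K0 cK bK.
have dxy : dist_set x K <= dist_set y K by apply: ymax; rewrite inE.
have dyr : dist_set y K < r0.
  by apply: le_lt_trans dr; have := dist_lipD y x K0; rewrite (enormBC y); move: By; rewrite /B/=; lra.
have dy0 : 0 < dist_set y K by lra.
have [v v1 yqE] : exists2 v, dot v v = 1 & y - q = dist_set y K *: v.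
  exists ((dist_set y K)^-1 *: (y - q)); last first.
    by rewrite scalerA divff ?scale1r ?gt_eqF.
  by rewrite dotZl dotZr -enorm_sq -dyq; field; rewrite gt_eqF.
pose x' := x + r *: v.
have Bx' : B x'.
  rewrite /B/= /x' opprD addrA subrr sub0r enormN enormZ gtr0_norm//.
  by rewrite enormE v1 sqrtr1 mulr1.
(* v is the unit vector from q to y, and x' the end of the radius along v *)
suff yx' : y = x'.
  have : dist_set x K <= enorm (x - q) by exact: dist_le.
  have -> : x - q = (dist_set y K - r) *: v.
    rewrite scalerBl -yqE yx' /x'; apply/rowP => i; rewrite !mxE; ring.
  rewrite enormZ enormE v1 sqrtr1 mulr1 ger0_norm; lra.
apply: contrapT => yx'.
(* otherwise w points away from q while y + h w stays in the ball *)
pose w := x' - y.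
have wv : 0 < dot w v.
  have w0 : 0 < dot w w.
    rewrite lt_def dot_ge0 andbT; apply/eqP => /dot_eq0 /eqP.
    by rewrite subr_eq0 => /eqP/esym.
  have : dot (x - y) (x - y) <= r ^+ 2 by rewrite -le_enorm// ltW.
  have wE : w = (x - y) + r *: v by rewrite /w /x' addrAC.
  move: w0; rewrite wE; move: (x - y) => a.
  rewrite !dotE v1 (dotC v a); nra.
(* the points of K that a step along w does not leave behind; q being the only
   nearest point of y, they are farther than q by some r1 > 0 *)
pose C := [set z | K z /\ dot w (y - z) <= 0].
have [r1 r1p hr1] : exists2 r1, 0 < r1 & forall z, C z -> dist_set y K + r1 <= enorm (y - z).
  have [C0|C0] := pselect (C !=set0); last first.
    by exists 1 => // z Cz; exfalso; apply: C0; exists z.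
  have cC : closed C.
    apply: closedI => //; apply: closed_le_cont; last by exact: cst_continuous.
    apply: (@lip_continuous _ _ _ (enorm w)) => a b.
    have E : dot w (y - a) - dot w (y - b) = dot w (b - a) by rewrite !dotE; ring.
    rewrite E (enormBC a) ler_norml dot_le_enorm andbT lerNl -dotNr.
    by rewrite -(enormN (b - a)) dot_le_enorm.
  have bC : bounded_set C by apply: bounded_setS bK => z [].
  have [z [Kz wz] zmin] := closed_bounded_attain y C0 cC bC.
  exists (enorm (y - z) - dist_set y K) => [|z' /zmin]; last lra.
  rewrite subr_gt0 lt_neqAle dist_le// andbT; apply/eqP => dz.
  have qz := dxy_unique dyr Kq Kz dyq dz.
  move: wz; rewrite -qz yqE dotZr leNgt => /negP; apply.
  by rewrite mulr_gt0.
pose h := Num.min 1 (r1 / (2 * enorm w + 1)).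
have ew0 := enorm_ge0 w.
have h0 : 0 < h by rewrite lt_min ltr01 divr_gt0//; lra.
have h1 : h <= 1 by rewrite /h ge_min lexx.
have hr : 2 * (h * enorm w) < r1.
  have : h <= r1 / (2 * enorm w + 1) by rewrite /h ge_min lexx orbT.
  rewrite ler_pdivlMr; last lra.
  nra.
have Byh : B (y + h *: w).
  rewrite /B/= (_ : x - _ = (1 - h) *: (x - y) + h *: (x - x')); last first.
    by rewrite /w; apply/rowP => i; rewrite !mxE; ring.
  rewrite (le_trans (ler_enormD _ _))// !enormZ !ger0_norm ?subr_ge0 ?(ltW h0)//.
  move: By Bx'; rewrite /B/= => By Bx'; nra.
have [z Kz dz] := dist_attain (y + h *: w) K0 cK bK.
have Cz : ~ C z.
  move=> /hr1; have := ler_enormB y (y + h *: w) z; rewrite -dz.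
  rewrite opprD addrA subrr sub0r enormN enormZ gtr0_norm//.
  have := dist_lipD (y + h *: w) y K0; rewrite [y + _]addrC addrK enormZ gtr0_norm//.
  lra.
have wz : 0 < dot w (y - z) by rewrite ltNge; apply/negP => wz; apply: Cz.
have := ymax (y + h *: w); rewrite inE => /(_ Byh).
have : dist_set y K <= enorm (y - z) by exact: dist_le.
rewrite dz => yz /= /le_trans /(_ yz).
rewrite le_enorm ?enorm_ge0// enorm_sq.
have -> : y + h *: w - z = (y - z) + h *: w by rewrite addrAC.
clearbody w; move: wz; move: (y - z) => a aw; rewrite !dotE (dotC a w).
have := dot_ge0 w; nra.
Qed.

(** A point of largest distance among those reached from [x] at unit speed without
  exceeding [t] attains [t], since [reach_step] improves any other. *)
Lemma reach_far x t : 0 < dist_set x K -> dist_set x K < t -> t < r0 ->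
  exists2 z, enorm (x - z) < t & dist_set z K = t.
Proof.
move=> dx0 dxt tr.
pose C := [set y | enorm (x - y) <= dist_set y K - dist_set x K] `&`
  [set y | dist_set y K <= t].
have cd : continuous d by exact: dist_continuous.
have cC : closed C.
  apply: closedI; apply: closed_le_cont => //; last exact: cst_continuous.
    exact: enorm_sub_continuous.
  apply: (@lip_continuous _ _ _ 1) => y z; rewrite mul1r opprB addrA subrK.
  have := dist_lipD y z K0; have := dist_lipD z y K0.
  by rewrite (enormBC z) ler_norml; lra.
have Ct y : C y -> enorm (x - y) <= t - dist_set x K.
  by move=> [/= h1 h2]; lra.
have bC : bounded_set C by apply: (@bounded_sub_eball _ _ _ x) Ct.
have Cx : C x by split => /=; rewrite ?subrr ?enorm0// ltW.
have [|y /set_mem Cy ymax] := @EVT_max_rV _ _ d C (ex_intro _ _ Cx)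
    (bounded_closed_compact bC cC).
  exact: continuous_subspaceT.
exists y; first by have := Ct _ Cy; lra.
apply/eqP; rewrite eq_le Cy.2/= leNgt; apply/negP => dyt.
have dxy : dist_set x K <= dist_set y K by apply: ymax; rewrite inE.
pose r := Num.min (t - dist_set y K) (dist_set y K / 2).
have r1 : r <= t - dist_set y K by rewrite /r ge_min lexx.
have r2 : r <= dist_set y K / 2 by rewrite /r ge_min lexx orbT.
have rp : 0 < r by rewrite lt_min; apply/andP; split; lra.
have [||z yz dz] := @reach_step y r rp; [lra|lra|].
have dzy := dist_lipD z y K0; rewrite (enormBC z) in dzy.
have : dist_set z K <= dist_set y K.
  apply: ymax; rewrite inE; split => /=; last lra.
  have := ler_enormB x y z; move: Cy.1 => /=; lra.
lra.
Qed.

End reach.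

Section rV_topology.
Context {R : realType} {n : nat}.
Implicit Types (A : set 'rV[R]_n) (x y : 'rV[R]_n) (r : R).

Lemma nbhs_enormP x A : nbhs x A <-> exists2 r, 0 < r & eball x r `<=` A.
Proof.
split=> [/nbhs_ballP[r/= r0 rA]|[r r0 rA]]; last first.
  by apply: filterS rA _; exact: nbhs_eball.
exists r => // y yr; apply: rA; rewrite -ball_normE/=.
exact: le_lt_trans (normr_le_enorm _) yr.
Qed.

Lemma bounded_enorm A : bounded_set A -> exists M, forall x, A x -> enorm x <= M.
Proof.
move=> [M [Mr hM]]; exists (n%:R * (M + 1)) => x Ax.
rewrite (le_trans (enorm_le_normr _))// ler_wpM2l//.
by apply: hM Ax; rewrite ltrDl.
Qed.

Lemma closure_bounded A : bounded_set A -> bounded_set (closure A).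
Proof.
move=> /bounded_enorm[M hM]; apply: (@bounded_sub_eball _ _ _ 0 M) => x clx.
have cB : closed [set y : 'rV[R]_n | enorm (0 - y) <= M].
  by apply: closed_le_cont; [exact: enorm_sub_continuous|exact: cst_continuous].
apply: cB; apply: closure_subset clx => y /hM.
by rewrite /= sub0r enormN.
Qed.

Lemma dot_ler_norm x e : dot e e = 1 -> `|dot x e| <= enorm x.
Proof.
move=> e1; have E : enorm e = 1 by rewrite enormE e1 sqrtr1.
have := dot_le_enorm x e; have := dot_le_enorm (- x) e.
by rewrite dotNl enormN E mulr1 ler_norml; lra.
Qed.

(** The indices are only required to satisfy [k <= f k], which is enough to
  preserve limits. *)
Lemma bounded_subsequence (u : nat -> 'rV[R]_n) A : bounded_set A ->
  (forall k, A (u k)) ->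
  exists (f : nat -> nat) x, (forall k, (k <= f k)%N) /\ u (f k) @[k --> \oo] --> x.
Proof.
move=> bA Au.
have cA : compact (closure A).
  by apply: bounded_closed_compact; [exact: closure_bounded|exact: closed_closure].
have [|x [_ clx]] := cA (u @ \oo) _.
  by exists 0 => // k _ /=; apply: subset_closure; exact: Au.
have /choice[f hf] : forall k : nat, exists j, (k <= j)%N /\ `|x - u j| < k.+1%:R^-1.
  move=> k; have [||y [[j kj <-] xy]] := clx [set u j | j in [set j | (k <= j)%N]]
    (ball x k.+1%:R^-1).
  - by exists k => // j kj; exists j.
  - by apply: nbhsx_ballx.
  - by exists j; split => //; move: xy; rewrite -ball_normE.
exists f, x; split => [k|]; first by case: (hf k).
apply/cvgrPdist_lt => r r0; near=> k.
apply: lt_trans (hf k).2 _.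
by near: k; exact: (near_infty_natSinv_lt (PosNum r0)).
Unshelve. all: by end_near. Qed.

End rV_topology.

(** * Moving planes over the parallel neighbourhood *)
Lemma crossing (R : realType) (g : R -> R) (t a b : R) : continuous g ->
  g 0 < t -> 0 < a -> t <= g (- a) -> 0 < b -> t <= g b ->
  exists r1 r2, [/\ - a <= r1, r1 < 0, 0 < r2, g r1 = t & g r2 = t].
Proof.
move=> cg g0 a0 ga b0 gb.
have IVT' c d : c <= d -> Num.min (g c) (g d) <= t <= Num.max (g c) (g d) ->
    exists2 r, r \in `[c, d] & g r = t.
  by move=> cd; apply: IVT => //; exact: continuous_subspaceT.
have [||r1 /itvP r1I gr1] := IVT' (- a) 0; first by rewrite oppr_le0 ltW.
  by rewrite ge_min le_max ga (ltW g0) orbT.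
have [||r2 /itvP r2I gr2] := IVT' 0 b; first exact: ltW.
  by rewrite ge_min le_max gb (ltW g0) orbT.
exists r1, r2; split => //; first by rewrite r1I.
  rewrite lt_neqAle r1I andbT; apply/eqP => r10.
  by move: g0; rewrite -gr1 r10 ltxx.
rewrite lt_neqAle r2I andbT; apply/eqP => r20.
by move: g0; rewrite -gr2 -r20 ltxx.
Qed.

Lemma cvg_constant (R : realType) (u : nat -> R) (c l : R) :
  (forall k, u k = c) -> u k @[k --> \oo] --> l -> l = c.
Proof.
move=> uc ul; have uE : u = cst c by exact/funext.
rewrite uE in ul; exact: (cvg_unique _ ul (@cvg_cst _ c _ _ _)).
Qed.

Lemma abs_diff_bound (R : realType) (a b c : R) :
  a <= b + c -> b <= a + c -> - c <= a - b <= c.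
Proof. by move=> h1 h2; apply/andP; split; lra. Qed.

Lemma midpoint_gt (R : realType) (x l r1 r2 : R) :
  - (2 * (x - l)) <= r1 -> 0 < r2 -> l < x + r2 - (r2 - r1) / 2.
Proof. lra. Qed.

Section moving_plane.
Context {R : realType} {n : nat}.
Variables (Omega : set 'rV[R]_n) (t : R) (e : 'rV[R]_n).
Hypotheses (Omega0 : Omega !=set0) (regO : regopen Omega)
  (bO : bounded_set Omega) (t0 : 0 < t) (reachO : (t%:E < reach (closure Omega))%E).
Hypothesis e1 : dot e e = 1.
Local Notation d x := (dist_set x Omega).

Definition plane_ok l :=
  forall x, d x < t -> l < dot x e -> d (refl e l x) < t.

Let bK := closure_bounded bO.
Let K0 : closure Omega !=set0.
Proof. by case: Omega0 => a /subset_closure; exists a. Qed.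
Let cK : closed (closure Omega). Proof. exact: closed_closure. Qed.

Let d0K x : d x = 0 -> closure Omega x.
Proof. by rewrite -dist_closure//; exact: dist_eq0. Qed.

Let Kd0 x : closure Omega x -> d x = 0.
Proof.
move=> Kx; apply/eqP; rewrite eq_le dist_ge0// andbT -dist_closure//.
by have := dist_le x Kx; rewrite subrr enorm0.
Qed.

(** If the reflection of [x] left the closure, one could move away from it to a
  point [z] of Gamma_t closer than [t] to the reflection of [x]. If [z] is on the
  right, it is even closer to [x]; if it is on the left, its reflection is in
  {d < t} and admissibility brings [z] itself there. Both contradict [d z = t]. *)
Lemma plane_ok_closure l x : plane_ok l -> closure Omega x -> l < dot x e ->
  closure Omega (refl e l x).
Proof.
move=> Pl Kx lx; apply: contrapT => nKRx.
have dRx : d (refl e l x) < t by apply: Pl; rewrite ?Kd0.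
have dRx0 : 0 < d (refl e l x).
  by rewrite lt_def dist_ge0// andbT; apply: contra_notN nKRx => /eqP/d0K.
have [r tr rU] := reach_Unp t0 reachO.
have [||z xz dz] := reach_far K0 cK bK rU _ _ tr (x := refl e l x).
- by rewrite dist_closure.
- by rewrite dist_closure.
rewrite dist_closure// in dz.
have dlt y : enorm (x - y) < t -> d y < t.
  move=> xy; have := dist_lipD y x Omega0; rewrite (Kd0 Kx) (enormBC y); lra.
have [lz|lz] := ltP l (dot z e).
  suff /dlt : enorm (x - z) < t by rewrite dz ltxx.
  move: xz; rewrite enorm_reflC// !lt_enorm ?(ltW t0)// dot_sub_refl//.
  have : 0 < (dot x e - l) * (dot z e - l) by rewrite mulr_gt0 ?subr_gt0.
  nra.
have dz' : d (refl e l z) < t by apply: dlt; rewrite -enorm_reflC.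
move: lz; rewrite le_eqVlt => /orP[/eqP zl|lz].
  by move: dz'; rewrite /refl zl subrr mulr0 scale0r subr0 dz ltxx.
have lz' : l < dot (refl e l z) e by rewrite dot_refl// mulr_natl mulr2n -addrA ltrDl subr_gt0.
by have := Pl _ dz' lz'; rewrite reflK// dz ltxx.
Qed.

(** The reflection is open, so the statement for the closure passes to the interior
  of the closure, which is [Omega]. *)
Lemma plane_ok_domain l x : plane_ok l -> Omega x -> l < dot x e ->
  Omega (refl e l x).
Proof.
move=> Pl Ox lx; rewrite -regO.
have : nbhs x [set y | closure Omega y /\ l < dot y e].
  apply: filterI; first by move: Ox; rewrite -{1}regO.
  have [r0] : 0 < dot x e - l by lra.
  apply/nbhs_enormP; exists (dot x e - l) => // y /=; rewrite /eball/=.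
  by have := dot_ler_norm (x - y) e1; rewrite dotDl dotNl ler_norml; lra.
move=> /nbhs_enormP[r r0 hr]; apply/nbhs_enormP; exists r => // y.
rewrite /eball/= enorm_reflC// => /hr/= [KRy lRy].
by rewrite -(reflK l e1 y); exact: plane_ok_closure.
Qed.

(** On the line in the direction [e] through a point [x] violating admissibility,
  the distance is less than [t] at [x], at least [t] at its reflection, and large
  far to the right. The two crossings of the level [t] around [x] have their
  midpoint right of the plane. *)
Lemma not_plane_ok l : ~ plane_ok l -> exists a h,
  [/\ d a = t, d (a - h *: e) = t, 0 < h & l < dot a e - h / 2].
Proof.
move=> nP.
have [x [dx lx dRx]] : exists x, [/\ d x < t, l < dot x e & t <= d (refl e l x)].
  apply: contrapT => h; apply: nP => x dx lx; rewrite ltNge; apply/negP => dRx.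
  by apply: h; exists x.
pose g r := d (x + r *: e).
have cg : continuous g.
  move=> r; apply/cvgrPdist_le => s s0; apply/nbhs_ballP; exists s => // r' rr'.
  have E : enorm (r *: e - r' *: e) = `|r - r'|.
    by rewrite -scalerBl enormZ [enorm e]enormE e1 sqrtr1 mulr1.
  have h1 := dist_lipD (x + r *: e) (x + r' *: e) Omega0.
  have h2 := dist_lipD (x + r' *: e) (x + r *: e) Omega0.
  rewrite !opprD !addrA ![x + _ - x]addrAC !subrr !add0r in h1 h2.
  rewrite enormBC in h2; rewrite E in h1 h2.
  rewrite (le_trans _ (ltW rr'))// ler_norml /g.
  by move: h1 h2; exact: abs_diff_bound.
have gx : g 0 < t by rewrite /g scale0r addr0.
pose h0 := 2 * (dot x e - l).
have gh0 : t <= g (- h0) by rewrite /g scaleNr.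
have h00 : 0 < h0 by rewrite /h0; lra.
have [T T0 gT] : exists2 T, 0 < T & t <= g T.
  have [M hM] := bounded_enorm bO.
  have M0 : 0 <= M by case: Omega0 => y /hM; apply: le_trans; exact: enorm_ge0.
  exists (M + t + enorm x + 1); first by rewrite ltr_wpDl// !addr_ge0 ?enorm_ge0 ?(ltW t0).
  set T := (X in g X); apply: dist_ge => // y /hM yM.
  have h1 := ler_enormD (x + T *: e - y) (y - x).
  rewrite addrA subrK addrAC subrr add0r enormZ [enorm e]enormE e1 sqrtr1 mulr1 in h1.
  have := ler_enormD y (- x); rewrite enormN.
  have : T <= `|T| by exact: ler_norm.
  rewrite {1}/T; lra.
have [r1 [r2 [r1h r10 r20 gr1 gr2]]] := crossing cg gx h00 gh0 T0 gT.
exists (x + r2 *: e), (r2 - r1); split => //.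
- by rewrite -addrA -scalerBl subKr.
- by rewrite subr_gt0 (lt_trans r10).
rewrite dotDl dotZl e1 mulr1; apply: midpoint_gt r1h r20.
Qed.

(** The smallest position beyond which all planes are admissible. *)
Let critical_inf : exists l, [/\ forall m, l <= m -> plane_ok m &
  forall r, 0 < r -> exists m, [/\ l - r <= m, m < l & ~ plane_ok m]].
Proof.
pose S := [set l | forall m, l <= m -> plane_ok m].
have [M0 hM0] := bounded_enorm bO.
pose M := M0 + t.
have hM x : d x < t -> enorm x <= M.
  move=> /(dist_lt Omega0)[y /hM0 yM xy].
  have := ler_enormD (x - y) y; rewrite subrK /M; lra.
have S0 : S !=set0.
  exists M => m Mm x /hM xM mx; exfalso.
  by have := dot_ler_norm x e1; rewrite ler_norml; lra.
have lbS : has_lbound S.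
  case: (Omega0) => x0 Ox0.
  have dx0 : d x0 < t by rewrite Kd0//; exact: subset_closure.
  (* a plane further left would carry x0 outside the ball of radius M *)
  exists (Num.min (dot x0 e) ((dot x0 e - M) / 2)) => l Sl.
  rewrite ge_min; have [//|lx0] := leP (dot x0 e) l.
  have /hM RM := Sl l (lexx _) _ dx0 lx0.
  by have := dot_ler_norm (refl e l x0) e1; rewrite dot_refl// ler_norml; lra.
have infS : has_inf S by [].
pose l := inf S.
have Pgt m : l < m -> plane_ok m.
  by move=> /(inf_lt S0)[l' Sl' l'm]; apply: Sl'; exact: ltW.
have Pl : plane_ok l.
  move=> x dx lx.
  (* shifting the plane by r and the point by 2 r does not change the reflected
     point, and keeps the point in {d < t} *)
  pose r := (t - d x) / 4.
  have r0 : 0 < r by rewrite /r; lra.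
  have -> : refl e l x = refl e (l + r) (x + (2 * r) *: e).
    rewrite /refl dotDl dotZl e1; apply/rowP => i; rewrite !mxE; ring.
  apply: Pgt; first by rewrite ltrDl.
    have := dist_lipD (x + (2 * r) *: e) x Omega0.
    rewrite addrAC subrr add0r enormZ [enorm e]enormE e1 sqrtr1 mulr1 gtr0_norm; last lra.
    rewrite /r; lra.
  by rewrite dotDl dotZl e1; lra.
exists l; split.
  by move=> m; rewrite le_eqVlt => /predU1P[<-//|]; exact: Pgt.
move=> r r0; have : ~ S (l - r).
  by move=> Slr; have := ge_inf lbS Slr; rewrite -/l; lra.
move=> nS; have [m lm nPm] : exists2 m, l - r <= m & ~ plane_ok m.
  by apply: contrapT => h; apply: nS => m lm; apply: contrapT => nPm; apply: h; exists m.
exists m; split => //; rewrite ltNge le_eqVlt; apply/negP => /predU1P[lm'|/Pgt//].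
by apply: nPm; rewrite -lm'.
Qed.

(** The two contact cases at once: [h] is the gap between the two symmetric points,
  and [h = 0] is the tangential case, where the information is carried by the
  sequence of pairs with positive gap. For [h > 0] a constant sequence does. The
  pairs come from non-admissible planes increasing to the infimum, and converge
  because Gamma_t is bounded; their midpoints are caught between these planes and
  the critical one. *)
Lemma critical_plane : exists l a h (a_ : nat -> 'rV[R]_n) (h_ : nat -> R),
  [/\ forall m, l <= m -> plane_ok m,
      [/\ d a = t, d (a - h *: e) = t, dot a e - h / 2 = l & 0 <= h],
      forall k, [/\ d (a_ k) = t, d (a_ k - h_ k *: e) = t & 0 < h_ k],
      a_ k @[k --> \oo] --> a & h_ k @[k --> \oo] --> h].
Proof.
have [l [lP lnP]] := critical_inf.
have [[a [h [da dah h0 lah]]]|none] := pselect (exists a h,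
  [/\ d a = t, d (a - h *: e) = t, 0 < h & l <= dot a e - h / 2]).
  exists (dot a e - h / 2), a, h, (fun=> a), (fun=> h); split => //.
  - by move=> m lm; apply: lP; exact: le_trans lm.
  - by split => //; exact: ltW.
  - exact: cvg_cst.
  - exact: cvg_cst.
have /choice[a_ /choice[h_ hah]] : forall k : nat, exists a h,
    [/\ d a = t, d (a - h *: e) = t, 0 < h & l - k.+1%:R^-1 < dot a e - h / 2 < l].
  move=> k; have k0 : 0 < k.+1%:R^-1 :> R by [].
  have [m [lm ml /not_plane_ok[a [h [da dah h0 mah]]]]] := lnP _ k0.
  exists a, h; split => //; rewrite (le_lt_trans lm)//= ltNge; apply/negP => lah.
  by apply: none; exists a, h.
have bG : bounded_set [set a | d a = t].
  have [M hM] := bounded_enorm bO.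
  apply: (@bounded_sub_eball _ _ _ 0 (M + t + 1)) => a /= da.
  have [|y /hM yM ay] := @dist_lt _ _ Omega a (t + 1) Omega0; first by rewrite da ltrDl.
  by rewrite sub0r enormN; have := ler_enormD (a - y) y; rewrite subrK; lra.
have [|f [a [fk ca]]] := bounded_subsequence bG (u := a_).
  by move=> k; case: (hah k).
pose h := 2 * (dot a e - l).
have ch : h_ (f k) @[k --> \oo] --> h.
  have -> : (fun k => h_ (f k)) = (fun k => 2 * (dot (a_ (f k)) e -
     (dot (a_ (f k)) e - h_ (f k) / 2))).
    by apply/funext => k; field.
  apply: cvgM; first exact: cvg_cst.
  apply: cvgB.
    have cdot : continuous (fun x : 'rV[R]_n => dot x e).
      apply: (@lip_continuous _ _ _ 1) => x y; rewrite mul1r -dotNl -dotDl.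
      exact: dot_ler_norm.
    exact: (continuous_cvg _ (cdot a) ca).
  apply/cvgrPdist_lt => r r0; near=> k.
  have [_ _ _ /andP[h1 h2]] := hah (f k).
  have : k.+1%:R^-1 < r by near: k; exact: (near_infty_natSinv_lt (PosNum r0)).
  have : (f k).+1%:R^-1 <= k.+1%:R^-1 :> R by rewrite lef_pV2 ?posrE// ler_nat ltnS.
  move=> fkk kr; rewrite gtr0_norm ?subr_gt0//.
  by apply: lt_trans (le_lt_trans fkk kr); rewrite ltrBlDl -ltrBlDr.
have cd := dist_continuous Omega0.
exists l, a, h, (a_ \o f), (h_ \o f); split => //.
- have cah : a_ (f k) - h_ (f k) *: e @[k --> \oo] --> a - h *: e.
    by apply: cvgB => //; apply: cvgZr_tmp.
  split.
  + apply: (cvg_constant (u := fun k => d (a_ (f k)))).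
      by move=> k; case: (hah (f k)).
    exact: (continuous_cvg _ (cd a) ca).
  + apply: (cvg_constant (u := fun k => d (a_ (f k) - h_ (f k) *: e))).
      by move=> k; case: (hah (f k)).
    exact: (continuous_cvg _ (cd (a - h *: e)) cah).
  + by rewrite /h; lra.
  + by apply: (cvgr_to_ge ch); near=> k; case: (hah (f k)) => _ _ /ltW.
- by move=> k /=; case: (hah (f k)).
Unshelve. all: by end_near. Qed.

End moving_plane.

(** * Sets symmetric in every direction *)
Section symmetric_ball.
Context {R : realType} {n : nat}.
Variable Omega : set 'rV[R]_n.
Hypotheses (n1 : (1 <= n)%N) (oO : open Omega) (O0 : Omega !=set0)
  (bO : bounded_set Omega).
Hypothesis symO : forall e : 'rV[R]_n, dot e e = 1 -> exists l,
  (forall x, Omega x -> Omega (refl e l x)) /\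
  (forall m, l < m -> forall x, Omega x -> m < dot x e -> Omega (refl e m x)).

Let ei (i : 'I_n) : 'rV[R]_n := delta_mx ord0 i.

Let dot_ei x i : dot x (ei i) = x ord0 i.
Proof.
rewrite /dot (bigD1 i)//= !mxE !eqxx mulr1 big1 ?addr0// => j ji.
by rewrite !mxE (negbTE ji) andbF mulr0.
Qed.

Let ei1 i : dot (ei i) (ei i) = 1.
Proof. by rewrite dot_ei !mxE !eqxx. Qed.

(** The composition of the reflections along the coordinate axes is a point
  reflection. *)
Let center : exists c : 'rV[R]_n, forall x, Omega x -> Omega (2 *: c - x).
Proof.
have /choice[l hl] : forall i, exists l, forall x, Omega x -> Omega (refl (ei i) l x).
  by move=> i; have [l [hl _]] := symO (ei1 i); exists l.
exists (\row_i l i) => x Ox.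
pose y (k : nat) := \row_i (if (i < k)%N then 2 * l i - x ord0 i else x ord0 i).
have Oy k : (k <= n)%N -> Omega (y k).
  elim: k => [_|k IH kn].
    by rewrite (_ : y 0%N = x)//; apply/rowP => i; rewrite mxE ltn0.
  have -> : y k.+1 = refl (ei (Ordinal kn)) (l (Ordinal kn)) (y k).
    rewrite /refl dot_ei; apply/rowP => i; rewrite !mxE /= ltnn ltnS leq_eqVlt.
    have [ik|ik] := eqVneq i (Ordinal kn).
      by rewrite ik /= eqxx ltnn /=; ring.
    rewrite (_ : (i == k :> nat) = false) /= ?mulr0 ?subr0//.
    by apply/negbTE; apply: contra ik => /eqP ik; apply/eqP/val_inj.
  by apply: hl; apply: IH; exact: ltnW.
rewrite (_ : _ - x = y n); first exact: Oy.
by apply/rowP => i; rewrite !mxE ltn_ord.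
Qed.

(** All planes of symmetry pass through the centre [c] of the point reflection, so
  that [Omega] contains, with a point, its whole sphere about [c]; reflections in
  the planes beyond [c] fill the inside of the sphere. *)
Lemma symmetric_is_eball : is_eball Omega.
Proof.
have [c hc] := center.
have [M hM] := bounded_enorm bO.
have symc e : dot e e = 1 ->
    (forall x, Omega x -> Omega (refl e (dot c e) x)) /\
    (forall m, dot c e < m -> forall x, Omega x -> m < dot x e -> Omega (refl e m x)).
  move=> e1; have [l [h1 h2]] := symO e1.
  suff lE : l = dot c e by rewrite lE in h1 h2.
  (* reflecting in the plane and in c, twice, is a translation by r e, which must
     be trivial on a bounded set *)
  pose r := 4 * (dot c e - l).
  have tr x : Omega x -> Omega (x + r *: e).
    move=> /h1/hc/h1/hc; rewrite (_ : 2 *: c - _ = x + r *: e)//.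
    rewrite /refl !dotE e1 /r; apply/rowP => i; rewrite !mxE; ring.
  have trk k x : Omega x -> Omega (x + (k%:R * r) *: e).
    elim: k => [|k IH] Ox; first by rewrite mul0r scale0r addr0.
    by rewrite -natr1 mulrDl mul1r scalerDl addrA; apply: tr; exact: IH.
  case: O0 => x Ox.
  have bnd k : k%:R * `|r| <= M + `|dot x e|.
    have := hM _ (trk k x Ox); have := dot_ler_norm (x + (k%:R * r) *: e) e1.
    rewrite dotDl dotZl e1 mulr1 => a1 a2.
    rewrite -(ger0_norm (ler0n R k)) -normrM.
    have := ler_normB (dot x e + k%:R * r) (dot x e).
    rewrite addrAC subrr add0r => a3.
    by rewrite (le_trans a3)// lerD2r (le_trans a1).
  have [r0|r0] := eqVneq r 0.
    by move: r0; rewrite /r; lra.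
  have rp : 0 < `|r| by rewrite normr_gt0.
  have := bnd (Num.bound ((M + `|dot x e|) / `|r|)).
  rewrite -ler_pdivlMr// leNgt => /negP; case.
  by apply: archi_boundP; rewrite divr_ge0// -(mul0r `|r|) (bnd 0%N).
(* points at the same distance from c are symmetric about a plane through c *)
have rot x y : Omega x -> enorm (x - c) = enorm (y - c) -> Omega y.
  move=> Ox xy; have [->//|nxy] := eqVneq y x.
  have d0 : 0 < enorm (x - y) by apply: enorm_gt0; rewrite subr_eq0 eq_sym.
  pose e := (enorm (x - y))^-1 *: (x - y).
  have e1 : dot e e = 1.
    by rewrite /e dotZl dotZr -enorm_sq; field; rewrite gt_eqF.
  have := (symc e e1).1 x Ox; rewrite (_ : refl _ _ _ = y)//.
  have E : 2 * dot (x - c) (x - y) = enorm (x - y) ^+ 2.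
    have : enorm (x - c) ^+ 2 = enorm (y - c) ^+ 2 by rewrite xy.
    rewrite !enorm_sq !dotE (dotC c x) (dotC c y) (dotC y x); lra.
  rewrite /refl -dotNl -dotDl /e dotZr.
  have -> : 2 * ((enorm (x - y))^-1 * dot (x - c) (x - y)) = enorm (x - y).
    by rewrite mulrCA E; field; rewrite gt_eqF.
  by rewrite scalerA divff ?gt_eqF// scale1r subKr.
(* a plane orthogonal to the radius of x moves x along this radius *)
have dil x a : Omega x -> 0 <= a < 1 -> Omega (c + a *: (x - c)).
  move=> Ox /andP[a0 a1]; have [xc|nxc] := eqVneq x c.
    by rewrite xc subrr scaler0 addr0 -xc.
  have d0 : 0 < enorm (x - c) by apply: enorm_gt0; rewrite subr_eq0.
  set r := enorm (x - c) in d0 *.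
  pose e := r^-1 *: (x - c).
  have e1 : dot e e = 1.
    by rewrite /e dotZl dotZr -enorm_sq -/r; field; rewrite gt_eqF.
  have xe : dot x e = dot c e + r.
    have : dot (x - c) e = r.
      by rewrite /e dotZr -enorm_sq -/r; field; rewrite gt_eqF.
    by rewrite dotDl dotNl => <-; ring.
  have xcE : x - c = r *: e by rewrite /e scalerA divff ?gt_eqF// scale1r.
  have := (symc e e1).2 (dot c e + r * (1 + a) / 2) _ x Ox _.
  rewrite (_ : refl _ _ _ = c + a *: (x - c)).
    apply; first by rewrite ltrDl divr_gt0// mulr_gt0// ltr_pwDl.
    by rewrite xe ltrD2l; nra.
  rewrite /refl xe [in RHS]xcE -[in LHS](subrK c x) xcE.
  apply/rowP => i; rewrite !mxE; by field; rewrite gt_eqF.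
have mono x y : Omega x -> enorm (y - c) <= enorm (x - c) -> Omega y.
  move=> Ox; rewrite le_eqVlt => /predU1P[xy|xy].
    by apply: rot Ox _; rewrite xy.
  have d0 : 0 < enorm (x - c) by apply: le_lt_trans xy; exact: enorm_ge0.
  pose a := enorm (y - c) / enorm (x - c).
  have a0 : 0 <= a by rewrite divr_ge0 ?enorm_ge0.
  apply: (rot (c + a *: (x - c))).
    by apply: dil => //; rewrite a0 ltr_pdivrMr ?mul1r.
  by rewrite addrAC subrr add0r enormZ ger0_norm// /a divfK ?gt_eqF.
pose S := [set enorm (x - c) | x in Omega].
have supS : has_sup S.
  case: O0 => x Ox; split; first by exists (enorm (x - c)), x.
  exists (M + enorm c) => _ [y /hM yM <-].
  by rewrite (le_trans (ler_enormD _ _))// enormN lerD2r.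
have lt_sup x : Omega x -> enorm (x - c) < sup S.
  move=> Ox; have [v v1 xv] : exists2 v, dot v v = 1 & x - c = enorm (x - c) *: v.
    have [xc|nxc] := eqVneq x c.
      exists (ei (Ordinal n1)); first exact: ei1.
      by rewrite xc subrr enorm0 scale0r.
    have d0 : 0 < enorm (x - c) by apply: enorm_gt0; rewrite subr_eq0.
    exists ((enorm (x - c))^-1 *: (x - c)).
      by rewrite dotZl dotZr -enorm_sq; field; rewrite gt_eqF.
    by rewrite scalerA divff ?gt_eqF// scale1r.
  have : nbhs x Omega by apply: open_nbhs_nbhs.
  move=> /nbhs_enormP[r r0 rO].
  have Ox' : Omega (x + (r / 2) *: v).
    apply: rO; rewrite /eball/= opprD addrA subrr sub0r enormN enormZ.
    rewrite [enorm v]enormE v1 sqrtr1 mulr1 gtr0_norm ?divr_gt0//; lra.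
  have : enorm (x + (r / 2) *: v - c) <= sup S.
    by apply: ub_le_sup; [case: supS|exists (x + (r / 2) *: v)].
  have r20 : 0 < r / 2 by rewrite divr_gt0.
  apply: lt_le_trans; rewrite addrAC {2}xv -scalerDl enormZ.
  rewrite [enorm v]enormE v1 sqrtr1 mulr1 ger0_norm ?addr_ge0 ?enorm_ge0 ?(ltW r20)//.
  by rewrite ltrDl.
exists c, (sup S); split.
  by case: O0 => x /lt_sup; apply: le_lt_trans; exact: enorm_ge0.
apply/seteqP; split => x; rewrite /eball/= enormBC; first exact: lt_sup.
move=> /(sup_gt supS.1)[_ [y Oy <-] xy].
by apply: mono Oy _; exact: ltW.
Qed.

End symmetric_ball.

(** * Integrability by countable covers and the Gamma integral *)
Lemma nneseries_geometric_lty (R : realType) (C q : R) : 0 <= C -> 0 < q < 1 ->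
  (\sum_(n <oo) (C * q ^+ n)%:E < +oo)%E.
Proof.
move=> C0 /andP[q0 q1]; apply: (@le_lt_trans _ _ (C * (1 - q)^-1)%:E); last exact: ltry.
apply: lime_le.
  by apply: is_cvg_nneseries => n _ _; rewrite lee_fin mulr_ge0 ?exprn_ge0// ltW.
near=> n; rewrite sumEFin lee_fin.
by have := @geometric_le_lim R n C q C0 q0; rewrite ger0_norm ?(ltW q0)//; apply.
Unshelve. all: by end_near. Qed.

(** The sum of the [c j] times the indicators of the [A j] dominates [f]. With
  intervals or balls as [A j], this replaces explicit primitives and
  polar coordinates in the study of power-like singularities. *)
Lemma integral_cover_lty d (T : measurableType d) (R : realType)
    (mu : {measure set T -> \bar R}) (D : set T) (f : T -> R)
    (A : nat -> set T) (c : nat -> R) (C q : R) :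
  measurable D -> measurable_fun D f -> (forall x, D x -> 0 <= f x) ->
  (forall j, measurable (A j)) -> (forall j, 0 <= c j) ->
  (forall x, D x -> exists2 j, A j x & f x <= c j) ->
  0 <= C -> 0 < q < 1 -> (forall j, ((c j)%:E * mu (A j) <= (C * q ^+ j)%:E)%E) ->
  (\int[mu]_(x in D) (f x)%:E < +oo)%E.
Proof.
move=> mD mf f0 mA c0 cov C0 q01 hc.
have mg j : measurable_fun D (fun x => (c j * \1_(A j) x)%:E).
  by apply/measurable_EFinP; apply: measurable_funM.
have g0 j x : (0 <= (c j * \1_(A j) x)%:E)%E by rewrite lee_fin mulr_ge0.
apply: (@le_lt_trans _ _ (\int[mu]_(x in D) \sum_(j <oo) (c j * \1_(A j) x)%:E)%E).
  apply: ge0_le_integral => //.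
  - exact/measurable_EFinP.
  - by apply: ge0_emeasurable_sum => [j x Dx _|j _]; [exact: g0|exact: mg].
  move=> x Dx; have [j Ajx fc] := cov x Dx.
  apply: le_trans (nneseries_lim_ge j.+1 _); last by move=> k _ _; exact: g0.
  rewrite big_nat_recr//= (@le_trans _ _ (c j * \1_(A j) x)%:E)//.
    by rewrite lee_fin indicE mem_set// mulr1.
  by rewrite leeDr// sume_ge0.
rewrite integral_nneseries//.
apply: le_lt_trans (nneseries_geometric_lty C0 q01).
apply: lee_nneseries => [j _ _|j _]; first by apply: integral_ge0 => x _; exact: g0.
apply: le_trans (hc j); under eq_integral do rewrite EFinM.
rewrite ge0_integralZl//; last by rewrite lee_fin.
rewrite integral_indic//; apply: lee_wpmul2l; first by rewrite lee_fin.
by apply: le_measure; rewrite ?inE//; exact: measurableI.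
by apply/measurable_EFinP.
Qed.

Lemma dyadic_large (R : realType) (r : R) : 1 <= r ->
  exists j : nat, 2 ^+ j <= r < 2 ^+ j.+1.
Proof.
move=> r1; have ex : exists j : nat, r < 2 ^+ j.+1.
  exists (Num.bound r); apply: (@lt_le_trans _ _ (Num.bound r)%:R).
    by apply: archi_boundP; exact: le_trans r1.
  by rewrite -natrX ler_nat (leq_trans (ltnW (ltn_expl _ (ltnSn 1))))// leq_exp2l.
have [j rj jmin] := ex_minnP ex; exists j; rewrite rj andbT.
case: j rj jmin => [|j] rj jmin; first by rewrite expr0.
by rewrite leNgt; apply/negP => /jmin; rewrite ltnn.
Qed.

Lemma dyadic_small (R : realType) (r : R) : 0 < r < 1 ->
  exists j : nat, 2^-1 ^+ j.+1 <= r < 2^-1 ^+ j.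
Proof.
move=> /andP[r0 r1]; have ex : exists j : nat, 2^-1 ^+ j.+1 <= r.
  have [|j /andP[_ jr]] := @dyadic_large R r^-1; first by rewrite invf_ge1 ?ltW.
  by exists j; rewrite exprVn -[r]invrK lef_pV2 ?posrE ?exprn_gt0 ?invr_gt0// ltW.
have [j rj jmin] := ex_minnP ex; exists j; rewrite rj /=.
case: j rj jmin => [|j] rj jmin; first by rewrite expr0.
by rewrite ltNge; apply/negP => /jmin; rewrite ltnn.
Qed.

Lemma powR_expn (R : realType) (a x : R) (j : nat) : 0 <= a ->
  (a ^+ j) `^ x = (a `^ x) ^+ j.
Proof. by move=> a0; rewrite -powR_mulrn// powRAC powR_mulrn// powR_ge0. Qed.

Lemma powR_lt1 (R : realType) (x : R) : 0 < x -> 0 < 2^-1 `^ x < 1.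
Proof.
move=> x0; rewrite powR_gt0//= [ltRHS](_ : 1 = 1 `^ x); last by rewrite powR1.
by apply: gt0_ltr_powR => //; rewrite ?nnegrE// invf_lt1// ltr1n.
Qed.

Section Gamma.
Context {R : realType}.
Variable z : R.
Hypothesis z0 : 0 < z.
Local Notation mu := (@lebesgue_measure R).

Let f (x : R) := x `^ (z - 1) * expR (- x).

Let mf (D : set R) : measurable_fun D (f : measurableTypeR R -> measurableTypeR R).
Proof.
apply: measurable_funTS; apply: measurable_funM; first exact: measurable_powR.
by apply: measurableT_comp => //; apply: measurableT_comp.
Qed.

Let f0 x : 0 <= f x.
Proof. by rewrite mulr_ge0 ?powR_ge0// expR_ge0. Qed.

Let int_small : (\int[mu]_(x in `]0%R, 1%R[) (f x)%:E < +oo)%E.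
Proof.
apply: (@integral_cover_lty _ _ _ mu `]0, 1[%classic f
  (fun j => `]0, 2^-1 ^+ j[%classic)
  (fun j => 2 * (2^-1 `^ z) ^+ j * 2 ^+ j) 2 (2^-1 `^ z)) => //.
- exact: mf.
- move=> x /=; rewrite in_itv/= => x01; have [j /andP[jx xj]] := dyadic_small x01.
  have /andP[x0 x1] := x01.
  exists j; first by rewrite /= in_itv/= x0.
  rewrite /f (@le_trans _ _ (x `^ (z - 1)))//.
    by rewrite ler_piMr ?powR_ge0// expR_le1 oppr_le0 ltW.
  have -> : x `^ (z - 1) = x `^ z / x.
    by rewrite powRB ?(gt_eqF x0) ?implybT// powRr1// ltW.
  rewrite -powR_expn//.
  rewrite [leRHS]mulrAC -exprS [leRHS]mulrC.
  rewrite ler_pM ?powR_ge0 ?invr_ge0 ?(ltW x0)//.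
    by apply: ge0_ler_powR; rewrite ?nnegrE ?(ltW z0) ?(ltW x0) ?exprn_ge0// ltW.
  by rewrite -[leRHS]invrK -exprVn lef_pV2 ?posrE ?exprn_gt0.
- by rewrite powR_lt1.
- move=> j; apply: le_trans (_ : (_ * (2^-1 ^+ j)%:E <= _)%E).
    apply: lee_wpmul2l; first by rewrite lee_fin.
    by rewrite le_eqVlt; apply/predU1P; left;
      rewrite [LHS]lebesgue_measure_itv/= lte_fin exprn_gt0// oppr0 adde0.
  by rewrite -EFinM lee_fin exprVn mulfK// expf_neq0.
Qed.

Let int_large : (\int[mu]_(x in `[1%R, +oo[) (f x)%:E < +oo)%E.
Proof.
have [N [N0 zN]] : exists N : nat, (0 < N)%N /\ z - 1 <= N%:R.
  exists (Num.bound z).+1; split => //; rewrite lerBlDr -natr1.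
  have := archi_boundP (ltW z0); move: (_%:R) => b; lra.
have N0' : 0 < N%:R :> R by rewrite ltr0n.
apply: (@integral_cover_lty _ _ _ mu `[1, +oo[%classic f
  (fun j => `[j%:R, j.+1%:R[%classic)
  (fun j => (2 * N%:R) ^+ N * (expR (- 2^-1)) ^+ j) ((2 * N%:R) ^+ N) (expR (- 2^-1))) => //.
- exact: mf.
- move=> x /=; rewrite in_itv/= andbT => x1.
  have x0 : 0 <= x by apply: le_trans x1.
  exists (Num.trunc x); first by rewrite /= in_itv/= truncn_itv.
  have jx : (Num.trunc x)%:R <= x by have /andP[] := truncn_itv x0.
  have h1 : x `^ (z - 1) <= x ^+ N.
    by rewrite -powR_mulrn//; exact: ler_powR.
  have h2 : x ^+ N <= (2 * N%:R) ^+ N * expR (x / 2).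
    (* half of the exponential absorbs the power, by 1 + y <= exp y *)
    have -> : x / 2 = N%:R * (x / (2 * N%:R)) by field; rewrite gt_eqF.
    rewrite expRM_natl -exprMn lerXn2r ?nnegrE ?mulr_ge0 ?expR_ge0//.
    have := expR_ge1Dx (x / (2 * N%:R)) => h.
    rewrite [leLHS](_ : x = 2 * N%:R * (x / (2 * N%:R))); last by field; rewrite gt_eqF.
    by rewrite ler_wpM2l ?mulr_ge0// (le_trans _ h)// lerDr.
  rewrite /f (@le_trans _ _ ((2 * N%:R) ^+ N * expR (x / 2) * expR (- x)))//.
    by rewrite ler_wpM2r ?expR_ge0// (le_trans h1).
  rewrite -mulrA -expRD ler_wpM2l ?exprn_ge0 ?mulr_ge0// -expRM_natl ler_expR.
  by rewrite mulrN lerNr; lra.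
- by apply/andP; split; [exact: expR_gt0|rewrite expR_lt1 oppr_lt0 invr_gt0].
- move=> j; apply: le_trans (_ : (_ * 1%:E <= _)%E); last by rewrite mule1.
  apply: lee_wpmul2l; first by rewrite lee_fin.
  by rewrite le_eqVlt; apply/predU1P; left;
    rewrite [LHS]lebesgue_measure_itv/= lte_fin ltr_nat ltnSn -EFinB -natr1 addrAC subrr add0r.
Qed.

(** [GammaR] is the finite part of an extended integral and would be 0 if this
  integral were infinite, so convergence is part of the proof. *)
Lemma GammaR_gt0 : 0 < GammaR z.
Proof.
have split01 : `]0, +oo[%classic = `]0, 1[ `|` `[1, +oo[ :> set R.
  apply/seteqP; split => x /=; rewrite !in_itv/= ?andbT.
    by move=> x0; have [x1|x1] := ltP x 1; [left|right]; rewrite ?x0.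
  by case=> [/andP[]//|]; apply: lt_le_trans.
rewrite /GammaR /Rintegral; apply: fine_gt0; apply/andP; split; last first.
  rewrite split01 ge0_integral_setU//=.
  - by rewrite lte_add_pinfty// ?int_small ?int_large.
  - by apply/measurable_EFinP; exact: mf.
  - by move=> x _; rewrite lee_fin; exact: f0.
  - apply/disj_setPS => x /= []; rewrite !in_itv/= andbT => /andP[_].
    by rewrite ltNge => /negP.
apply: (@lt_le_trans _ _ (\int[mu]_(x in `[1%R, 2%R]) (expR (- 2) * Num.min 1 (2 `^ (z - 1)))%R%:E)%E).
  rewrite integral_cst//= [X in (_ * X)%E]lebesgue_measure_itv/= lte_fin ltr1n.
  by rewrite mule_gt0// ?lte_fin ?mulr_gt0 ?expR_gt0// ?lt_min ?ltr01 ?powR_gt0// subr_gt0 ltr1n.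
apply: (@le_trans _ _ (\int[mu]_(x in `[1%R, 2%R]) (f x)%:E)%E).
  apply: ge0_le_integral => //.
  - by apply/measurable_EFinP; exact: mf.
  move=> x /=; rewrite in_itv/= => /andP[x1 x2]; rewrite lee_fin /f mulrC.
  rewrite ler_pM ?le_min ?ler01 ?powR_ge0 ?expR_ge0// ?ler_expR ?lerN2//.
  have [z1|z1] := leP 1 z.
    rewrite ge_min (_ : 1 <= x `^ (z - 1))//.
    rewrite -[leLHS](powRr0 x); apply: ler_powR => //; lra.
  rewrite ge_min (_ : 2 `^ (z - 1) <= x `^ (z - 1)) ?orbT//.
  have x0 : 0 < x by exact: lt_le_trans ltr01 x1.
  rewrite -[z - 1]opprB !powRN lef_pV2 ?posrE ?powR_gt0//.
  by apply: ge0_ler_powR; rewrite ?nnegrE ?(ltW x0)// subr_ge0 ltW.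
apply: ge0_subset_integral => //.
- by apply/measurable_EFinP; exact: mf.
- by move=> x _; rewrite lee_fin; exact: f0.
- by move=> x /=; rewrite !in_itv/= andbT => /andP[x1 _]; apply: lt_le_trans x1.
Qed.

End Gamma.

Lemma frac_const_gt0 (R : realType) n (s : R) : 0 < s -> s < 1 -> 0 < frac_const n s.
Proof.
move=> s0 s1; rewrite /frac_const.
by rewrite divr_gt0 ?GammaR_gt0// ?mulr_gt0 ?GammaR_gt0 ?powR_gt0 ?pi_gt0 ?subr_gt0//
  ?ltr_wpDl ?divr_ge0//; lra.
Qed.

(** * The fractional kernel and its energy space *)
Lemma ge0_integral_scale d (X : measurableType d) (R : realType)
    (m : {measure set X -> \bar R}) (c : R) (f : X -> R) :
  0 <= c -> measurable_fun setT f -> (forall x, 0 <= f x) ->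
  (\int[m]_x (c * f x)%:E = c%:E * \int[m]_x (f x)%:E)%E.
Proof.
move=> c0 mf f0; under eq_integral do rewrite EFinM.
rewrite ge0_integralZl//; first exact/measurable_EFinP.
by move=> x _; rewrite lee_fin.
Qed.

Lemma prod_integral_lty d (X : measurableType d) (R : realType)
    (m : {sigma_finite_measure set X -> \bar R}) (f f1 f2 : X * X -> R) :
  measurable_fun setT f -> measurable_fun setT f1 -> measurable_fun setT f2 ->
  (forall p, 0 <= f p) -> (forall p, 0 <= f1 p) -> (forall p, 0 <= f2 p) ->
  (forall p, f p <= f1 p + f2 p) ->
  (\int[m]_x \int[m]_y (f1 (x, y))%:E < +oo)%E ->
  (\int[m]_y \int[m]_x (f2 (x, y))%:E < +oo)%E ->
  (\int[m \x m]_p (f p)%:E < +oo)%E.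
Proof.
move=> mf mf1 mf2 f0 f10 f20 ff i1 i2.
apply: (@le_lt_trans _ _ (\int[m \x m]_p ((f1 p)%:E + (f2 p)%:E))%E).
  apply: ge0_le_integral => //.
  - by move=> p _; rewrite lee_fin.
  - exact/measurable_EFinP.
  - by apply: emeasurable_funD; apply/measurable_EFinP.
  - by move=> p _; rewrite -EFinD lee_fin.
rewrite ge0_integralD//; last 4 first.
- by move=> p _; rewrite lee_fin.
- exact/measurable_EFinP.
- by move=> p _; rewrite lee_fin.
- exact/measurable_EFinP.
apply: lte_add_pinfty.
  have mEf1 : measurable_fun setT (EFin \o f1) by exact/measurable_EFinP.
  by rewrite (fubini_tonelli1 (EFin \o f1) mEf1)// => p; rewrite /= lee_fin.
have mEf2 : measurable_fun setT (EFin \o f2) by exact/measurable_EFinP.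
by rewrite (fubini_tonelli2 (EFin \o f2) mEf2)// => p; rewrite /= lee_fin.
Qed.

Section Hs.
Context {R : realType} {n : nat}.
Variable s : R.
Hypotheses (n1 : (1 <= n)%N) (s0 : 0 < s) (s1 : s < 1).
Local Notation mu := (lebesgue_rV R n).
Local Notation T := 'rV[R]_n.

(** Since division by zero gives zero, the kernel takes the value 0 at the origin
  instead of being infinite. The diagonal is a null set, but pointwise comparisons
  of kernels have to exclude it. *)
Definition fker (z : T) : R := (enorm z `^ (n%:R + 2 * s))^-1.

Let p0 : 0 < n%:R + 2 * s. Proof. by rewrite ltr_wpDl// mulr_gt0. Qed.

Lemma fkerE (z : T) : enorm z `^ (- n%:R - 2 * s) = fker z.
Proof. by rewrite -opprD powRN. Qed.

Lemma fker_ge0 z : 0 <= fker z.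
Proof. by rewrite invr_ge0 powR_ge0. Qed.

Lemma fker0 : fker 0 = 0.
Proof. by rewrite /fker enorm0 powR0 ?invr0// gt_eqF. Qed.

Lemma fkerN z : fker (- z) = fker z.
Proof. by rewrite /fker enormN. Qed.

Lemma fker_gt0 z : z != 0 -> 0 < fker z.
Proof. by move=> z0; rewrite invr_gt0 powR_gt0// enorm_gt0. Qed.

Lemma le_fker (r : R) z : 0 < r -> r <= enorm z -> fker z <= (r `^ (n%:R + 2 * s))^-1.
Proof.
move=> r0 rz; have z0 : 0 < enorm z by exact: lt_le_trans rz.
rewrite lef_pV2 ?posrE ?powR_gt0//.
by apply: ge0_ler_powR; rewrite ?nnegrE ?(ltW r0) ?(ltW z0) ?(ltW p0).
Qed.

Lemma measurable_fker : measurable_fun setT fker.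
Proof.
rewrite (_ : fker = (fun r => r `^ (- (n%:R + 2 * s))) \o @enorm R n); last first.
  by apply/funext => z; rewrite /= powRN.
apply: measurableT_comp; first exact: measurable_powR.
exact: (continuous_measurable_rV (@enorm_continuous R n)).
Qed.

Lemma measurable_rV_sub : measurable_fun setT (fun p : T * T => p.1 - p.2).
Proof.
apply: measurable_fun_rVP => i; under eq_fun do rewrite !mxE.
apply: measurable_funB.
  exact: (measurableT_comp (measurable_rV_coord i) measurable_fst).
exact: (measurableT_comp (measurable_rV_coord i) measurable_snd).
Qed.

Lemma measurable_fker_sub : measurable_fun setT (fun p : T * T => fker (p.1 - p.2)).
Proof. exact: measurableT_comp measurable_fker measurable_rV_sub. Qed.

Lemma Lfun2P d (X : measurableType d) (m : {measure set X -> \bar R}) (f : X -> R) :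
  f \in Lfun m 2%:E <->
  measurable_fun setT f /\ (\int[m]_x ((f x) ^+ 2)%:E < +oo)%E.
Proof.
split=> [fL|[mf fi]].
  have mf : measurable_fun setT f by move: fL; rewrite inE => /andP[]; rewrite inE.
  split => //; have /integrableP[_] := Lfun2_integrable_sqr fL.
  by under eq_integral do rewrite /= ger0_norm ?sqr_ge0//.
rewrite inE; apply/andP; split; rewrite inE//=.
rewrite /finite_norm unlock /Lnorm; apply: poweR_lty.
by under eq_integral do rewrite /= powR_mulrn// real_normK ?num_real//.
Qed.

Definition gagliardo (u v : T -> R) (p : T * T) : R :=
  (u p.1 - u p.2) * (v p.1 - v p.2) * fker (p.1 - p.2).

Lemma measurable_gagliardo u v : measurable_fun setT u -> measurable_fun setT v ->
  measurable_fun setT (gagliardo u v).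
Proof.
move=> mf mg; apply: measurable_funM; last exact: measurable_fker_sub.
by apply: measurable_funM; apply: measurable_funB;
  by [exact: (measurableT_comp _ measurable_fst)|exact: (measurableT_comp _ measurable_snd)].
Qed.

Lemma gagliardo_ge0 u p : 0 <= gagliardo u u p.
Proof. by rewrite mulr_ge0 ?fker_ge0// -expr2 sqr_ge0. Qed.

(** Membership in the energy space in terms of integrals over the product measure,
  to which Fubini, invariance under reflections and monotonicity apply. *)
Lemma HsP (u : T -> R) : Hs s u <-> [/\ measurable_fun setT u,
  (\int[mu]_x ((u x) ^+ 2)%:E < +oo)%E &
  (\int[mu \x mu]_p (gagliardo u u p)%:E < +oo)%E].
Proof.
have E : measurable_fun setT u -> (\int[mu]_x \int[mu]_y
     (`|u x - u y| ^+ 2 * enorm (x - y) `^ (- n%:R - 2 * s))%:E =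
    \int[mu \x mu]_p (gagliardo u u p)%:E)%E.
  move=> mf.
  transitivity (\int[mu]_x \int[mu]_y (gagliardo u u (x, y))%:E)%E.
    apply: eq_integral => x _; apply: eq_integral => y _.
    by rewrite /gagliardo /= fkerE real_normK ?num_real// expr2.
  apply/esym; apply: (fubini_tonelli1 (fun p => (gagliardo u u p)%:E)).
    by apply/measurable_EFinP; exact: measurable_gagliardo.
  by move=> p; rewrite lee_fin gagliardo_ge0.
split=> [[/Lfun2P[mf fi] h]|[mf fi h]].
  by split => //; rewrite -E.
by split; [exact/Lfun2P|rewrite E].
Qed.

(** A tent over a ball of the sup norm, whose measure is immediate. *)
Definition bump (x0 : T) (r : R) (x : T) : R := Num.max 0 (r - `|x0 - x|).

Lemma bump_lip x0 r x y : `|bump x0 r x - bump x0 r y| <= `|x - y|.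
Proof.
have h1 := ler_distD x x0 y; have h2 := ler_distD y x0 x.
rewrite (distrC y x) in h2; rewrite /bump ler_norml.
move: `|x0 - x| `|x0 - y| `|x - y| h1 h2 => a b c h1 h2.
rewrite !maxEle; case: ifP => ha; case: ifP => hb; lra.
Qed.

Lemma continuous_bump x0 r : continuous (bump x0 r).
Proof.
apply: (@lip_continuous _ _ _ 1) => x y; rewrite mul1r.
exact: le_trans (bump_lip _ _ _ _) (normr_le_enorm _).
Qed.

Lemma bump_ge0 x0 r x : 0 <= bump x0 r x.
Proof. by rewrite le_max lexx. Qed.

Lemma bump_le x0 r x : 0 < r -> bump x0 r x <= r.
Proof. by move=> r0; rewrite ge_max ltW//= gerBl. Qed.

Lemma bump_out x0 r x : ~ ball x0 r x -> bump x0 r x = 0.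
Proof.
rewrite -ball_normE/= => /negP; rewrite -leNgt => h.
by rewrite /bump; apply/max_idPl; rewrite subr_le0.
Qed.

(** On the shell of radius 2^-j the integrand is of order 2^(-j (2 - n - 2 s)), on a
  set of measure of order 2^(-j n); the product is summable as [s < 1]. *)
Let small_int : (\int[mu]_(z in ball (0%R : T) 1%R) (`|z| ^+ 2 * fker z)%R%:E < +oo)%E.
Proof.
have b0 j : 0 < 2^-1 ^+ j :> R by rewrite exprn_gt0.
have mball (r : R) : measurable (ball (0 : T) r).
  by apply: open_measurable_rV; exact: ball_open.
apply: (@integral_cover_lty _ _ _ mu (ball (0 : T) 1) (fun z => `|z| ^+ 2 * fker z)
  (fun j => ball (0 : T) (2^-1 ^+ j))
  (fun j => (2^-1 ^+ j) ^+ 2 * ((2^-1 ^+ j.+1) `^ (n%:R + 2 * s))^-1)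
  (2 ^+ n * (2^-1 `^ (n%:R + 2 * s))^-1) (2^-1 `^ (2 - 2 * s))).
- exact: mball.
- apply: measurable_funTS; apply: measurable_funM; last exact: measurable_fker.
  apply: measurable_funX; apply: continuous_measurable_rV; exact: norm_continuous.
- by move=> z _; rewrite mulr_ge0 ?fker_ge0.
- by move=> j; exact: mball.
- by move=> j; rewrite mulr_ge0 ?invr_ge0 ?powR_ge0 ?sqr_ge0.
- move=> z; rewrite -ball_normE/= sub0r normrN => z1.
  have [->|z0] := eqVneq z 0.
    exists 0%N; first by rewrite ?sub0r ?normrN normr0.
    by rewrite fker0 mulr0 mulr_ge0 ?invr_ge0 ?powR_ge0 ?sqr_ge0.
  have [|j /andP[jz zj]] := @dyadic_small R `|z|; first by rewrite normr_gt0 z0.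
  exists j; first by rewrite ?sub0r ?normrN.
  rewrite ler_pM ?sqr_ge0 ?fker_ge0//.
    by rewrite ler_sqr ?nnegrE// ltW.
  by apply: le_fker => //; apply: le_trans (normr_le_enorm z).
- by rewrite mulr_ge0 ?invr_ge0 ?powR_ge0 ?exprn_ge0.
- by apply: powR_lt1; rewrite subr_gt0 gtr_pMr.
move=> j; rewrite [X in (_ * X)%E](lebesgue_rV_ball _ (b0 j)) -EFinM lee_fin.
rewrite -powR_expn// (exprS _ j); move: (b0 j); set b := 2^-1 ^+ j => bp.
have -> : b `^ (2 - 2 * s) = b ^+ 2 * b ^+ n * (b `^ (n%:R + 2 * s))^-1.
  rewrite (_ : 2 - 2 * s = 2%:R + n%:R - (n%:R + 2 * s)); last by ring.
  rewrite powRB ?(gt_eqF bp) ?implybT// powRD ?(gt_eqF bp) ?implybT//.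
  by rewrite !powR_mulrn ?(ltW bp).
rewrite powRM ?(ltW bp)// invfM -[b *+ 2]mulr_natl (exprMn n 2 b).
by rewrite le_eqVlt; apply/predU1P; left; ring.
Qed.

(** Outside the unit ball radii 2^j serve, and summability comes from [0 < s]. *)
Let large_int : (\int[mu]_(z in ~` ball (0%R : T) 1%R) (fker z)%:E < +oo)%E.
Proof.
have b0 j : 0 < 2 ^+ j :> R by rewrite exprn_gt0.
have mball (r : R) : measurable (ball (0 : T) r).
  by apply: open_measurable_rV; exact: ball_open.
have s20 : 0 < 2 * s by rewrite mulr_gt0.
apply: (@integral_cover_lty _ _ _ mu (~` ball (0 : T) 1) fker
  (fun j => ball (0 : T) (2 ^+ j.+1))
  (fun j => ((2 ^+ j) `^ (n%:R + 2 * s))^-1)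
  (4 ^+ n) (2 `^ (- (2 * s)))).
- exact: measurableC.
- by apply: measurable_funTS; exact: measurable_fker.
- by move=> z _; rewrite fker_ge0.
- by move=> j; exact: mball.
- by move=> j; rewrite invr_ge0 powR_ge0.
- move=> z; rewrite -ball_normE/= sub0r normrN => /negP; rewrite -leNgt => z1.
  have [j /andP[jz zj]] := dyadic_large z1.
  exists j; first by rewrite ?sub0r ?normrN.
  by apply: le_fker => //; apply: le_trans (normr_le_enorm z).
- by rewrite exprn_ge0.
- rewrite powR_gt0// powRN invf_lt1 ?powR_gt0//=.
  rewrite [ltLHS](_ : 1 = 1 `^ (2 * s)); last by rewrite powR1.
  by apply: gt0_ltr_powR => //; rewrite ?nnegrE// ltr1n.
move=> j; rewrite [X in (_ * X)%E](lebesgue_rV_ball _ (b0 j.+1)) -EFinM lee_fin.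
rewrite -powR_expn// (exprS _ j); move: (b0 j); set b := 2 ^+ j => bp.
have -> : b `^ (- (2 * s)) = b ^+ n * (b `^ (n%:R + 2 * s))^-1.
  rewrite (_ : - (2 * s) = n%:R - (n%:R + 2 * s)); last by ring.
  by rewrite powRB ?(gt_eqF bp) ?implybT// !powR_mulrn ?(ltW bp).
rewrite -[2 * b *+ 2]mulr_natl mulrA -natrM (exprMn n _ b).
by rewrite le_eqVlt; apply/predU1P; left; ring.
Qed.

(** The squared difference is at most min(|x - y|^2, r^2), and it vanishes unless one
  of the two points lies in the ball. Integrating first over the other point leaves
  the integral of [g], which converges near the origin and at infinity. *)
Lemma Hs_bump x0 r : 0 < r -> Hs s (bump x0 r).
Proof.
move=> r0; apply/HsP.
have mb : measurable_fun setT (bump x0 r).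
  by apply: continuous_measurable_rV; exact: continuous_bump.
have mball (c : T) (r' : R) : measurable (ball c r').
  by apply: open_measurable_rV; exact: ball_open.
have muB : (mu (ball x0 r) < +oo)%E by rewrite lebesgue_rV_ball// ltry.
pose g (z : T) := Num.min (`|z| ^+ 2) (r ^+ 2) * fker z.
have g0 z : 0 <= g z by rewrite mulr_ge0 ?fker_ge0// le_min !sqr_ge0.
have mg : measurable_fun setT g.
  apply: measurable_funM; last exact: measurable_fker.
  apply: measurable_minr => //; apply: measurable_funX.
  apply: continuous_measurable_rV; exact: norm_continuous.
have mEg : measurable_fun setT (EFin \o g) by exact/measurable_EFinP.
have gN z : g (- z) = g z by rewrite /g normrN fkerN.
have Ig : (\int[mu]_z (g z)%:E < +oo)%E.
  rewrite -(setUv (ball (0 : T) 1)) ge0_integral_setU//=.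
  - apply: lte_add_pinfty.
      apply: le_lt_trans small_int; apply: ge0_le_integral => //.
      + by move=> z _; rewrite lee_fin.
      + exact: measurable_funTS.
      + apply/measurable_EFinP/measurable_funTS.
        apply: measurable_funM; last exact: measurable_fker.
        by apply: measurable_funX; apply: continuous_measurable_rV; exact: norm_continuous.
      by move=> z _; rewrite lee_fin ler_wpM2r ?fker_ge0// ge_min lexx.
    apply: (@le_lt_trans _ _ (\int[mu]_(z in ~` ball (0%R : T) 1%R) ((r ^+ 2)%:E * (fker z)%:E))%E).
      apply: ge0_le_integral => //.
      + exact: measurableC.
      + by move=> z _; rewrite lee_fin.
      + exact: measurable_funTS.
      + apply/measurable_EFinP/measurable_funTS.
        by apply: measurable_funM => //; exact: measurable_fker.
      by move=> z _; rewrite lee_fin ler_wpM2r ?fker_ge0// ge_min lexx orbT.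
    rewrite ge0_integralZl//.
    + by apply: lte_mul_pinfty; rewrite ?lee_fin ?sqr_ge0.
    + exact: measurableC.
    + by apply/measurable_EFinP/measurable_funTS; exact: measurable_fker.
    + by move=> z _; rewrite lee_fin fker_ge0.
    + by rewrite lee_fin sqr_ge0.
  - exact: measurableC.
  - by rewrite setUv.
  - by move=> z _; rewrite lee_fin.
  - by apply/disj_setPS => z [].
split => //.
  apply: (@le_lt_trans _ _ (\int[mu]_x ((r ^+ 2)%:E * (\1_(ball x0 r) x)%:E))%E).
    apply: ge0_le_integral => //.
    + by move=> x _; rewrite lee_fin sqr_ge0.
    + by apply/measurable_EFinP; exact: measurable_funX.
    + by apply/measurable_EFinP; exact: measurable_funM.
    move=> x _; rewrite -EFinM lee_fin indicE.
    have [xB|xB] := pselect (ball x0 r x).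
      by rewrite mem_set// mulr1 ler_sqr ?nnegrE ?bump_ge0 ?(ltW r0)// bump_le.
    by rewrite memNset// bump_out// expr0n mulr0.
  rewrite ge0_integralZl//.
  - by rewrite integral_indic// setIT; apply: lte_mul_pinfty; rewrite ?lee_fin ?sqr_ge0.
  - by apply/measurable_EFinP.
  - by rewrite lee_fin sqr_ge0.
have mgd : measurable_fun setT (fun p : T * T => g (p.1 - p.2)).
  exact: measurableT_comp mg measurable_rV_sub.
have mB1 : measurable_fun setT (fun p : T * T => \1_(ball x0 r) p.1 : R).
  by apply: (measurableT_comp (f := \1_(ball x0 r) : _ -> R)); [exact: measurable_indic|].
have mB2 : measurable_fun setT (fun p : T * T => \1_(ball x0 r) p.2 : R).
  by apply: (measurableT_comp (f := \1_(ball x0 r) : _ -> R)); [exact: measurable_indic|].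
pose h1 (p : T * T) := \1_(ball x0 r) p.1 * g (p.1 - p.2).
pose h2 (p : T * T) := \1_(ball x0 r) p.2 * g (p.1 - p.2).
have mh1 : measurable_fun setT h1 by exact: (measurable_funM mB1 mgd).
have mh2 : measurable_fun setT h2 by exact: (measurable_funM mB2 mgd).
have h10 p : 0 <= h1 p by rewrite mulr_ge0.
have h20 p : 0 <= h2 p by rewrite mulr_ge0.
have mgx (x : T) : measurable_fun setT (fun y : T => g (x - y)).
  exact: (measurableT_comp mg (lebesgue_rV_subl x).1).
have Ig0 : (0 <= \int[mu]_z (g z)%:E)%E by apply: integral_ge0 => z _; rewrite lee_fin.
pose I := fine (\int[mu]_z (g z)%:E)%E.
have IE : (\int[mu]_z (g z)%:E = I%:E)%E by rewrite /I fineK// ge0_fin_numE.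
have I0 : 0 <= I by rewrite fine_ge0.
have inner (x : T) : (\int[mu]_y (\1_(ball x0 r) x * g (x - y))%:E =
    (I * \1_(ball x0 r) x)%:E)%E.
  rewrite (ge0_integral_scale mu _ (mgx x)) => [|//|y]; last exact: g0.
  have -> : (\int[mu]_y (g (x - y))%:E = I%:E)%E.
    rewrite -IE.
    exact: (mpres_ge0_integral (lebesgue_rV_subl x) (g := EFin \o g)).
  by rewrite -EFinM mulrC.
have outer : (\int[mu]_x (I * \1_(ball x0 r) x)%:E < +oo)%E.
  rewrite ge0_integral_scale//.
  by rewrite integral_indic// setIT; apply: lte_mul_pinfty.
apply: (prod_integral_lty (measurable_gagliardo mb mb) mh1 mh2
    (gagliardo_ge0 _) h10 h20); last 2 first.
- by under eq_integral do rewrite inner.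
- rewrite (eq_integral (fun y => (I * \1_(ball x0 r) y)%:E))// => y _.
  rewrite -inner; apply: eq_integral => x _ /=.
  by rewrite -gN opprB.
- move=> [x y]; rewrite /gagliardo /h1 /h2 /= -mulrDl.
  rewrite mulrA ler_wpM2r ?fker_ge0// -expr2 !indicE.
  have hb (a b : T) : (bump x0 r a - bump x0 r b) ^+ 2 <= Num.min (`|a - b| ^+ 2) (r ^+ 2).
    rewrite le_min; apply/andP; split.
      by rewrite -real_normK ?num_real// ler_sqr ?nnegrE// bump_lip.
    rewrite -real_normK ?num_real// ler_sqr ?nnegrE ?(ltW r0)//.
    have := bump_ge0 x0 r a; have := bump_ge0 x0 r b.
    have := bump_le x0 a r0; have := bump_le x0 b r0.
    by rewrite ler_norml; lra.
  have m0 : 0 <= Num.min (`|x - y| ^+ 2) (r ^+ 2) by rewrite le_min !sqr_ge0.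
  have [xB|xB] := pselect (ball x0 r x).
    by rewrite (mem_set xB); apply: le_trans (hb x y) _; rewrite ler_peMl// lerDl.
  have [yB|yB] := pselect (ball x0 r y).
    by rewrite (mem_set yB); apply: le_trans (hb x y) _; rewrite ler_peMl// lerDr.
  by rewrite !bump_out// subrr expr0n mulr_ge0// addr_ge0.
Qed.

End Hs.

(** * Vanishing integrals and null sets *)
Section integral_tools.
Context d (X : measurableType d) (R : realType).

Lemma integrable_fin (m : {measure set X -> \bar R}) (f : X -> R) :
  m.-integrable setT (EFin \o f) -> exists r : R, (\int[m]_x (f x)%:E = r%:E)%E.
Proof.
move=> fi; exists (fine (\int[m]_x (f x)%:E)%E); rewrite fineK//.
exact: integrable_fin_num.
Qed.

Lemma integrableD_EFin (m : {measure set X -> \bar R}) (f g : X -> R) :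
  m.-integrable setT (EFin \o f) -> m.-integrable setT (EFin \o g) ->
  m.-integrable setT (EFin \o (fun x => f x + g x)) /\
  (\int[m]_x (f x + g x)%:E = \int[m]_x (f x)%:E + \int[m]_x (g x)%:E)%E.
Proof.
move=> fi gi; split; last exact: integralD_EFin.
apply: eq_integrable (integrableD measurableT fi gi) => //.
Qed.

Lemma ge0_integral_eq0 (m : {measure set X -> \bar R}) (f : X -> R) :
  measurable_fun setT f -> (forall x, 0 <= f x) -> (\int[m]_x (f x)%:E <= 0)%E ->
  {ae m, forall x, f x = 0}.
Proof.
move=> mf f0 fi.
have /ae_eq_integral_abs : measurable_fun setT (EFin \o f) by exact/measurable_EFinP.
move=> /(_ m measurableT)[+ _].
have -> : (\int[m]_x `|(EFin \o f) x| = \int[m]_x (f x)%:E)%E.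
  by apply: eq_integral => x _ /=; rewrite ger0_norm.
move=> H; have /H : (\int[m]_x (f x)%:E = 0)%E.
  by apply/eqP; rewrite eq_le fi; apply: integral_ge0 => x _; rewrite lee_fin.
by apply: filterS => x /(_ I) [].
Qed.

Lemma ae_le_integral_le0 (m : {measure set X -> \bar R}) (f : X -> R) :
  measurable_fun setT f -> {ae m, forall x, f x <= 0} -> (\int[m]_x (f x)%:E <= 0)%E.
Proof.
move=> mf f0.
have -> : (\int[m]_x (f x)%:E = \int[m]_x (- (Num.max 0 (- f x))%:E))%E.
  apply: ae_eq_integral => //.
  - exact/measurable_EFinP.
  - apply/measurable_EFinP; apply: measurableT_comp => //.
    apply: measurable_maxr => //; exact: measurableT_comp.
  apply: filterS f0 => x fx _ /=; congr _%:E.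
  by rewrite (max_idPr _) ?opprK// oppr_ge0.
rewrite integral_ge0N; last by move=> x _; rewrite lee_fin le_max lexx.
by rewrite leeNl oppe0 integral_ge0// => x _; rewrite lee_fin le_max lexx.
Qed.

(** Averaging over measure-preserving maps: [J] itself has no sign, but the sum of
  its four images does. The maps will reflect one or both of two variables. *)
Lemma integral_sym4 (m : {measure set X -> \bar R}) (J G : X -> R) (f g h : X -> X) :
  mpres m f -> mpres m g -> mpres m h ->
  m.-integrable setT (EFin \o J) -> (\int[m]_x (J x)%:E = 0)%E ->
  measurable_fun setT G -> (forall x, 0 <= G x) ->
  (forall x, G x <= J x + J (f x) + J (g x) + J (h x)) ->
  {ae m, forall x, G x = 0}.
Proof.
move=> pf pg ph Ji J0 mG G0 GJ; apply: ge0_integral_eq0 => //.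
have hi k : mpres m k -> m.-integrable setT (EFin \o (J \o k)) /\
    (\int[m]_x (J (k x))%:E = 0)%E.
  by move=> pk; split; [exact: (mpres_integrable pk Ji)|rewrite (mpres_integral pk Ji)].
have [fi fE] := hi f pf; have [gi gE] := hi g pg; have [ki kE] := hi h ph.
have [i1 E1] := integrableD_EFin Ji fi.
have [i2 E2] := integrableD_EFin i1 gi.
have [i3 E3] := integrableD_EFin i2 ki.
apply: (@le_trans _ _ (\int[m]_x (J x + (J \o f) x + (J \o g) x + (J \o h) x)%:E)%E).
  apply: ge0_le_integral => //.
  - by move=> x _; rewrite lee_fin.
  - exact/measurable_EFinP.
  - by case/integrableP : i3.
  - by move=> x _; rewrite lee_fin; exact: GJ.
rewrite E3 E2 E1 J0 /=.
by rewrite fE gE kE !adde0.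
Qed.

End integral_tools.

Section ae_product.
Context d (X : measurableType d) (R : realType).
Variable m : {sigma_finite_measure set X -> \bar R}.

Lemma ae_prod (P : X -> Prop) : {ae m, forall x, P x} ->
  {ae (m \x m)%E, forall p, P p.1 /\ P p.2}.
Proof.
move=> [N [mN N0 PN]].
have m1 : (m \x m)%E (N `*` setT) = 0%E
  by rewrite product_measure1E//; apply: etrans (mul0e (m setT)); congr (_ * _)%E.
have m2 : (m \x m)%E (setT `*` N) = 0%E
  by rewrite product_measure1E//; apply: etrans (mule0 (m setT)); congr (_ * _)%E.
exists ((N `*` setT) `|` (setT `*` N)); split.
- by apply: measurableU; exact: measurableX.
- by apply: null_set_setU => //; exact: measurableX.
move=> [x y] /= /not_andP[/PN Nx|/PN Ny]; [left|right]; split => //.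
Qed.

(** For a point [x] with [f x] nonzero the section [w (x, _)] would vanish almost
  everywhere. *)
Lemma ae_prod_weight (f : X -> R) (w : X * X -> R) :
  measurable_fun setT f -> measurable_fun setT w ->
  (forall p, 0 <= w p) ->
  (forall x, ~ {ae m, forall y, w (x, y) = 0}) ->
  {ae (m \x m)%E, forall p, f p.1 ^+ 2 * w p = 0} -> {ae m, forall x, f x = 0}.
Proof.
move=> mf mw w0 nw G0.
pose G (p : X * X) := f p.1 ^+ 2 * w p.
have mG : measurable_fun setT G.
  apply: measurable_funM => //; apply: measurable_funX.
  exact: measurableT_comp mf measurable_fst.
have G_ge0 p : 0 <= G p by rewrite mulr_ge0 ?sqr_ge0.
have mEG : measurable_fun setT (EFin \o G) by exact/measurable_EFinP.
have I0 : (\int[m \x m]_p (G p)%:E = 0)%E.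
  rewrite (ae_eq_integral (cst 0%E)) ?integral0//.
  by apply: filterS G0 => p Gp _; rewrite /G Gp.
rewrite (fubini_tonelli1 (EFin \o G) mEG) in I0; last by move=> p; rewrite /= lee_fin.
have mF : measurable_fun setT (fubini_F m (EFin \o G)).
  by apply: measurable_fun_fubini_tonelli_F => // p; rewrite /= lee_fin.
have F0 x : (0 <= fubini_F m (EFin \o G) x)%E.
  by apply: integral_ge0 => y _; rewrite /= lee_fin.
have : ae_eq m setT (fubini_F m (EFin \o G)) (cst 0%E).
  apply/ae_eq_integral_abs => //; rewrite -[RHS]I0; apply: eq_integral => x _.
  by rewrite gee0_abs.
apply: filterS => x /(_ I) Fx.
apply: contrapT => fx; apply: (nw x).
have mGx : measurable_fun setT (fun y => G (x, y)).
  exact: measurableT_comp mG (measurable_pair1 x).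
have : {ae m, forall y, G (x, y) = 0}.
  by apply: ge0_integral_eq0 => //; rewrite -[leRHS]Fx.
apply: filterS => y /eqP; rewrite mulf_eq0 sqrf_eq0 /= => /orP[/eqP//|/eqP//].
Qed.

End ae_product.

(** * The energy form and the sign of the solution *)
Lemma negpart_antimono (R : realType) (a b : R) :
  (a - b) * (Num.max 0 (- a) - Num.max 0 (- b)) <= 0.
Proof.
rewrite !maxEle; have [ha|ha] := leP 0 (- a); have [hb|hb] := leP 0 (- b).
- by have := sqr_ge0 (a - b); nra.
- by rewrite subr0 mulr_le0_ge0//; lra.
- by rewrite sub0r mulr_ge0_le0//; lra.
- by rewrite subrr mulr0.
Qed.

Section Hs_theory.
Context {R : realType} {n : nat}.
Variable s : R.
Hypotheses (n1 : (1 <= n)%N) (s0 : 0 < s) (s1 : s < 1).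
Local Notation mu := (lebesgue_rV R n).
Local Notation T := 'rV[R]_n.
Local Notation gag := (@gagliardo R n s).
Implicit Types u v : T -> R.

Lemma Hs_measurable u : Hs s u -> measurable_fun setT u.
Proof. by case/HsP. Qed.

Lemma Hs_mono v (F : T * T -> R) : measurable_fun setT v -> measurable_fun setT F ->
  (\int[mu]_x ((v x) ^+ 2)%:E < +oo)%E ->
  (forall p, gag v v p <= F p) -> (\int[mu \x mu]_p (F p)%:E < +oo)%E -> Hs s v.
Proof.
move=> mv mF v2 vF iF; apply/HsP; split => //; apply: le_lt_trans iF.
apply: ge0_le_integral => //.
- by move=> p _; rewrite lee_fin gagliardo_ge0.
- by apply/measurable_EFinP; exact: measurable_gagliardo.
- by apply/measurable_EFinP.
- by move=> p _; rewrite lee_fin.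
Qed.

(** It applies to positive and negative parts. *)
Lemma Hs_contraction u v : Hs s u -> measurable_fun setT v ->
  (forall x, `|v x| <= `|u x|) -> (forall x y, `|v x - v y| <= `|u x - u y|) ->
  Hs s v.
Proof.
move=> /HsP[mu_ u2 ui] mv vu vuu.
apply: (Hs_mono mv (measurable_gagliardo s mu_ mu_)) => //.
- apply: le_lt_trans u2; apply: ge0_le_integral => //.
  + by move=> x _; rewrite lee_fin sqr_ge0.
  + by apply/measurable_EFinP; exact: measurable_funX.
  + by apply/measurable_EFinP; exact: measurable_funX.
  + move=> x _; rewrite lee_fin -[leLHS]real_normK ?num_real//.
    by rewrite -[leRHS]real_normK ?num_real// ler_sqr ?nnegrE.
- move=> p; rewrite ler_wpM2r ?fker_ge0// -!expr2.
  rewrite -[leLHS]real_normK ?num_real//.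
  by rewrite -[leRHS]real_normK ?num_real// ler_sqr ?nnegrE.
Qed.

Lemma Hs_gagliardo_int u v : Hs s u -> Hs s v ->
  (mu \x mu)%E.-integrable setT (EFin \o gag u v).
Proof.
move=> /HsP[mu_ _ ui] /HsP[mv _ vi].
have iD w : measurable_fun setT w -> (\int[mu \x mu]_p (gag w w p)%:E < +oo)%E ->
    (mu \x mu)%E.-integrable setT (EFin \o gag w w).
  move=> mw wi; apply/integrableP; split.
    by apply/measurable_EFinP; exact: measurable_gagliardo.
  apply: le_lt_trans wi; apply: ge0_le_integral => //.
  - by apply: measurableT_comp => //; apply/measurable_EFinP; exact: measurable_gagliardo.
  - by apply/measurable_EFinP; exact: measurable_gagliardo.
  - by move=> p _ /=; rewrite lee_fin ger0_norm ?gagliardo_ge0.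
have [i12 _] := integrableD_EFin (iD u mu_ ui) (iD v mv vi).
apply: le_integrable i12 => //.
  by apply/measurable_EFinP; exact: measurable_gagliardo.
move=> p _ /=; rewrite lee_fin [leRHS]ger0_norm ?addr_ge0 ?gagliardo_ge0//.
rewrite /gagliardo normrM (ger0_norm (fker_ge0 _ _)) -mulrDl ler_wpM2r ?fker_ge0//.
move: (u p.1 - u p.2) (v p.1 - v p.2) => a b; rewrite ler_norml; nra.
Qed.

Lemma frac_formE u v : Hs s u -> Hs s v ->
  (frac_form s u v = (frac_const n s / 2)%:E * \int[mu \x mu]_p (gag u v p)%:E)%E.
Proof.
move=> hu hv; congr (_ * _)%E.
exact: (integral12_prod_meas1 (Hs_gagliardo_int hu hv)).
Qed.

Let c20 : 0 < frac_const n s / 2.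
Proof. by rewrite divr_gt0// frac_const_gt0. Qed.

Lemma frac_form_le0 u v : Hs s u -> Hs s v ->
  {ae (mu \x mu)%E, forall p, gag u v p <= 0} -> (frac_form s u v <= 0)%E.
Proof.
move=> hu hv uv; rewrite frac_formE// -(mule0 (frac_const n s / 2)%:E).
apply: lee_wpmul2l; first by rewrite lee_fin ltW.
apply: ae_le_integral_le0 => //.
exact: measurable_gagliardo (Hs_measurable hu) (Hs_measurable hv).
Qed.

Lemma frac_form_eq0 u v : Hs s u -> Hs s v -> frac_form s u v = 0%E ->
  (\int[mu \x mu]_p (gag u v p)%:E = 0)%E.
Proof.
move=> hu hv; rewrite frac_formE// => /eqP; rewrite mule_eq0 => /orP[|/eqP//].
by rewrite eqe gt_eqF.
Qed.

Lemma frac_form_ae u u' v : Hs s u -> Hs s u' -> Hs s v ->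
  {ae mu, forall x, u x = u' x} -> frac_form s u v = frac_form s u' v.
Proof.
move=> hu hu' hv uu'; rewrite !frac_formE//; congr (_ * _)%E.
apply: ae_eq_integral => //.
- apply/measurable_EFinP; exact: measurable_gagliardo (Hs_measurable hu) (Hs_measurable hv).
- apply/measurable_EFinP; exact: measurable_gagliardo (Hs_measurable hu') (Hs_measurable hv).
by apply: filterS (ae_prod uu') => p [p1 p2] _; rewrite /gagliardo p1 p2.
Qed.

Lemma integral_supp (Omega : set T) (f : T -> R) : measurable Omega ->
  (forall x, ~ Omega x -> f x = 0) ->
  (\int[mu]_(x in Omega) (f x)%:E = \int[mu]_x (f x)%:E)%E.
Proof.
move=> mO f0; rewrite integral_mkcond; apply: eq_integral => x _.
rewrite patchE; case: ifPn => // /negP xO; rewrite f0// => Ox; apply: xO.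
by rewrite inE.
Qed.

Lemma Hs_integrable (Omega : set T) u : measurable Omega -> bounded_set Omega ->
  Hs s u -> (forall x, ~ Omega x -> u x = 0) -> mu.-integrable setT (EFin \o u).
Proof.
move=> mO bO /HsP[mu_ u2 _] u0.
have i1 : mu.-integrable setT (EFin \o (\1_Omega : T -> R)).
  apply/integrableP; split; first exact/measurable_EFinP.
  under eq_integral do rewrite /= ger0_norm//.
  by rewrite integral_indic// setIT; exact: lebesgue_rV_bounded.
have i2 : mu.-integrable setT (EFin \o (fun x => u x ^+ 2)).
  apply/integrableP; split; first by apply/measurable_EFinP; exact: measurable_funX.
  rewrite (eq_integral (fun x => (u x ^+ 2)%:E))// => x _ /=.
  by rewrite ger0_norm ?sqr_ge0.
have [i12 _] := integrableD_EFin i1 i2.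
apply: le_integrable i12 => //; first exact/measurable_EFinP.
move=> x _ /=; rewrite lee_fin indicE.
have [xO|xO] := pselect (Omega x); last by rewrite u0// normr0.
rewrite mem_set// [leRHS]ger0_norm ?addr_ge0 ?sqr_ge0//.
rewrite -[X in X + _]/(1 : R); move: (u x) => a.
have := sqr_ge0 (a - 1); have := sqr_ge0 (a + 1); rewrite ler_norml; lra.
Qed.

Section weak_solution.
Variables (Omega : set T) (u : T -> R).
Hypotheses (oO : open Omega) (hu : torsion_weak_solution s Omega u).

Let hHs : Hs s u. Proof. by case: hu => -[]. Qed.
Let u0 x : ~ Omega x -> u x = 0. Proof. by case: hu => -[_ +] _; apply. Qed.
Let mO : measurable Omega. Proof. exact: open_measurable_rV. Qed.

(** Testing with the negative part gives an energy that is at most 0 and equals its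
  integral. *)
Lemma weak_solution_ge0 : {ae mu, forall x, 0 <= u x}.
Proof.
pose v x := Num.max 0 (- u x).
have mu_ := Hs_measurable hHs.
have mv : measurable_fun setT v.
  by apply: measurable_maxr => //; exact: measurableT_comp.
have hv : Hs s v.
  apply: (Hs_contraction hHs mv) => [x|x y]; rewrite /v.
    by rewrite -[leRHS]normrN maxEle; case: ifP; rewrite ?normr0.
  move: (u x) (u y) => a b; rewrite -[leRHS]normrN !maxEle.
  have [ha|ha] := leP 0 (- a); have [hb|hb] := leP 0 (- b);
    rewrite ?opprB ?subrr ?normr0//.
  - by rewrite opprK addrC distrC.
  - by rewrite subr0 ger0_norm// ler_normr; apply/orP; left; lra.
  - by rewrite sub0r normrN ger0_norm// ler_normr; apply/orP; right; lra.
have v0 x : ~ Omega x -> v x = 0.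
  by move=> Ox; rewrite /v u0// oppr0 maxxx.
have E := hu.2 v (conj hv v0).
have vge0 x : 0 <= v x by rewrite /v le_max lexx.
have le0 : (frac_form s u v <= 0)%E.
  apply: frac_form_le0 => //; apply: aeW => p.
  apply: mulr_le0_ge0; last exact: fker_ge0.
  exact: negpart_antimono.
rewrite E integral_supp// in le0.
apply: filterS (ge0_integral_eq0 mv vge0 le0) => x.
rewrite /v maxEle; case: ifPn => [_ /eqP|]; first by rewrite oppr_eq0 => /eqP ->.
by rewrite -ltNge oppr_lt0 => /ltW.
Qed.

(** A representative that is nonnegative everywhere, which frees later arguments
  from one exceptional set. *)
Lemma weak_solution_pospart :
  exists2 v, torsion_weak_solution s Omega v &
    (forall x, 0 <= v x) /\ {ae mu, forall x, u x = v x}.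
Proof.
pose v x := Num.max 0 (u x).
have uv : {ae mu, forall x, u x = v x}.
  by apply: filterS weak_solution_ge0 => x ux; rewrite /v max_r.
have mu_ := Hs_measurable hHs.
have mv : measurable_fun setT v by exact: measurable_maxr.
have hv : Hs s v.
  apply: (Hs_contraction hHs mv) => [x|x y]; rewrite /v.
    by rewrite maxEle; case: ifP; rewrite ?normr0.
  move: (u x) (u y) => a b; rewrite !maxEle.
  have [ha|ha] := leP 0 a; have [hb|hb] := leP 0 b; rewrite ?subrr ?normr0//.
  - by rewrite subr0 ger0_norm// ler_normr; apply/orP; left; lra.
  - by rewrite sub0r normrN ger0_norm// ler_normr; apply/orP; right; lra.
exists v; last by split => // x; rewrite /v le_max lexx.
split; first by split => // x Ox; rewrite /v u0// maxxx.
have vu : {ae mu, forall x, v x = u x} by apply: filterS uv.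
move=> phi hphi; rewrite -(hu.2 phi hphi).
exact: (frac_form_ae hv hHs hphi.1 vu).
Qed.

End weak_solution.

End Hs_theory.

(** * The maximum principle for the reflected solution *)
Section chi.
Context {R : realType}.
Implicit Types (a k : R) (b : bool).

(** Positive part on the right ([b] true) and negative part on the left: applied to
  an odd function, it yields the odd extension of its positive part on the
  right. *)
Definition chi b a := if b then Num.max 0 a else Num.min 0 a.

Lemma chiN b a : chi (~~ b) (- a) = - chi b a.
Proof. by case: b; rewrite /= ?oppr_max ?oppr_min oppr0. Qed.

Lemma chi0 b : chi b 0 = 0.
Proof. by case: b; rewrite /= ?maxxx ?minxx. Qed.

Lemma chi_le b a : chi b a ^+ 2 <= a ^+ 2.
Proof.
case: b; rewrite /= ?maxEle ?minEle; case: ifP => h //; rewrite expr0n sqr_ge0//.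
Qed.

(** Let [p], [q] be the positive parts. Since [p * a = p ^+ 2], the brackets add up
  to [2 * (p ^+ 2 + q ^+ 2)]; the first is nonnegative and carries the larger
  weight [k1], unless it vanishes. *)
Let core a a' k1 k2 : 0 <= k1 -> 0 <= k2 -> k2 <= k1 \/ a = a' ->
  2 * (chi true a ^+ 2 + chi true a' ^+ 2) * Num.min k1 k2 <=
  k1 * ((chi true a - chi true a') * (a - a')) +
  k2 * ((chi true a + chi true a') * (a + a')).
Proof.
move=> k10 k20 h; rewrite /=; set p := Num.max 0 a; set q := Num.max 0 a'.
have [pa qa] : p * a = p ^+ 2 /\ q * a' = q ^+ 2.
  rewrite /p /q !maxEle; split; case: ifP => // _; rewrite ?mul0r ?expr0n//= expr2//.
have A0 : 0 <= (p - q) * (a - a').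
  rewrite /p /q !maxEle; have [h1|h1] := leP 0 a; have [h2|h2] := leP 0 a'.
  - by rewrite -expr2 sqr_ge0.
  - by rewrite subr0 mulr_ge0//; lra.
  - by rewrite sub0r mulr_le0//; lra.
  - by rewrite subrr mul0r.
have AB : (p - q) * (a - a') + (p + q) * (a + a') = 2 * (p ^+ 2 + q ^+ 2).
  by rewrite -pa -qa; ring.
set A := (p - q) * _ in A0 AB *; set B := (p + q) * _ in AB *.
have S0 : 0 <= 2 * (p ^+ 2 + q ^+ 2) by rewrite mulr_ge0// addr_ge0 ?sqr_ge0.
case: h => [k21|aa].
  by rewrite (min_idPr k21) -AB mulrDl mulrC [B * _]mulrC lerD2r ler_wpM2r.
have AE : A = 0 by rewrite /A aa subrr mulr0.
rewrite AE add0r in AB; rewrite AE mulr0 add0r -AB [leRHS]mulrC ler_wpM2l//.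
  by rewrite AB.
by rewrite ge_min lexx orbT.
Qed.

(** The sum of the energy integrand over a pair of points and its mirror images,
  for an odd function with values [a], [a'] at the two points: [k1] is the kernel
  between them, [k2] the kernel between one and the mirror image of the other. The
  alternatives to the comparison of [k1] and [k2] cover coinciding points, where
  the kernel has its conventional value 0. *)
Lemma chi_form_ge b b' a a' k1 k2 : 0 <= k1 -> 0 <= k2 ->
  (b = b' -> k2 <= k1 \/ a = a') -> (b <> b' -> k1 <= k2 \/ a = - a') ->
  2 * (chi b a ^+ 2 + chi b' a' ^+ 2) * Num.min k1 k2 <=
  k1 * ((chi b a - chi b' a') * (a - a')) +
  k2 * ((chi b a + chi b' a') * (a + a')).
Proof.
move=> k10 k20.
have neg c : chi false c = - chi true (- c) by rewrite -chiN opprK.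
case: b; case: b' => h1 h2; rewrite ?neg.
- by apply: core => //; exact: h1.
- have := @core a (- a') k2 k1 k20 k10 (h2 _); rewrite minC sqrrN !opprK [leRHS]addrC.
  by apply.
- have := @core (- a) a' k2 k1 k20 k10; rewrite minC sqrrN => /(_ _)/le_trans; apply.
    by case: h2 => // [|->]; [left|right; rewrite opprK].
  by rewrite le_eqVlt; apply/predU1P; left; ring.
- have := @core (- a) (- a') k1 k2 k10 k20; rewrite !sqrrN => /(_ _)/le_trans; apply.
    by case: h1 => // [|->]; [left|right].
  by rewrite le_eqVlt; apply/predU1P; left; ring.
Qed.

Let core2 a a' : (chi true a - chi true a') ^+ 2 <= (a - a') ^+ 2.
Proof.
rewrite /= !maxEle; have [h1|h1] := leP 0 a; have [h2|h2] := leP 0 a' => //.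
- rewrite subr0; nra.
- rewrite sub0r; nra.
- by rewrite subrr expr0n sqr_ge0.
Qed.

(** For points on different sides the truncation may increase the difference, but
  then the energy of the mirror pair, with its larger kernel, pays for it. *)
Lemma chi_seminorm_le b b' a a' k1 k2 : 0 <= k1 -> 0 <= k2 ->
  (b <> b' -> k1 <= k2 \/ a = - a') ->
  (chi b a - chi b' a') ^+ 2 * k1 <= (a - a') ^+ 2 * k1 + (a + a') ^+ 2 * k2.
Proof.
move=> k10 k20 h.
have same : b = b' -> (chi b a - chi b' a') ^+ 2 <= (a - a') ^+ 2.
  have neg c : chi false c = - chi true (- c) by rewrite -chiN opprK.
  move=> <-; case: b {h}; first exact: core2.
  have E (x y : R) : (- x - - y) ^+ 2 = (x - y) ^+ 2 by ring.
  by rewrite !neg E -[leRHS]E; exact: core2.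
have [bb|/eqP bb] := eqVneq b b'.
  apply: le_trans (ler_wpM2r k10 (same bb)) _.
  by rewrite lerDl mulr_ge0// sqr_ge0.
have opp : (chi b a - chi b' a') ^+ 2 <= (a - a') ^+ 2 + (a + a') ^+ 2.
  have := chi_le b a; have := chi_le b' a'.
  move: (chi b a) (chi b' a') => p q h1 h2.
  have := sqr_ge0 (p + q); nra.
case: (h bb) => [k12|aa].
  apply: le_trans (ler_wpM2r k10 opp) _.
  by rewrite mulrDl lerD2l ler_wpM2l ?sqr_ge0.
have z : (a + a') ^+ 2 = 0 by rewrite aa addNr expr0n.
rewrite z mul0r addr0; rewrite z addr0 in opp.
exact: ler_wpM2r.
Qed.

End chi.

Lemma mpres_id d (X : measurableType d) (R : realType)
  (m : {measure set X -> \bar R}) : mpres m id.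
Proof. by split. Qed.

Lemma integral_comp_le_lty d (X : measurableType d) (R : realType)
    (m : {measure set X -> \bar R}) (f : X -> X) (F : X -> R) :
  mpres m f -> measurable_fun setT F -> (forall p, 0 <= F p) ->
  (\int[m]_p (F p)%:E < +oo)%E -> (\int[m]_p (F p + F (f p))%:E < +oo)%E.
Proof.
move=> pf mF F0 Fi.
have mEF : measurable_fun setT (EFin \o F) by exact/measurable_EFinP.
have mFf : measurable_fun setT (fun p => F (f p)) by exact: measurableT_comp mF pf.1.
rewrite (eq_integral (fun p => (F p)%:E + (F (f p))%:E)%E); last by [].
rewrite ge0_integralD//.
- apply: lte_add_pinfty => //.
  by rewrite (mpres_ge0_integral pf mEF)// => p; rewrite /= lee_fin.
- by move=> p _; rewrite lee_fin.
- by move=> p _; rewrite lee_fin.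
- exact/measurable_EFinP.
Qed.

Lemma integralD_lty d (X : measurableType d) (R : realType)
    (m : {measure set X -> \bar R}) (F G : X -> R) (a b : R) :
  0 <= a -> 0 <= b ->
  measurable_fun setT F -> (forall p, 0 <= F p) -> measurable_fun setT G -> (forall p, 0 <= G p) ->
  (\int[m]_p (F p)%:E < +oo)%E -> (\int[m]_p (G p)%:E < +oo)%E ->
  (\int[m]_p (a * F p + b * G p)%:E < +oo)%E.
Proof.
move=> a0 b0 mF F0 mG G0 Fi Gi.
have h (c : R) (H : X -> R) : 0 <= c -> measurable_fun setT H -> (forall p, 0 <= H p) ->
    (\int[m]_p (H p)%:E < +oo)%E -> (\int[m]_p (c * H p)%:E < +oo)%E.
  move=> c0 mH H0 Hi; rewrite ge0_integral_scale//.
  by apply: lte_mul_pinfty; rewrite ?lee_fin.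
rewrite (eq_integral (fun p => (a * F p)%:E + (b * G p)%:E)%E); last by [].
have mS (c : R) (H : X -> R) : measurable_fun setT H ->
    measurable_fun setT (fun p => (c * H p)%:E).
  by move=> mH; apply/measurable_EFinP; exact: measurable_funM.
rewrite ge0_integralD//.
- by apply: lte_add_pinfty; exact: h.
- by move=> p _; rewrite lee_fin mulr_ge0.
- exact: mS.
- by move=> p _; rewrite lee_fin mulr_ge0.
- exact: mS.
Qed.

Lemma integral_antisym d (X : measurableType d) (R : realType)
    (m : {measure set X -> \bar R}) (f : X -> X) (g : X -> R) :
  mpres m f -> m.-integrable setT (EFin \o g) -> (forall x, g (f x) = - g x) ->
  (\int[m]_x (g x)%:E = 0)%E.
Proof.
move=> pf gi gf; have [r rE] := integrable_fin gi.
have [_] := integrableD_EFin gi (mpres_integrable pf gi : m.-integrable setT (EFin \o (g \o f))).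
rewrite (mpres_integral pf gi) rE.
rewrite (eq_integral (cst 0%E)) ?integral0.
  by rewrite -EFinD => -[r0]; congr _%:E; lra.
by move=> x _; rewrite /= gf subrr.
Qed.

Lemma sqr_le_twice (R : realType) (a b : R) : a ^+ 2 <= 2 * (a ^+ 2 + b ^+ 2).
Proof. by have := sqr_ge0 a; have := sqr_ge0 b; lra. Qed.

(** The left side involves the antisymmetric differences [a - a'] and [b - b'], the
  right side the four terms that the energy of the solution itself contributes. *)
Lemma fold_sum (R : realType) (a a' b b' p q k1 k2 : R) :
  k1 * ((p - q) * ((a - a') - (b - b'))) + k2 * ((p + q) * ((a - a') + (b - b'))) =
  (a - b) * (p - q) * k1 + (a' - b') * (- p - - q) * k1 +
  (a - b') * (p - - q) * k2 + (a' - b) * (- p - q) * k2.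
Proof. by ring. Qed.

Section maximum_principle.
Context {R : realType} {n : nat}.
Variable s : R.
Hypotheses (n1 : (1 <= n)%N) (s0 : 0 < s) (s1 : s < 1).
Local Notation mu := (lebesgue_rV R n).
Local Notation T := 'rV[R]_n.
Local Notation gag := (@gagliardo R n s).
Local Notation ker := (@fker R n s).
Variables (e : T) (l : R).
Hypothesis e1 : dot e e = 1.
Local Notation rf := (refl e l).

Lemma fker_refl x y : ker (rf x - rf y) = ker (x - y).
Proof. by rewrite /fker enorm_reflr. Qed.

Lemma fker_reflC x y : ker (rf x - y) = ker (x - rf y).
Proof. by rewrite /fker enorm_reflC. Qed.

Let mR : mpres mu rf. Proof. exact: mpres_refl. Qed.

Lemma fker_le_same x y : 0 <= (dot x e - l) * (dot y e - l) -> x != y ->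
  ker (x - rf y) <= ker (x - y).
Proof.
move=> h xy; have xy0 : 0 < enorm (x - y) by rewrite enorm_gt0// subr_eq0.
apply: (le_fker s0 xy0); rewrite le_enorm ?enorm_ge0// enorm_sq dot_sub_refl//.
by move: h; set a := _ * _ => h; rewrite -mulrA -/a lerDl mulr_ge0.
Qed.

Lemma fker_le_opp x y : (dot x e - l) * (dot y e - l) <= 0 -> x != rf y ->
  ker (x - y) <= ker (x - rf y).
Proof.
move=> h xy; rewrite -{1}(reflK l e1 y); apply: fker_le_same => //.
by rewrite dot_refl// (_ : 2 * l - dot y e - l = - (dot y e - l)) ?mulrN ?oppr_ge0//; ring.
Qed.

Lemma Hs_refl (u : T -> R) : Hs s u -> Hs s (u \o rf).
Proof.
move=> hu; have mu_ := Hs_measurable hu; case/HsP : hu => _ u2 ui.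
have mur : measurable_fun setT (u \o rf) by exact: measurableT_comp mu_ mR.1.
have mRR := mpres_prod mR mR.
have mg := measurable_gagliardo s mu_ mu_.
apply/HsP; split => //.
  have := mpres_ge0_integral mR (g := fun x => ((u x) ^+ 2)%:E).
  move=> -> //; last by move=> x; rewrite lee_fin sqr_ge0.
  by apply/measurable_EFinP; exact: measurable_funX.
have mEg : measurable_fun setT (EFin \o gag u u) by exact/measurable_EFinP.
have g0 p : (0 <= (EFin \o gag u u) p)%E by rewrite /= lee_fin gagliardo_ge0.
rewrite (eq_integral (fun p => (EFin \o gag u u) (rf p.1, rf p.2))).
  by rewrite (mpres_ge0_integral mRR mEg g0).
by move=> p _; rewrite /gagliardo /= fker_refl.
Qed.

Lemma Hs_sub (u v : T -> R) : Hs s u -> Hs s v -> Hs s (fun x => u x - v x).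
Proof.
move=> hu hv; have mu_ := Hs_measurable hu; have mv := Hs_measurable hv.
case/HsP : hu => _ u2 ui; case/HsP : hv => _ v2 vi.
have sq (a b : R) : (a - b) ^+ 2 <= 2 * a ^+ 2 + 2 * b ^+ 2.
  by have := sqr_ge0 (a + b); nra.
have mgu := measurable_gagliardo s mu_ mu_.
have mgv := measurable_gagliardo s mv mv.
have msq (w : T -> R) : measurable_fun setT w -> measurable_fun setT (fun x : T => w x ^+ 2).
  by move=> mw; exact: measurable_funX.
apply: (Hs_mono _ (F := fun p => 2 * gag u u p + 2 * gag v v p)).
- exact: measurable_funB.
- by apply: measurable_funD; exact: measurable_funM.
- apply: le_lt_trans (integralD_lty (ler0n R 2) (ler0n R 2) (msq _ mu_) (fun p => sqr_ge0 _)
     (msq _ mv) (fun p => sqr_ge0 _) u2 v2).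
  apply: ge0_le_integral => //.
  + by move=> x _; rewrite lee_fin sqr_ge0.
  + by apply/measurable_EFinP; apply: msq; exact: (measurable_funB mu_ mv).
  + apply/measurable_EFinP; apply: measurable_funD; apply: measurable_funM => //; exact: msq.
  + by move=> x _; rewrite lee_fin.
- move=> p; rewrite /gagliardo !mulrA -mulrDl ler_wpM2r ?fker_ge0//.
  by have := sq (u p.1 - u p.2) (v p.1 - v p.2); move=> /=; nra.
- exact: (integralD_lty (ler0n R 2) (ler0n R 2) mgu (gagliardo_ge0 _ _)
     mgv (gagliardo_ge0 _ _) ui vi).
Qed.

Variables (Omega : set T) (u : T -> R).
Hypotheses (oO : open Omega) (bO : bounded_set Omega).
Hypotheses (hu : torsion_weak_solution s Omega u) (ge0u : forall x, 0 <= u x).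
Hypothesis refO : forall x, Omega x -> l < dot x e -> Omega (rf x).

Let w x := u x - u (rf x).
Let b x := l < dot x e.
Let psi x := chi (b x) (w x).

Let uHs : Hs s u. Proof. by case: hu => -[]. Qed.
Let u0 x : ~ Omega x -> u x = 0. Proof. by case: hu => -[_ +] _; apply. Qed.
Let wHs : Hs s w. Proof. exact: (Hs_sub uHs (Hs_refl uHs)). Qed.

Let wR x : w (rf x) = - w x.
Proof. by rewrite /w reflK// opprB. Qed.

Let on_plane x : dot x e = l -> rf x = x.
Proof. by move=> xl; rewrite /refl xl subrr mulr0 scale0r subr0. Qed.

Let psiR x : psi (rf x) = - psi x.
Proof.
rewrite /psi wR /b dot_refl//.
have [xl|xl|xl] := ltgtP (dot x e) l; last first.
- have -> : w x = 0 by rewrite /w on_plane// subrr.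
  by rewrite oppr0 !chi0 oppr0.
- by rewrite -chiN; congr chi; rewrite /=; apply/negbTE; rewrite -leNgt; lra.
- by rewrite -chiN; congr chi; rewrite /=; lra.
Qed.

Let psi0 x : ~ Omega x -> psi x = 0.
Proof.
move=> Ox; rewrite /psi /w u0// sub0r /b.
have [xl|xl|xl] := ltgtP (dot x e) l; last first.
- by rewrite on_plane// u0// oppr0 chi0.
- by rewrite /=; apply/max_idPl; rewrite oppr_le0.
- suff -> : u (rf x) = 0 by rewrite oppr0 chi0.
  apply: u0 => ORx; apply: Ox; rewrite -(reflK l e1 x); apply: refO => //.
  by rewrite dot_refl//; lra.
Qed.

Let mw : measurable_fun setT w. Proof. exact: Hs_measurable wHs. Qed.

Let mpsi : measurable_fun setT psi.
Proof.
apply: measurable_fun_ifT.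
- apply: measurable_fun_ltr => //.
  apply: measurable_sum => i; apply: measurable_funM => //.
  exact: measurable_rV_coord.
- exact: measurable_maxr.
- exact: measurable_minr.
Qed.

Let side x y : b x = b y -> 0 <= (dot x e - l) * (dot y e - l).
Proof.
rewrite /b; have [h1|h1] := ltP l (dot x e) => /esym.
  by move=> h2; rewrite mulr_ge0// subr_ge0 ltW.
by move=> /negbT; rewrite -leNgt => h2; rewrite mulr_le0// subr_le0.
Qed.

Let oside x y : b x <> b y -> (dot x e - l) * (dot y e - l) <= 0.
Proof.
rewrite /b; have [h1|h1] := ltP l (dot x e); have [h2|h2] := ltP l (dot y e) => // _.
  by rewrite mulr_ge0_le0// ?subr_ge0 ?subr_le0// ltW.
by rewrite mulr_le0_ge0// ?subr_ge0 ?subr_le0// ltW.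
Qed.

Let ker_opp x y : b x <> b y -> ker (x - y) <= ker (x - rf y) \/ w x = - w y.
Proof.
move=> bxy; have [->|xy] := eqVneq x (rf y); first by right; exact: wR.
by left; apply: fker_le_opp => //; exact: oside.
Qed.

Let ker_same x y : b x = b y -> ker (x - rf y) <= ker (x - y) \/ w x = w y.
Proof.
move=> bxy; have [->|xy] := eqVneq x y; first by right.
by left; apply: fker_le_same => //; exact: side.
Qed.

Let mI : mpres (mu \x mu)%E (fun p : T * T => (p.1, rf p.2)).
Proof. exact: (mpres_prod (mpres_id mu) mR). Qed.

(** The positive part of [w] cut off at the plane need not have finite energy for
  general [w]; its odd extension does, as [w] is odd. *)
Let psiHs : Hs s psi.
Proof.
have mgw := measurable_gagliardo s mw mw.
have mgwR : measurable_fun setT (fun p => gag w w (p.1, rf p.2)).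
  exact: measurableT_comp mgw mI.1.
apply: (Hs_mono mpsi (F := fun p => gag w w p + gag w w (p.1, rf p.2))).
- exact: (measurable_funD mgw mgwR).
- case/HsP : wHs => _ w2 _; apply: le_lt_trans w2; apply: ge0_le_integral => //.
  + by move=> x _; rewrite lee_fin sqr_ge0.
  + by apply/measurable_EFinP; exact: measurable_funX.
  + by apply/measurable_EFinP; exact: measurable_funX.
  + by move=> x _; rewrite lee_fin chi_le.
- move=> [x y]; rewrite /gagliardo /= -!expr2 wR opprK.
  by apply: chi_seminorm_le; rewrite ?fker_ge0//; exact: ker_opp.
- case/HsP : wHs => _ _ wi.
  exact: (integral_comp_le_lty mI mgw (gagliardo_ge0 _ _) wi).
Qed.

(** The right side of the weak equation is the integral of an odd function. *)
Let form0 : frac_form s u psi = 0%E.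
Proof.
have mO : measurable Omega by exact: open_measurable_rV.
rewrite hu.2// integral_supp//.
exact: (integral_antisym mR (Hs_integrable mO bO psiHs psi0)).
Qed.

(** The energy of [u] and [psi] is zero. Averaged over the reflections of the two
  variables, its integrand bounds [psi ^+ 2] from above, with a weight that is
  positive unless the two points coincide or are mirror images; so [psi] is zero. *)
Lemma reflected_le : {ae mu, forall x, l < dot x e -> u x <= u (rf x)}.
Proof.
suff : {ae mu, forall x, psi x = 0}.
  apply: filterS => x; rewrite /psi /b => + xl; rewrite xl /= => /max_idPl.
  by rewrite subr_le0.
pose m2 (p : T * T) := Num.min (ker (p.1 - p.2)) (ker (p.1 - rf p.2)).
have mker : measurable_fun setT (fun p : T * T => ker (p.1 - p.2)).
  exact: measurable_fker_sub.
have mm2 : measurable_fun setT m2.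
  exact: (measurable_minr mker (measurableT_comp mker mI.1)).
have m20 p : 0 <= m2 p.
  by rewrite /m2 le_min; apply/andP; split; exact: fker_ge0.
have J0 := frac_form_eq0 s0 s1 uHs psiHs form0.
have Ji := Hs_gagliardo_int uHs psiHs.
pose G (p : T * T) := psi p.1 ^+ 2 * m2 p.
have mG : measurable_fun setT G.
  apply: measurable_funM => //; apply: measurable_funX.
  exact: measurableT_comp mpsi measurable_fst.
have G0 p : 0 <= G p by rewrite mulr_ge0 ?sqr_ge0.
have : {ae (mu \x mu)%E, forall p, G p = 0}.
  apply: (integral_sym4 (mpres_prod mR mR) mI (mpres_prod mR (mpres_id mu)) Ji J0 mG G0).
  move=> [x y]; rewrite /G /m2 /gagliardo /= !psiR fker_refl fker_reflC.
  have := @chi_form_ge R (b x) (b y) (w x) (w y) (ker (x - y)) (ker (x - rf y))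
    (fker_ge0 _ _) (fker_ge0 _ _) (@ker_same x y) (@ker_opp x y).
  rewrite -/(psi x) -/(psi y).
  have := m20 (x, y); rewrite /m2 /=; move: (Num.min _ _) => m m_ge0 h.
  apply: (@le_trans _ _ (2 * (psi x ^+ 2 + psi y ^+ 2) * m)).
    by rewrite ler_wpM2r// sqr_le_twice.
  apply: le_trans h _; rewrite le_eqVlt; apply/predU1P; left.
  exact: fold_sum.
apply: ae_prod_weight => // x [N [mN N0 xN]].
have m1 := @measurable_rV_set1 R n.
have : (0 < mu setT)%E by apply: lebesgue_rV_open; [exact: openT|exists 0].
rewrite ltNge => /negP; apply.
have mS : measurable (N `|` ([set x] `|` [set rf x])).
  by apply: measurableU => //; apply: measurableU; exact: m1.
apply: (@le_trans _ _ (mu (N `|` ([set x] `|` [set rf x])))).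
  apply: le_measure; rewrite ?inE//.
  move=> y _; have [[->|->]|xy] := pselect (([set x] `|` [set rf x]) y).
  - by right; left.
  - by right; right.
  left; apply: xN => /eqP; rewrite /m2 /= gt_eqF// lt_min.
  apply/andP; split; apply: fker_gt0; rewrite subr_eq0; apply/eqP => xE; apply: xy.
    by left.
  by right; rewrite xE reflK.
rewrite le_eqVlt; apply/predU1P; left; apply: null_set_setU => //.
  by apply: measurableU; exact: m1.
by apply: null_set_setU; by [exact: m1|exact: lebesgue_rV_set1].
Qed.

End maximum_principle.

(** * Symmetry of the solution and of the domain *)
Lemma ae_ge0_integral_eq0 d (X : measurableType d) (R : realType)
    (m : {measure set X -> \bar R}) (f : X -> R) :
  measurable_fun setT f -> {ae m, forall x, 0 <= f x} ->
  (\int[m]_x (f x)%:E = 0)%E -> {ae m, forall x, f x = 0}.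
Proof.
move=> mf f0 fi; pose g x := Num.max 0 (f x).
have mg : measurable_fun setT g by exact: measurable_maxr.
have fg : {ae m, forall x, g x = f x}.
  by apply: filterS f0 => x fx; rewrite /g max_r.
have : {ae m, forall x, g x = 0}.
  apply: ge0_integral_eq0 => // [x|]; first by rewrite /g le_max lexx.
  rewrite (ae_eq_integral (fun x => (f x)%:E)) ?fi//.
  - exact/measurable_EFinP.
  - exact/measurable_EFinP.
  - by apply: filterS fg => x gf _; rewrite gf.
by move=> g0; apply: filterS (filterI fg g0) => x [gf gx]; rewrite -gf.
Qed.

Lemma integral_fold_opp0 d (X : measurableType d) (R : realType)
    (m : {measure set X -> \bar R}) (f : X -> X) (g : X -> R) :
  mpres m f -> m.-integrable setT (EFin \o g) -> (\int[m]_x (g x)%:E = 0)%E ->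
  (\int[m]_x (- (g (f x) + g x))%:E = 0)%E.
Proof.
move=> pf gi g0.
have gfi : m.-integrable setT (EFin \o (g \o f)) by exact: (mpres_integrable pf gi).
have [hi hE] := integrableD_EFin gfi gi.
have Ni : m.-integrable setT (EFin \o (fun x => - (g (f x) + g x))).
  by apply: eq_integrable (integrableN hi).
have [_] := integrableD_EFin hi Ni.
rewrite hE g0 adde0 [X in (_ = X + _)%E](_ : _ = 0%E); last first.
  by rewrite -g0; exact: (mpres_integral pf gi).
rewrite add0e => <-; rewrite (eq_integral (cst 0%E)) ?integral0//.
by move=> x _; rewrite /= subrr.
Qed.

Lemma bump_form_le0 (R : realType) (a b p q : R) : 0 <= a -> 0 <= b -> 0 <= p -> 0 <= q ->
  a * p = 0 -> b * q = 0 -> (a - b) * (p - q) <= 0.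
Proof.
move=> a0 b0 p0 q0 ap bq; rewrite mulrBl !mulrBr ap bq.
by have := mulr_ge0 a0 q0; have := mulr_ge0 b0 p0; lra.
Qed.

Section symmetry.
Context {R : realType} {n : nat}.
Variable s : R.
Hypotheses (n1 : (1 <= n)%N) (s0 : 0 < s) (s1 : s < 1).
Local Notation mu := (lebesgue_rV R n).
Local Notation T := 'rV[R]_n.
Variables (Omega : set T) (u : T -> R).
Hypotheses (oO : open Omega) (bO : bounded_set Omega).
Hypotheses (hu : torsion_weak_solution s Omega u) (ge0u : forall x, 0 <= u x).

Let uHs : Hs s u. Proof. by case: hu => -[]. Qed.
Let u0 x : ~ Omega x -> u x = 0. Proof. by case: hu => -[_ +] _; apply. Qed.
Let mO : measurable Omega. Proof. exact: open_measurable_rV. Qed.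

(** Against a bump supported where [u] vanishes, the energy of the nonnegative [u] is
  at most 0, whereas the right side of the equation is positive: a nonlocal
  operator sees the values of [u] elsewhere. *)
Lemma weak_solution_nonvanishing (V : set T) : open V -> V `<=` Omega ->
  {ae mu, forall x, V x -> u x = 0} -> V = set0.
Proof.
move=> oV VO uV; apply/seteqP; split => // x0 Vx0; exfalso.
have : nbhs x0 V by exact: open_nbhs_nbhs.
move=> /nbhs_ballP[r /= r0 rV].
pose phi : T -> R := bump x0 r.
have phiHs : Hs s phi by exact: Hs_bump.
have phi0 x : ~ Omega x -> phi x = 0.
  by move=> Ox; apply: bump_out => /rV/VO.
have E := hu.2 phi (conj phiHs phi0).
have uphi : {ae mu, forall x, u x * phi x = 0}.
  apply: filterS uV => x uVx; have [Bx|Bx] := pselect (ball x0 r x).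
    by rewrite uVx ?mul0r//; exact: rV.
  by rewrite /phi bump_out ?mulr0.
have le0 : (frac_form s u phi <= 0)%E.
  apply: frac_form_le0 => //; apply: filterS (ae_prod uphi) => p [h1 h2].
  apply: mulr_le0_ge0; last exact: fker_ge0.
  by apply: bump_form_le0 => //; exact: bump_ge0.
rewrite E integral_supp// in le0.
have : {ae mu, forall x, phi x = 0}.
  by apply: ge0_integral_eq0 => //; [exact: Hs_measurable phiHs|move=> x; exact: bump_ge0].
move=> [N [mN N0 hN]].
have mB : measurable (ball x0 r) by apply: open_measurable_rV; exact: ball_open.
have : (0 < mu (ball x0 r))%E.
  by apply: lebesgue_rV_open; [exact: ball_open|exists x0; exact: ballxx].
rewrite ltNge => /negP; apply; rewrite -N0; apply: le_measure; rewrite ?inE//.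
move=> x Bx; apply: hN => /= px.
move: Bx; rewrite -ball_normE/= => Bx.
by move: px; rewrite /phi /bump max_r; lra.
Qed.

Variables (e : T) (l : R).
Hypothesis e1 : dot e e = 1.
Local Notation rf := (refl e l).

Let mR : mpres mu rf. Proof. exact: mpres_refl. Qed.

Let refl_ball x y r : eball (rf x) r y -> eball x r (rf y).
Proof. by rewrite /eball/= -enorm_reflC. Qed.

(** Where [Omega] sticks out of the closure of its mirror image the solution would
  vanish by symmetry; regularity of the open set removes the closure. *)
Lemma symmetric_domain : regopen Omega -> {ae mu, forall x, u x = u (rf x)} ->
  forall x, Omega x -> Omega (rf x).
Proof.
move=> regO usym x Ox; apply: contrapT => nORx.
pose V := Omega `&` [set y | (~` closure Omega) (rf y)].
have oV : open V.
  apply: openI => //.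
  have oK : open (~` closure Omega) by apply: closed_openC; exact: closed_closure.
  rewrite openE => y /= Ky.
  have : nbhs (rf y) (~` closure Omega) by exact: open_nbhs_nbhs.
  move=> /nbhs_enormP[r r0 rK]; apply/nbhs_enormP; exists r; first exact: r0.
  move=> z yz.
  by apply: rK; apply: refl_ball; rewrite reflK.
have : V = set0.
  apply: (weak_solution_nonvanishing oV); first by move=> y [].
  apply: filterS usym => y -> [_ Ky]; apply: u0 => ORy; apply: Ky.
  exact: subset_closure.
have : nbhs x Omega by exact: open_nbhs_nbhs.
move=> /nbhs_enormP[r r0 rO].
apply/eqP/set0P; apply: contrapT => V0; apply: nORx; rewrite -regO.
apply/nbhs_enormP; exists r; first exact: r0.
move=> y /refl_ball/rO ORy.
apply: contrapT => Ky; apply: V0; exists (rf y); split => //=.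
by rewrite reflK.
Qed.

(** Folding the integral of [u * D] along the plane gives the integral of
  (u o R - u) D, nonnegative by [reflected_le]. The alternative to [0 < D y] admits
  a weight with an exceptional point outside the domain. *)
Lemma symmetric_solution (D : T -> R) (C : R) :
  (forall x, Omega x -> l < dot x e -> Omega (rf x)) ->
  measurable_fun setT D -> (forall y, Omega y -> `|D y| <= C) ->
  (forall y, D (rf y) = - D y) ->
  (forall y, l < dot y e -> 0 < D y \/ u y = u (rf y)) ->
  (\int[mu]_y (u y * D y)%:E = 0)%E -> {ae mu, forall x, u x = u (rf x)}.
Proof.
move=> refO mD DC DR Dpos uD0.
have mu_ := Hs_measurable uHs.
have ui : mu.-integrable setT (EFin \o u) by exact: (Hs_integrable mO bO uHs u0).
have uDi : mu.-integrable setT (EFin \o (fun y => u y * D y)).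
  have Cui := integrableZl measurableT C ui.
  apply: le_integrable Cui => //; first by apply/measurable_EFinP; exact: measurable_funM.
  move=> y _ /=; rewrite lee_fin !normrM.
  have [Oy|Oy] := pselect (Omega y); last by rewrite u0// normr0 mul0r mulr0.
  rewrite mulrC ler_wpM2r//; exact: le_trans (DC y Oy) (ler_norm C).
pose H y := u (rf y) * D y - u y * D y.
have murf : measurable_fun setT (u \o rf) by exact: measurableT_comp mu_ mR.1.
have mH : measurable_fun setT H.
  by apply: measurable_funB; apply: measurable_funM.
have H0 : (\int[mu]_y (H y)%:E = 0)%E.
  rewrite -(integral_fold_opp0 mR uDi uD0); apply: eq_integral => y _.
  by rewrite /H DR mulrN opprD opprK.
have le1 := reflected_le n1 s0 s1 e1 oO bO hu ge0u refO.
have le2 := mpres_ae mR le1.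
have Hge0 : {ae mu, forall y, 0 <= H y}.
  apply: filterS (filterI le1 le2) => y [h1 h2].
  rewrite /H -mulrBl; have [yl|yl|yl] := ltgtP (dot y e) l; last first.
  - by rewrite /refl yl subrr mulr0 scale0r subr0 subrr mul0r.
  - have [Dy|->] := Dpos y yl; last by rewrite subrr mul0r.
    by rewrite mulr_ge0 ?subr_ge0 ?h1// ltW.
  - have yl' : l < dot (rf y) e by rewrite dot_refl// mulr_natl mulr2n -addrA ltrDl subr_gt0.
    have [Dy|->] := Dpos _ yl'; last by rewrite reflK// subrr mul0r.
    rewrite -[D y]opprK -DR reflK// in h2 *.
    by rewrite mulr_le0// ?subr_le0 ?h2// oppr_le0 ltW.
have := ae_ge0_integral_eq0 mH Hge0 H0.
apply: filterS => y; rewrite /H -mulrBl => /eqP; rewrite mulf_eq0 => /orP[|/eqP Dy].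
  by rewrite subr_eq0 => /eqP.
have [yl|yl|yl] := ltgtP (dot y e) l; last first.
- by rewrite /refl yl subrr mulr0 scale0r subr0.
- by have [|//] := Dpos y yl; rewrite Dy ltxx.
- have yl' : l < dot (rf y) e by rewrite dot_refl// mulr_natl mulr2n -addrA ltrDl subr_gt0.
  by have [|->] := Dpos _ yl'; [rewrite DR Dy oppr0 ltxx|rewrite reflK].
Qed.

End symmetry.

(** * The potential on the parallel surface *)
Lemma integral_diff0 d (X : measurableType d) (R : realType)
    (m : {measure set X -> \bar R}) (f g : X -> R) (k : R) :
  m.-integrable setT (EFin \o f) -> m.-integrable setT (EFin \o g) ->
  (\int[m]_x (f x)%:E = \int[m]_x (g x)%:E)%E ->
  (\int[m]_x (k * (f x - g x))%:E = 0)%E.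
Proof.
move=> fi gi fg; have [r rE] := integrable_fin gi.
have di : m.-integrable setT (EFin \o (fun x => f x - g x)).
  by apply: eq_integrable (integrableB measurableT fi gi).
rewrite (eq_integral (fun x => k%:E * (f x - g x)%:E)%E)//.
rewrite integralZl// integralB_EFin// fg rE -EFinB subrr.
by rewrite mule0.
Qed.

Section powR_mvt.
Context {R : realType}.
Variable q : R.

Lemma powR_continuous (x : R) : 0 < x -> continuous_at x (@powR R ^~ q).
Proof.
move=> x0; apply: differentiable_continuous; apply/derivable1_diffP.
by have [] := is_derive1_powR q x0.
Qed.

(** The intermediate point is located by its distance to [x], so that it can be
  followed when [y] tends to [x]. *)
Lemma powR_MVT (x y : R) : 0 < x -> 0 < y -> exists z,
  [/\ Num.min x y <= z, `|z - x| <= `|y - x| &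
   x `^ q - y `^ q = q * z `^ (q - 1) * (x - y)].
Proof.
have ord (a b : R) : 0 < a -> a <= b -> exists z,
    [/\ a <= z, z <= b & b `^ q - a `^ q = q * z `^ (q - 1) * (b - a)].
  move=> a0 ab; have [||z zab E] := @MVT_segment R (@powR R ^~ q) (fun z => q * z `^ (q - 1)) a b ab.
  - move=> z; rewrite in_itv/= => /andP[az _]; apply: is_derive1_powR.
    exact: lt_trans az.
  - apply: continuous_in_subspaceT => z; rewrite inE/= in_itv/= => /andP[az _].
    by apply: powR_continuous; exact: lt_le_trans az.
  by exists z; move: zab; rewrite in_itv/= => /andP[az zb].
move=> x0 y0; have [xy|/ltW yx] := leP x y.
  have [z [xz zy E]] := ord x y x0 xy; exists z; split => //.
    by rewrite !ger0_norm ?subr_ge0// lerD2r.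
  by rewrite -opprB E -mulrN opprB.
have [z [yz zx E]] := ord y x y0 yx; exists z; split => //.
by rewrite !ler0_norm ?subr_le0// lerN2 lerD2r.
Qed.

End powR_mvt.

Section potential.
Context {R : realType} {n : nat}.
Variable s : R.
Hypotheses (n1 : (1 <= n)%N) (s0 : 0 < s) (s1 : s < 1).
Local Notation mu := (lebesgue_rV R n).
Local Notation T := 'rV[R]_n.
Local Notation ker := (@fker R n s).
Variables (Omega : set T) (t : R) (u v : T -> R).
Hypotheses (oO : open Omega) (bO : bounded_set Omega) (O0 : Omega !=set0) (t0 : 0 < t).
Local Notation d x := (dist_set x Omega).
Hypotheses (vHs : Hs s v) (v0 : forall x, ~ Omega x -> v x = 0).

Lemma fker_lt (z z' : T) : 0 < enorm z -> enorm z < enorm z' -> ker z' < ker z.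
Proof.
move=> z0 zz'; have z'0 : 0 < enorm z' by exact: lt_trans zz'.
rewrite ltf_pV2 ?posrE ?powR_gt0//.
by apply: gt0_ltr_powR; rewrite ?nnegrE ?enorm_ge0// ltr_wpDl// mulr_gt0.
Qed.

Lemma parallel_far x y : d x = t -> Omega y -> t <= enorm (x - y).
Proof. by move=> <- Oy; exact: dist_le. Qed.

Lemma parallel_out x : d x = t -> ~ Omega x.
Proof.
move=> dx Ox; have := parallel_far dx Ox.
by rewrite subrr enorm0 leNgt t0.
Qed.

Lemma parallel_bounded : exists N, forall x y, d x = t -> Omega y -> enorm (x - y) <= N.
Proof.
have [M hM] := bounded_enorm bO.
exists (t + 1 + M + M) => x y dx Oy.
have [|z Oz xz] := @dist_lt _ _ Omega x (t + 1) O0; first by rewrite dx ltrDl.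
have h1 := ler_enormB x z y.
have h2 := ler_enormD z (- y); rewrite enormN in h2.
have h3 := hM _ Oz; have h4 := hM _ Oy.
rewrite (le_trans h1)// -addrA lerD//; first exact: ltW.
by rewrite (le_trans h2)// lerD.
Qed.

Let mO : measurable Omega. Proof. exact: open_measurable_rV. Qed.
Let mv := Hs_measurable vHs.
Let vi : mu.-integrable setT (EFin \o v). Proof. exact: (Hs_integrable mO bO vHs v0). Qed.

Let mker x : measurable_fun setT (fun y : T => ker (x - y)).
Proof. exact: (measurableT_comp (measurable_fker s) (lebesgue_rV_subl x).1). Qed.

Lemma integrable_bounded_mul (D : T -> R) (C : R) : measurable_fun setT D ->
  (forall y, Omega y -> `|D y| <= C) ->
  mu.-integrable setT (EFin \o (fun y => v y * D y)).
Proof.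
move=> mD DC; have Cvi := integrableZl measurableT C vi.
apply: le_integrable Cvi => //; first by apply/measurable_EFinP; exact: measurable_funM.
move=> y _ /=; rewrite lee_fin !normrM.
have [Oy|Oy] := pselect (Omega y); last by rewrite v0// normr0 mul0r mulr0.
rewrite mulrC ler_wpM2r//; exact: le_trans (DC y Oy) (ler_norm C).
Qed.

Lemma potential_integrable x : d x = t ->
  mu.-integrable setT (EFin \o (fun y => v y * ker (x - y))).
Proof.
move=> dx; apply: (@integrable_bounded_mul _ ((t `^ (n%:R + 2 * s))^-1)) => // y Oy.
by rewrite ger0_norm ?fker_ge0//; apply: le_fker => //; exact: parallel_far.
Qed.

(** Outside [Omega] the nonlocal normal derivative is minus the constant times the
  potential; dividing uses that the constant is positive. *)
Lemma potential_const : measurable_fun setT u -> (forall x, ~ Omega x -> u x = 0) ->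
  {ae mu, forall x, u x = v x} ->
  (exists c : R, forall x, d x = t -> nonlocal_normal s Omega u x = c%:E) ->
  exists c : R, forall x, d x = t -> (\int[mu]_y (v y * ker (x - y))%:E = c%:E)%E.
Proof.
move=> mu_ u0 uv [c hc]; have k0 := frac_const_gt0 n s0 s1.
exists (- (c / frac_const n s)) => x dx; have := hc x dx.
have Ox := parallel_out dx.
rewrite /nonlocal_normal (integral_supp (f := fun y => (u x - u y) / enorm (x - y) `^ (n%:R + 2 * s)))//; last first.
  by move=> y Oy; rewrite !u0// subrr mul0r.
have pi := potential_integrable dx.
have [r rE] := integrable_fin pi.
have -> : (\int[mu]_y ((u x - u y) / enorm (x - y) `^ (n%:R + 2 * s))%:E =
    (- r)%:E)%E.
  transitivity (\int[mu]_y (- (v y * ker (x - y)))%:E)%E.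
    apply: ae_eq_integral => //.
    - apply/measurable_EFinP; apply: (measurable_funM _ (mker x)).
      exact: measurable_funB.
    - apply/measurable_EFinP; apply: measurableT_comp => //.
      exact: measurable_funM.
    apply: filterS uv => y uvy _; rewrite (u0 x)// uvy sub0r mulNr.
    by [].
  have Ni : mu.-integrable setT (EFin \o (fun y => - (v y * ker (x - y)))).
    by apply: eq_integrable (integrableN pi).
  have [r' r'E] := integrable_fin Ni.
  have [_] := integrableD_EFin pi Ni.
  rewrite rE r'E (eq_integral (cst 0%E)) ?integral0; last first.
    by move=> y _; rewrite /= subrr.
  by move=> [rr]; congr _%:E; lra.
rewrite rE -EFinM => -[kr]; congr _%:E.
by rewrite -kr; field; rewrite gt_eqF.
Qed.

End potential.

Lemma mul1_subN (R : pzRingType) (x y : R) : 1 * (x - y) = - (1 * (y - x)).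
Proof. by rewrite !mul1r opprB. Qed.

Section weights.
Context {R : realType} {n : nat}.
Variable s : R.
Hypotheses (n1 : (1 <= n)%N) (s0 : 0 < s) (s1 : s < 1).
Local Notation mu := (lebesgue_rV R n).
Local Notation T := 'rV[R]_n.
Local Notation ker := (@fker R n s).
Variables (Omega : set T) (t : R) (v : T -> R) (c : R).
Hypotheses (oO : open Omega) (bO : bounded_set Omega) (O0 : Omega !=set0) (t0 : 0 < t).
Local Notation d x := (dist_set x Omega).
Hypotheses (hv : torsion_weak_solution s Omega v) (v_ge0 : forall x, 0 <= v x).
Hypothesis pot : forall x, d x = t -> (\int[mu]_y (v y * ker (x - y))%:E = c%:E)%E.
Variables (e : T) (l : R).
Hypothesis e1 : dot e e = 1.
Hypothesis refO : forall x, Omega x -> l < dot x e -> Omega (refl e l x).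
Local Notation rf := (refl e l).

Let vHs : Hs s v. Proof. by case: hv => -[]. Qed.
Let v0 x : ~ Omega x -> v x = 0. Proof. by case: hv => -[_ +] _; apply. Qed.

Let mker x : measurable_fun setT (fun y : T => ker (x - y)).
Proof. exact: (measurableT_comp (measurable_fker s) (lebesgue_rV_subl x).1). Qed.

Let potD a b : d a = t -> d b = t -> forall k,
  (\int[mu]_y (v y * (k * (ker (a - y) - ker (b - y))))%:E = 0)%E.
Proof.
move=> da db k.
have ai := potential_integrable s0 oO bO t0 vHs v0 da.
have bi := potential_integrable s0 oO bO t0 vHs v0 db.
apply: etrans (integral_diff0 k ai bi (etrans (pot da) (esym (pot db)))).
by apply: eq_integral => y _; rewrite mulrCA mulrBr.
Qed.

Let ker_bound x y : d x = t -> Omega y -> `|ker (x - y)| <= (t `^ (n%:R + 2 * s))^-1.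
Proof.
move=> dx Oy; rewrite ger0_norm ?fker_ge0//.
exact: (le_fker s0 t0 (parallel_far dx Oy)).
Qed.

(** The weight is the difference of the kernels at [a] and at its mirror image; it is
  positive on the side of [a]. At [a] itself the kernel has its conventional value
  0, but [a] lies outside [Omega]. *)
Lemma symmetric_of_pair a : d a = t -> d (rf a) = t -> l < dot a e ->
  {ae mu, forall x, v x = v (rf x)}.
Proof.
move=> da dra al.
(* the factor 1 gives D the form of the difference quotients of the other case *)
pose D y := 1 * (ker (a - y) - ker (rf a - y)).
apply: (@symmetric_solution _ _ _ n1 s0 s1 _ _ oO bO hv v_ge0 e l e1 D
  ((t `^ (n%:R + 2 * s))^-1 + (t `^ (n%:R + 2 * s))^-1)) => //.
- by apply: measurable_funM => //; apply: measurable_funB; exact: mker.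
- move=> y Oy; rewrite /D mul1r (le_trans (ler_normB _ _))// lerD//.
    exact: ker_bound.
  exact: ker_bound.
- move=> y; rewrite /D (fker_refl s l e1 a y) -(fker_reflC s l e1 a y).
  exact: mul1_subN.
- move=> y yl; have [->|ya] := eqVneq y a.
    by right; rewrite !v0//; exact: (parallel_out t0).
  left; rewrite /D mul1r subr_gt0; apply: fker_lt => //.
    by rewrite enorm_gt0// subr_eq0 eq_sym.
  rewrite lt_enorm ?enorm_ge0// enorm_reflC// enorm_sq dot_sub_refl// ltrDl.
  by rewrite -mulrA mulr_gt0// mulr_gt0// subr_gt0.
exact: potD.
Qed.

Let q := (n%:R + 2 * s) / 2.
Let q0 : 0 < q. Proof. by rewrite divr_gt0// ltr_wpDl// mulr_gt0. Qed.

Let kerE z : ker z = dot z z `^ (- q).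
Proof.
rewrite -enorm_sq -powR_mulrn ?enorm_ge0// -powRrM /fker -powRN; congr (_ `^ _).
by rewrite /q; field.
Qed.

(** The difference quotients of the kernel along the merging pairs converge, by
  dominated convergence, to the derivative of the kernel at [a] in the direction
  [e], which is odd under the reflection because [a] lies on the plane. They
  remain bounded on [Omega], which is at distance [t] from all these points. *)
Lemma symmetric_of_tangency a (a_ : nat -> T) (h_ : nat -> R) :
  d a = t -> dot a e = l ->
  (forall k, [/\ d (a_ k) = t, d (a_ k - h_ k *: e) = t & 0 < h_ k]) ->
  a_ k @[k --> \oo] --> a -> h_ k @[k --> \oo] --> 0 ->
  {ae mu, forall x, v x = v (rf x)}.
Proof.
move=> da al hak ca ch.
have [N hN] := parallel_bounded t bO O0.
have N0 : 0 <= N.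
  by case: O0 => y Oy; apply: le_trans (hN a y da Oy); exact: enorm_ge0.
pose W (x y : T) := 2 * q * dot (x - y) (x - y) `^ (- q - 1).
pose D y := W a y * (dot y e - l).
pose C := 2 * q * (t ^+ 2) `^ (- q - 1) * N.
pose D_ k y := (h_ k)^-1 * (ker (a_ k - y) - ker (a_ k - h_ k *: e - y)).
have q20 : 0 <= 2 * q by rewrite mulr_ge0// ltW.
have powR_bound r : t ^+ 2 <= r -> r `^ (- q - 1) <= (t ^+ 2) `^ (- q - 1).
  move=> tr; have t20 : 0 < t ^+ 2 by rewrite exprn_gt0.
  have r0 : 0 < r by exact: lt_le_trans tr.
  rewrite -opprD !powRN lef_pV2 ?posrE ?powR_gt0//.
  by apply: ge0_ler_powR; rewrite ?nnegrE ?(ltW r0) ?(ltW t20)// addr_ge0// ltW.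
have far x y : d x = t -> Omega y -> t ^+ 2 <= dot (x - y) (x - y).
  move=> dx Oy; rewrite -enorm_sq ler_sqr ?nnegrE ?enorm_ge0 ?(ltW t0)//.
  exact: (parallel_far dx Oy).
(* the mean value theorem for r `^ (- q) between the two squared distances, whose
   difference is 2 h_k (dot (a_ k - y) e - h_k / 2) *)
have mvt k y : Omega y -> exists z, [/\ t ^+ 2 <= z,
    `|z - dot (a_ k - y) (a_ k - y)| <=
      `|dot (a_ k - h_ k *: e - y) (a_ k - h_ k *: e - y) - dot (a_ k - y) (a_ k - y)| &
    D_ k y = - (2 * q * z `^ (- q - 1) * (dot (a_ k - y) e - h_ k / 2))].
  move=> Oy; have [dak dbk hk0] := hak k.
  have f1 := far _ _ dak Oy; have f2 := far _ _ dbk Oy.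
  have t20 : 0 < t ^+ 2 by rewrite exprn_gt0.
  have [z [z1 z2 z3]] := powR_MVT (- q) (lt_le_trans t20 f1) (lt_le_trans t20 f2).
  exists z; split => //; first by apply: le_trans z1; rewrite le_min f1.
  rewrite /D_ !kerE z3.
  have -> : dot (a_ k - y) (a_ k - y) -
      dot (a_ k - h_ k *: e - y) (a_ k - h_ k *: e - y) =
      2 * h_ k * (dot (a_ k - y) e - h_ k / 2).
    rewrite addrAC; move: (a_ k - y) => z'.
    by rewrite !dotE e1 (dotC e z'); field.
  by field; rewrite gt_eqF.
have D_bound k y : Omega y -> `|D_ k y| <= C.
  move=> Oy; have [z [z1 _ ->]] := mvt k y Oy; have [dak dbk hk0] := hak k.
  rewrite normrN normrM /C ler_pM//.
    by rewrite normrM (ger0_norm q20) (ger0_norm (powR_ge0 _ _)) ler_wpM2l// powR_bound.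
  have -> : dot (a_ k - y) e - h_ k / 2 =
      (dot (a_ k - y) e + dot (a_ k - h_ k *: e - y) e) / 2.
    by rewrite !dotE e1; field.
  rewrite normrM [`|2^-1|]ger0_norm// ler_pdivrMr//.
  have b1 := le_trans (dot_ler_norm (a_ k - y) e1) (hN _ _ dak Oy).
  have b2 := le_trans (dot_ler_norm (a_ k - h_ k *: e - y) e1) (hN _ _ dbk Oy).
  by rewrite (le_trans (ler_normD _ _))// mulrDr mulr1 lerD.
have Dl y : dot y e - l = - dot (a - y) e by rewrite !dotE al; ring.
have DC y : Omega y -> `|D y| <= C.
  move=> Oy; rewrite normrM /C ler_pM//.
    rewrite /W normrM (ger0_norm q20) (ger0_norm (powR_ge0 _ _)) ler_wpM2l//.
    exact: powR_bound (far _ _ da Oy).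
  by rewrite Dl normrN (le_trans (dot_ler_norm _ e1))// hN.
have mD : measurable_fun setT D.
  have mdot : measurable_fun setT (fun y : T => dot y e).
    apply: measurable_sum => i; apply: measurable_funM => //.
    exact: measurable_rV_coord.
  apply: measurable_funM; last exact: measurable_funB.
  apply: measurable_funM => //.
  apply: (measurableT_comp (measurable_powR (- q - 1))).
  apply: measurable_sum => i; under eq_fun do rewrite !mxE.
  by apply: measurable_funM; apply: measurable_funB => //; exact: measurable_rV_coord.
have mD_ k : measurable_fun setT (D_ k).
  by apply: measurable_funM => //; apply: measurable_funB; exact: mker.
have D_D y : Omega y -> D_ k y @[k --> \oo] --> D y.
  move=> Oy; have /choice[z hz] : forall k, exists z, [/\ t ^+ 2 <= z,
    `|z - dot (a_ k - y) (a_ k - y)| <=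
      `|dot (a_ k - h_ k *: e - y) (a_ k - h_ k *: e - y) - dot (a_ k - y) (a_ k - y)| &
    D_ k y = - (2 * q * z `^ (- q - 1) * (dot (a_ k - y) e - h_ k / 2))].
    by move=> k; exact: mvt.
  have cdote : (dot (a_ k - y) e) @[k --> \oo] --> dot (a - y) e.
    have cd : continuous (fun x : T => dot (x - y) e).
      apply: (@lip_continuous _ _ _ 1) => x x'; rewrite mul1r -dotNl -dotDl opprB addrA subrK.
      exact: dot_ler_norm.
    exact: (continuous_cvg _ (cd a) ca).
  have cdot2 : (dot (a_ k - y) (a_ k - y)) @[k --> \oo] --> dot (a - y) (a - y).
    have cn : enorm (y - a_ k) @[k --> \oo] --> enorm (y - a).
      exact: (continuous_cvg _ (@enorm_sub_continuous R n y a) ca).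
    rewrite -enorm_sq -enormBC.
    have -> : (fun k => dot (a_ k - y) (a_ k - y)) = (fun k => enorm (y - a_ k) * enorm (y - a_ k)).
      by apply/funext => k; rewrite -expr2 enormBC enorm_sq.
    exact: cvgM.
  have cdiff : (dot (a_ k - h_ k *: e - y) (a_ k - h_ k *: e - y) -
      dot (a_ k - y) (a_ k - y)) @[k --> \oo] --> 0.
    have -> : (fun k => dot (a_ k - h_ k *: e - y) (a_ k - h_ k *: e - y) -
      dot (a_ k - y) (a_ k - y)) = (fun k => h_ k * (h_ k - 2 * dot (a_ k - y) e)).
      apply/funext => k; rewrite [a_ k - _ - y]addrAC; move: (a_ k - y) => z'.
      by rewrite !dotE e1 (dotC e z'); ring.
    rewrite -(mul0r (0 - 2 * dot (a - y) e)); apply: cvgM => //.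
    by apply: cvgB => //; apply: cvgM => //; exact: cvg_cst.
  have cz : z k @[k --> \oo] --> dot (a - y) (a - y).
    have -> : z = (fun k => (z k - dot (a_ k - y) (a_ k - y)) + dot (a_ k - y) (a_ k - y)).
      by apply/funext => k; rewrite subrK.
    rewrite -[X in _ --> X]add0r; apply: cvgD => //.
    apply/norm_cvg0P; apply: (squeeze_cvgr _ (cvg_cst 0) (_ : _ @[_ --> \oo] --> 0)); last first.
      by rewrite -(normr0 R); apply: cvg_norm cdiff.
    by apply: nearW => k; rewrite normr_ge0/=; case: (hz k).
  have -> : (fun k => D_ k y) = (fun k => - (2 * q * z k `^ (- q - 1) * (dot (a_ k - y) e - h_ k / 2))).
    by apply/funext => k; case: (hz k).
  have -> : D y = - (W a y * (dot (a - y) e - 0 / 2)).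
    by rewrite /D Dl mul0r subr0 mulrN.
  apply: cvgN; apply: cvgM; last first.
    by apply: cvgB => //; apply: cvgM => //; exact: cvg_cst.
  apply: cvgM; first exact: cvg_cst.
  have tau0 : 0 < dot (a - y) (a - y).
    by apply: lt_le_trans (far a y da Oy); rewrite exprn_gt0.
  exact: (continuous_cvg _ (powR_continuous (q := - q - 1) tau0) cz).
have mv := Hs_measurable vHs.
have vi := Hs_integrable (open_measurable_rV oO) bO vHs v0.
have mf_ k : measurable_fun setT (fun y => (v y * D_ k y)%:E).
  by apply/measurable_EFinP; exact: (measurable_funM mv (mD_ k)).
have mf : measurable_fun setT (fun y => (v y * D y)%:E).
  by apply/measurable_EFinP; exact: (measurable_funM mv mD).
have gi : mu.-integrable setT (fun y => C%:E * (v y)%:E)%E.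
  exact: (integrableZl measurableT C vi).
have vD0 : (\int[mu]_y (v y * D y)%:E = 0)%E.
  have [||_ _ cvg] := @dominated_convergence _ _ _ mu setT measurableT _ _ _ mf_ mf _ gi.
  - apply: aeW => y _; have [Oy|Oy] := pselect (Omega y).
      by apply: cvg_EFin; [exact: nearW|apply: cvgM; [exact: cvg_cst|exact: D_D]].
    rewrite v0// mul0r.
    have -> : (fun k => (0 * D_ k y)%:E) = cst 0%E by apply/funext => k; rewrite mul0r.
    exact: cvg_cst.
  - apply: aeW => y k _; rewrite lee_fin normrM (ger0_norm (v_ge0 y)).
    have [Oy|Oy] := pselect (Omega y); last by rewrite v0// mul0r mulr0.
    by rewrite mulrC ler_wpM2r// D_bound.
  have E : (fun k => \int[mu]_y (v y * D_ k y)%:E)%E = cst 0%E.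
    by apply/funext => k; have [dak dbk _] := hak k; exact: potD.
  rewrite E in cvg; apply/esym.
  exact: (cvg_unique _ (@cvg_cst _ 0%E _ _ _) cvg).
apply: (@symmetric_solution _ _ _ n1 s0 s1 _ _ oO bO hv v_ge0 e l e1 D C) => //.
- have ra : rf a = a by rewrite /refl al subrr mulr0 scale0r subr0.
  move=> y; rewrite /D dot_refl// /W -!enorm_sq -enorm_reflC// ra; ring.
- move=> y yl; left.
  have tau0 : 0 < dot (a - y) (a - y).
    rewrite lt_def dot_ge0 andbT; apply/eqP => /dot_eq0/eqP.
    by rewrite subr_eq0 => /eqP ay; move: yl; rewrite -ay al ltxx.
  apply: mulr_gt0; last by rewrite subr_gt0.
  by apply: mulr_gt0; [exact: mulr_gt0|exact: powR_gt0].
Qed.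

End weights.

(** * The symmetry theorem *)
Unset Implicit Arguments.

Theorem theorem1p1 (R : realType) (n : nat) (hn : (1 <= n)%N)
    (s : R) (hs0 : 0 < s) (hs1 : s < 1)
    (Omega : set 'rV[R]_n) (Omega_neq0 : Omega !=set0)
    (Omega_regular : regopen Omega)
    (Omega_bounded : bounded_set Omega)
    (Omega_reach : (0 < reach (closure Omega))%E)
    (t : R) (ht0 : 0 < t) (htr : (t%:E < reach (closure Omega))%E)
    (u : 'rV[R]_n -> R) (hu : torsion_weak_solution s Omega u)
    (hN : exists c : R, forall x, parallel_set Omega t x ->
       nonlocal_normal s Omega u x = c%:E) :
  is_eball Omega.
Proof.
have oO : open Omega by rewrite -Omega_regular; exact: open_interior.
have [hHs u0] := hu.1.
have [v hv [v_ge0 uv]] := weak_solution_pospart hs0 hs1 oO hu.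
have [vHs v0] := hv.1.
have [c pot] := potential_const hs0 hs1 oO Omega_bounded ht0 vHs v0
  (Hs_measurable hHs) u0 uv hN.
apply: symmetric_is_eball => // e e1.
have [l [a [h [a_ [h_ [lP [da dah alh h0] hak ca ch]]]]]] :=
  critical_plane Omega_neq0 Omega_bounded ht0 e1.
have lO m : l <= m -> forall x, Omega x -> m < dot x e -> Omega (refl e m x).
  move=> lm x; exact: (plane_ok_domain Omega_neq0 Omega_regular Omega_bounded ht0 htr e1 (lP m lm)).
exists l; split; last by move=> m /ltW; exact: lO.
apply: (symmetric_domain hs0 hs1 oO hv v_ge0 e1 Omega_regular).
have [h_eq0|h_gt0] := eqVneq h 0.
  apply: (symmetric_of_tangency hn hs0 hs1 oO Omega_bounded Omega_neq0 ht0 hv v_ge0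
    pot e1 (lO l (lexx l)) da _ hak ca).
    by rewrite -alh h_eq0 mul0r subr0.
  by rewrite -h_eq0.
have hp : 0 < h by rewrite lt_neqAle eq_sym h_gt0.
have al : l < dot a e by rewrite -alh ltrBlDr ltrDl divr_gt0.
have ra : refl e l a = a - h *: e.
  by rewrite /refl -alh; congr (_ - _ *: _); field.
apply: (symmetric_of_pair hn hs0 hs1 oO Omega_bounded ht0 hv v_ge0 pot e1
  (lO l (lexx l)) da) => //.
by rewrite ra.
Qed.
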